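(* The following functions are orbitally unstable under the cubic Szegő flow: (a) $\varphi(z)=\alpha\prod_{j=1}^N\frac{z-\bar p_j}{1-p_jz}$ with $\alpha\in\mathbb C\setminus\{0\}$, $N\ge1$, $0\le|p_j|<1$; (b) $\varphi(z)=\alpha\frac{z^\ell}{1-p^Nz^N}$ with $\alpha\ne0$, $N\ge2$, $0\le\ell\le N-1$, $0<|p|<1$. Here orbital instability of $\varphi$ means: there exist $\varepsilon_0>0$ and a sequence $u_0^{(n)}\in H^{1/2}_+$ with $\|u_0^{(n)}-\varphi\|_{H^{1/2}}\to0$ such that the solutions $u^{(n)}$ of $i\partial_tu=\Pi(|u|^2u)$, $u^{(n)}(0)=u_0^{(n)}$, satisfy $\sup_{t\in\mathbb R}\inf_{(a,b)\in\mathbb T^2}\|u^{(n)}(t)-\varphi_{a,b}\|_{H^{1/2}}\ge\varepsilon_0$ for all $n$, where $\varphi_{a,b}(z)=e^{ia}\varphi(e^{ib}z)$.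
   Context: $L^2_+$ is the Hardy space of the circle (functions $\sum_{k\ge0}\hat u(k)e^{ik\theta}$ in $L^2$, identified with holomorphic functions on the unit disc), $H^{1/2}_+=H^{1/2}\cap L^2_+$, $\Pi$ the Szegő projector onto $L^2_+$. The cubic Szegő equation $i\partial_tu=\Pi(|u|^2u)$ is globally well-posed on $H^{1/2}_+$. *)

(* Defs.v *)
From Stdlib Require Import Reals.
Open Scope R_scope.

Definition Cx : Type := (R * R)%type.
Definition Cre (z : Cx) : R := fst z.
Definition Cim (z : Cx) : R := snd z.
Definition Cof (x : R) : Cx := (x, 0).
Definition C0 : Cx := (0, 0).
Definition C1 : Cx := (1, 0).
Definition Cadd (z w : Cx) : Cx := (Cre z + Cre w, Cim z + Cim w).
Definition Copp (z : Cx) : Cx := (- Cre z, - Cim z).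
Definition Csub (z w : Cx) : Cx := Cadd z (Copp w).
Definition Cmul (z w : Cx) : Cx :=
  (Cre z * Cre w - Cim z * Cim w, Cre z * Cim w + Cim z * Cre w).
Definition Cconj (z : Cx) : Cx := (Cre z, - Cim z).
Definition Cnorm2 (z : Cx) : R := Cre z * Cre z + Cim z * Cim z.
Definition Cnorm (z : Cx) : R := sqrt (Cnorm2 z).
Definition Cinv (z : Cx) : Cx := (Cre z / Cnorm2 z, - Cim z / Cnorm2 z).
Definition Cdiv (z w : Cx) : Cx := Cmul z (Cinv w).
Fixpoint Cpow (z : Cx) (n : nat) : Cx :=
  match n with O => C1 | S m => Cmul z (Cpow z m) end.
Definition Cexpi (a : R) : Cx := (cos a, sin a).
Fixpoint Cprod (N : nat) (f : nat -> Cx) : Cx :=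
  match N with O => C1 | S m => Cmul (Cprod m f) (f m) end.
Fixpoint Csum (N : nat) (f : nat -> Cx) : Cx :=
  match N with O => C0 | S m => Cadd (Csum m f) (f m) end.

Definition Ccv (s : nat -> Cx) (l : Cx) : Prop :=
  Un_cv (fun n => Cre (s n)) (Cre l) /\ Un_cv (fun n => Cim (s n)) (Cim l).

(** * Elements of L^2_+ are given by their Fourier coefficients u = sum_{k>=0} c_k e^{ik theta},
    i.e. by sequences c : nat -> Cx; the function on the disc is z |-> sum c_k z^k. *)

Definition is_taylor (c : nat -> Cx) (f : Cx -> Cx) : Prop :=
  forall z : Cx, Cnorm z < 1 ->
    Ccv (fun M => Csum M (fun k => Cmul (c k) (Cpow z k))) (f z).

Definition is_hnorm (c : nat -> Cx) (r : R) : Prop :=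
  0 <= r /\ infinite_sum (fun k => (1 + INR k) * Cnorm2 (c k)) (r * r).

Definition H12 (c : nat -> Cx) : Prop := exists r, is_hnorm c r.

Definition seq_sub (c d : nat -> Cx) : nat -> Cx := fun k => Csub (c k) (d k).

(** Fourier coefficient n of Pi(|u|^2 u), where u = sum c_k e^{ik theta}:
    sum over j, l >= 0 with k = j + l - n >= 0 of c_j c_l conj(c_k).
    [cubic_coef c n w] : the square-truncated sums (j, l <= M) converge to w. *)
Definition cubic_partial (c : nat -> Cx) (n M : nat) : Cx :=
  Csum (S M) (fun j => Csum (S M) (fun l =>
    if Nat.leb n (j + l)
    then Cmul (Cmul (c j) (c l)) (Cconj (c (j + l - n)%nat))
    else C0)).
Definition cubic_coef (c : nat -> Cx) (n : nat) (w : Cx) : Prop :=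
  Ccv (fun M => cubic_partial c n M) w.

(** [szego_sol u] : u : R -> H^{1/2}_+ is a global solution of the cubic Szego equation
    i d/dt u = Pi(|u|^2 u), with u in Cx(R, H^{1/2}_+), the equation holding
    Fourier-mode by Fourier mode: i c_n'(t) = w, i.e. c_n' = -i w. *)
Definition szego_sol (u : R -> nat -> Cx) : Prop :=
  (forall t, H12 (u t)) /\
  (forall t eps, 0 < eps -> exists delta, 0 < delta /\
     forall s, Rabs (s - t) < delta ->
       exists r, is_hnorm (seq_sub (u s) (u t)) r /\ r < eps) /\
  (forall (n : nat) (t : R), exists w : Cx,
     cubic_coef (u t) n w /\
     derivable_pt_lim (fun s => Cre (u s n)) t (Cim w) /\
     derivable_pt_lim (fun s => Cim (u s n)) t (- Cre w)).

(** phi_{a,b}(z) = e^{ia} phi(e^{ib} z): coefficient k is e^{ia} e^{ikb} c_k *)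
Definition rot (a b : R) (phi : nat -> Cx) : nat -> Cx :=
  fun k => Cmul (Cexpi (a + INR k * b)) (phi k).

(** Orbital instability of phi (given by its coefficient sequence), with
    sup_t inf_{a,b} ||u(t) - phi_{a,b}|| >= eps0 unfolded as:
    for every eps < eps0 there is t and eps' > eps with ||u(t) - phi_{a,b}|| >= eps'
    for all (a,b). *)
Definition orbitally_unstable (phi : nat -> Cx) : Prop :=
  exists eps0 : R, 0 < eps0 /\
  exists u0 : nat -> nat -> Cx,
    (forall n, H12 (u0 n)) /\
    (exists r : nat -> R,
        (forall n, is_hnorm (seq_sub (u0 n) phi) (r n)) /\ Un_cv r 0) /\
    (forall (n : nat) (u : R -> nat -> Cx),
        szego_sol u -> (forall k, u 0 k = u0 n k) ->
        forall eps, eps < eps0 ->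
          exists t eps', eps < eps' /\
            forall a b : R, exists r,
              is_hnorm (seq_sub (u t) (rot a b phi)) r /\ eps' <= r).

Definition blaschke_phi (alpha : Cx) (N : nat) (p : nat -> Cx) (z : Cx) : Cx :=
  Cmul alpha (Cprod N (fun j => Cdiv (Csub z (Cconj (p j))) (Csub C1 (Cmul (p j) z)))).
Definition phi_b (alpha : Cx) (N l : nat) (p : Cx) (z : Cx) : Cx :=
  Cmul alpha (Cdiv (Cpow z l) (Csub C1 (Cmul (Cpow p N) (Cpow z N)))).

(* Main.v *)
(** A solution is followed through a single scalar observable.  With H_u the
    Hankel operator of symbol u and K_u = S^* H_u, the Lax pair shows that
    vectors such as y = 1 (for G = H_u) or y = u (for G = K_u), and their
    images under powers of G, evolve by -i T_{|u|^2} up to a multiple of i G^2.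
    Hence Theta(u) = <G y, G^2 y> satisfies Theta' = -+ i <G^3 y, G^2 y>, and
    the norms of (G^2 - k) G y and (G^2 - k) G^2 y are conserved.  All profiles
    of the theorem satisfy G^3 y = k G y for G = H or G = K, because they have
    a multiple singular value.  Perturbing phi by eps * eta in the frequency 0
    (for H) or 1 (for K) makes both residuals O(eps), so that in the frame
    rotating at speed k the observable has an initial velocity of exact order
    eps and an acceleration O(eps^2) for all times: at time mu / eps it has
    moved by a fixed amount.  As |Theta| is constant on the orbit of phi and
    Theta is locally Lipschitz on H^{1/2}, this is instability.

    Everything is done on Fourier coefficients.  The vectors G^j y live in
    H^{1/4}: it is stable under Hankel operators with symbol in H^{1/2}, and
    its products lie in L^2, which bounds all quartic sums absolutely. *)

From Stdlib Require Import Reals Lra Lia Psatz FunctionalExtensionality.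
From Coquelicot Require Import Rbar Lim_seq Series PSeries.
Require Import Defs.
Open Scope R_scope.

(** * Complex numbers and finite sums *)

Declare Scope cx_scope.
Delimit Scope cx_scope with cx.
Infix "+" := Cadd : cx_scope.
Infix "-" := Csub : cx_scope.
Infix "*" := Cmul : cx_scope.
Notation "- z" := (Copp z) : cx_scope.
Notation "z ^*" := (Cconj z) (at level 2, format "z ^*") : cx_scope.

(** The relation G^3 y = k G y has two origins. In (a), |phi| is constant on the circle, so H_phi
    phi is a constant function. In (b), H and K send the geometric sequence carried by one residue
    class of frequencies modulo N to a multiple of the one carried by another class, and squaring
    returns to the first. The choice between H and K is forced when l = 0. There H preserves the
    class 0, and for every direction eta the first-order velocity of Theta is tangent to the circle
    of constant |Theta|, where it cannot be told from a motion along the orbit. K exchanges the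
    classes 0 and N - 1, distinct because N >= 2; then Theta vanishes at phi, and any nonzero
    velocity makes |Theta| grow. The analytic obstacle is that functions in H^{1/2} may be
    unbounded, so that the form <u x, u y> behind T_{|u|^2} is not controlled on L^2, while time
    derivatives are given mode by mode only. Scalar products are therefore differentiated term by
    term: the derivative of one factor acts as a functional on H^{1/4}, and the H^{1/4} tail of the
    other factor is small uniformly near the given time. *)

Definition Ci : Cx := (0, 1).

Ltac cx_unfold :=
  unfold Csub, Cadd, Cmul, Copp, Cconj, Cnorm2, Cof, C0, C1, Ci, Cre, Cim in *; cbn [fst snd] in *.
Ltac cx_ring := intros; apply injective_projections; cx_unfold; ring.

Lemma Cx_ring : ring_theory C0 C1 Cadd Cmul Csub Copp (@eq Cx).
Proof. constructor; cx_ring. Qed.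
Add Ring Cx_ring_inst : Cx_ring.

Lemma Cconj_add x y : ((x + y)^* = x^* + y^*)%cx. Proof. cx_ring. Qed.
Lemma Cconj_sub x y : ((x - y)^* = x^* - y^*)%cx. Proof. cx_ring. Qed.
Lemma Cconj_opp x : ((- x)^* = - x^*)%cx. Proof. cx_ring. Qed.
Lemma Cconj_mul x y : ((x * y)^* = x^* * y^*)%cx. Proof. cx_ring. Qed.
Lemma Cconj_conj x : (x^*^* = x)%cx. Proof. cx_ring. Qed.
Lemma Cconj_C0 : (C0^* = C0)%cx. Proof. cx_ring. Qed.
Lemma Cconj_C1 : (C1^* = C1)%cx. Proof. cx_ring. Qed.
Lemma Cconj_Cof r : ((Cof r)^* = Cof r)%cx. Proof. cx_ring. Qed.
Lemma Cmul_Cconj x : (x * x^* = Cof (Cnorm2 x))%cx. Proof. cx_ring. Qed.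

Lemma Cnorm2_ge0 z : 0 <= Cnorm2 z.
Proof. unfold Cnorm2; nra. Qed.
Lemma Cnorm_ge0 z : 0 <= Cnorm z.
Proof. apply sqrt_pos. Qed.
Lemma Cnorm_sqr z : Cnorm z * Cnorm z = Cnorm2 z.
Proof. apply sqrt_sqrt, Cnorm2_ge0. Qed.
Lemma Cnorm2_mul x y : Cnorm2 (x * y)%cx = Cnorm2 x * Cnorm2 y.
Proof. cx_unfold; ring. Qed.
Lemma Cnorm2_conj x : Cnorm2 (x^*)%cx = Cnorm2 x.
Proof. cx_unfold; ring. Qed.
Lemma Cnorm2_opp x : Cnorm2 (- x)%cx = Cnorm2 x.
Proof. cx_unfold; ring. Qed.
Lemma Cnorm2_C0 : Cnorm2 C0 = 0.
Proof. cx_unfold; ring. Qed.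
Lemma Cnorm2_Cof r : Cnorm2 (Cof r) = r * r.
Proof. cx_unfold; ring. Qed.
Lemma Cnorm_mul x y : Cnorm (x * y)%cx = Cnorm x * Cnorm y.
Proof. unfold Cnorm; rewrite Cnorm2_mul; apply sqrt_mult; apply Cnorm2_ge0. Qed.
Lemma Cnorm_conj x : Cnorm (x^*)%cx = Cnorm x.
Proof. unfold Cnorm; now rewrite Cnorm2_conj. Qed.
Lemma Cnorm_opp x : Cnorm (- x)%cx = Cnorm x.
Proof. unfold Cnorm; now rewrite Cnorm2_opp. Qed.
Lemma Cnorm_C0 : Cnorm C0 = 0.
Proof. unfold Cnorm; rewrite Cnorm2_C0; apply sqrt_0. Qed.
Lemma Cnorm_Cof r : Cnorm (Cof r) = Rabs r.
Proof. unfold Cnorm; rewrite Cnorm2_Cof; apply sqrt_Rsqr_abs. Qed.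
Lemma Cnorm_C1 : Cnorm C1 = 1.
Proof. change C1 with (Cof 1); rewrite Cnorm_Cof; apply Rabs_R1. Qed.
Lemma Cnorm_Ci : Cnorm Ci = 1.
Proof. unfold Cnorm, Ci, Cnorm2, Cre, Cim; cbn [fst snd].
  replace (0 * 0 + 1 * 1) with 1 by ring; apply sqrt_1. Qed.
Lemma Cre_le z : Rabs (Cre z) <= Cnorm z.
Proof.
  rewrite <- (Rabs_pos_eq (Cnorm z)) by apply Cnorm_ge0.
  apply Rsqr_le_abs_0; unfold Rsqr; rewrite Cnorm_sqr; unfold Cnorm2; nra.
Qed.
Lemma Cim_le z : Rabs (Cim z) <= Cnorm z.
Proof.
  rewrite <- (Rabs_pos_eq (Cnorm z)) by apply Cnorm_ge0.
  apply Rsqr_le_abs_0; unfold Rsqr; rewrite Cnorm_sqr; unfold Cnorm2; nra.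
Qed.
Lemma Cnorm_le_sum z : Cnorm z <= Rabs (Cre z) + Rabs (Cim z).
Proof.
  pose proof (Rabs_pos (Cre z)); pose proof (Rabs_pos (Cim z)).
  rewrite <- (Rabs_pos_eq (Cnorm z)) by apply Cnorm_ge0.
  rewrite <- (Rabs_pos_eq (Rabs (Cre z) + Rabs (Cim z))) by lra.
  apply Rsqr_le_abs_0; unfold Rsqr; rewrite Cnorm_sqr; unfold Cnorm2.
  pose proof (Rsqr_abs (Cre z)) as E1; pose proof (Rsqr_abs (Cim z)) as E2; unfold Rsqr in E1, E2.
  nra.
Qed.
Lemma Cnorm_triang x y : Cnorm (x + y)%cx <= Cnorm x + Cnorm y.
Proof.
  pose proof (Cnorm_ge0 x) as Hx; pose proof (Cnorm_ge0 y) as Hy.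
  rewrite <- (Rabs_pos_eq (Cnorm (x + y)%cx)) by apply Cnorm_ge0.
  rewrite <- (Rabs_pos_eq (Cnorm x + Cnorm y)) by lra.
  apply Rsqr_le_abs_0; unfold Rsqr; rewrite Cnorm_sqr.
  replace ((Cnorm x + Cnorm y) * (Cnorm x + Cnorm y))
    with (Cnorm2 x + Cnorm2 y + 2 * (Cnorm x * Cnorm y))
    by (rewrite <- !Cnorm_sqr; ring).
  pose proof (Cre_le (x * y^*)%cx) as Hc.
  rewrite Cnorm_mul, Cnorm_conj in Hc.
  pose proof (Rle_abs (Cre (x * y^*)%cx)).
  assert (Cnorm2 (x + y)%cx = Cnorm2 x + Cnorm2 y + 2 * Cre (x * y^*)%cx) as -> by (cx_unfold; ring).
  lra.
Qed.
Lemma Cnorm_sub_le x y : Cnorm (x - y)%cx <= Cnorm x + Cnorm y.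
Proof. rewrite <- (Cnorm_opp y). apply Cnorm_triang. Qed.
Lemma Cnorm_sub_sym x y : Cnorm (x - y)%cx = Cnorm (y - x)%cx.
Proof. rewrite <- Cnorm_opp. f_equal. ring. Qed.
Lemma Cnorm_rev_triang x y : Cnorm x - Cnorm y <= Cnorm (x - y)%cx.
Proof.
  pose proof (Cnorm_triang (x - y)%cx y).
  replace (x - y + y)%cx with x in H by ring. lra.
Qed.
Lemma Cnorm_eq0 z : Cnorm z = 0 -> z = C0.
Proof.
  intros H. pose proof (Cnorm_sqr z) as E. rewrite H in E. unfold Cnorm2 in E.
  apply injective_projections; cx_unfold; nra.
Qed.
Lemma Cnorm_pos z : z <> C0 -> 0 < Cnorm z.
Proof.
  intros H. destruct (Cnorm_ge0 z) as [h|E]; [exact h|]. elim H; apply Cnorm_eq0; auto.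
Qed.
Lemma Cnorm2_add_le x y : Cnorm2 (x + y)%cx <= 2 * Cnorm2 x + 2 * Cnorm2 y.
Proof. pose proof (Cnorm2_ge0 (x - y)%cx). cx_unfold; lra. Qed.

Fixpoint rsum (N : nat) (f : nat -> R) : R :=
  match N with O => 0 | S m => rsum m f + f m end.

Lemma rsum_ext M f g : (forall n, (n < M)%nat -> f n = g n) -> rsum M f = rsum M g.
Proof. induction M; intros H; simpl; [easy|]. rewrite IHM, H; auto. Qed.
Lemma rsum_le M f g : (forall n, (n < M)%nat -> f n <= g n) -> rsum M f <= rsum M g.
Proof. induction M; intros H; simpl; [lra|]. apply Rplus_le_compat; auto. Qed.
Lemma rsum_ge0 M f : (forall n, (n < M)%nat -> 0 <= f n) -> 0 <= rsum M f.
Proof. induction M; intros H; simpl; [lra|]. specialize (IHM (fun n h => H n ltac:(lia))). specialize (H M ltac:(lia)). lra. Qed.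
Lemma rsum_plus M f g : rsum M (fun n => f n + g n) = rsum M f + rsum M g.
Proof. induction M; simpl; [ring|]. rewrite IHM; ring. Qed.
Lemma rsum_scal M f k : rsum M (fun n => k * f n) = k * rsum M f.
Proof. induction M; simpl; [ring|]. rewrite IHM; ring. Qed.
Lemma rsum_mono M M' f : (forall n, 0 <= f n) -> (M <= M')%nat -> rsum M f <= rsum M' f.
Proof. intros H; induction 1; simpl; [lra|]. specialize (H m); lra. Qed.
Lemma rsum_sum_f_R0 f n : rsum (S n) f = sum_f_R0 f n.
Proof. induction n; simpl; [ring|]. simpl in IHn. now rewrite <- IHn. Qed.
Lemma rsum_head M f : rsum (S M) f = f 0%nat + rsum M (fun n => f (S n)).
Proof. induction M; simpl; [ring|]. simpl in IHM. rewrite IHM. ring. Qed.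
Lemma rsum_rev M f : rsum M f = rsum M (fun n => f (M - 1 - n)%nat).
Proof.
  revert f. induction M; intros f; [easy|].
  rewrite rsum_head. simpl. rewrite IHM.
  rewrite Rplus_comm. f_equal; [|f_equal; lia].
  apply rsum_ext; intros. f_equal; lia.
Qed.
Lemma rsum_shift_le M m f : (forall n, 0 <= f n) -> rsum M (fun n => f (n + m)%nat) <= rsum (M + m) f.
Proof.
  intros H; induction M; simpl; [apply rsum_ge0; auto|]. lra.
Qed.
Lemma rsum_term_le M f n : (forall n, 0 <= f n) -> (n < M)%nat -> f n <= rsum M f.
Proof.
  intros H h. apply Rle_trans with (rsum (S n) f); [|apply rsum_mono; auto].
  simpl. pose proof (rsum_ge0 n f (fun k _ => H k)). lra.
Qed.
Lemma rsum_cauchy_schwarz M f g :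
  rsum M (fun n => f n * g n) * rsum M (fun n => f n * g n)
  <= rsum M (fun n => f n * f n) * rsum M (fun n => g n * g n).
Proof.
  induction M; simpl; [lra|].
  set (S := rsum M (fun n => f n * g n)) in *.
  set (A := rsum M (fun n => f n * f n)) in *.
  set (B := rsum M (fun n => g n * g n)) in *.
  assert (HA : 0 <= A) by (apply rsum_ge0; intros; nra).
  assert (HB : 0 <= B) by (apply rsum_ge0; intros; nra).
  set (a := f M); set (b := g M).
  cut (2 * (S * (a * b)) <= A * (b * b) + a * a * B); [nra|].
  apply Rle_trans with (Rabs (2 * (S * (a * b)))); [apply Rle_abs|].
  rewrite <- (Rabs_pos_eq (A * (b * b) + a * a * B)) by nra.
  apply Rsqr_le_abs_0; unfold Rsqr.
  assert (0 <= a * a * (b * b)) by (apply Rmult_le_pos; nra).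
  assert ((S * S) * (a * a * (b * b)) <= A * B * (a * a * (b * b))) by (apply Rmult_le_compat_r; auto).
  assert (0 <= (A * (b * b) - a * a * B) * (A * (b * b) - a * a * B)) by apply Rle_0_sqr.
  lra.
Qed.

Lemma Csum_ext M f g : (forall n, (n < M)%nat -> f n = g n) -> Csum M f = Csum M g.
Proof. induction M; intros H; simpl; [easy|]. rewrite IHM, H; auto. Qed.
Lemma Csum_add M f g : Csum M (fun n => (f n + g n)%cx) = (Csum M f + Csum M g)%cx.
Proof. induction M; simpl; [ring|]. rewrite IHM; ring. Qed.
Lemma Csum_sub M f g : Csum M (fun n => (f n - g n)%cx) = (Csum M f - Csum M g)%cx.
Proof. induction M; simpl; [ring|]. rewrite IHM; ring. Qed.
Lemma Csum_scal M f k : Csum M (fun n => (k * f n)%cx) = (k * Csum M f)%cx.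
Proof. induction M; simpl; [ring|]. rewrite IHM; ring. Qed.
Lemma Csum_conj M f : Csum M (fun n => ((f n)^*)%cx) = ((Csum M f)^*)%cx.
Proof. induction M; simpl; [now rewrite Cconj_C0|]. rewrite IHM, Cconj_add; easy. Qed.
Lemma Csum_zero M f : (forall n, (n < M)%nat -> f n = C0) -> Csum M f = C0.
Proof. induction M; intros H; simpl; [easy|]. rewrite IHM, H; auto; ring. Qed.
Lemma Csum_head M f : Csum (S M) f = (f 0%nat + Csum M (fun n => f (S n)))%cx.
Proof. induction M; simpl; [ring|]. simpl in IHM. rewrite IHM. ring. Qed.
Lemma Csum_split M K f : Csum (M + K) f = (Csum M f + Csum K (fun n => f (M + n)%nat))%cx.
Proof.
  induction K; simpl; [rewrite Nat.add_0_r; ring|].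
  rewrite Nat.add_succ_r; simpl. rewrite IHK; ring.
Qed.
Lemma Csum_rev M f : Csum M f = Csum M (fun n => f (M - 1 - n)%nat).
Proof.
  revert f. induction M; intros f; [easy|].
  rewrite Csum_head. simpl. rewrite IHM.
  replace (M - 0 - M)%nat with 0%nat by lia.
  rewrite (Csum_ext M (fun n => f (S (M - 1 - n))) (fun n => f (M - 0 - n)%nat)) by (intros; f_equal; lia). ring.
Qed.
Lemma Csum_norm_le M f : Cnorm (Csum M f) <= rsum M (fun n => Cnorm (f n)).
Proof.
  induction M; simpl; [rewrite Cnorm_C0; lra|].
  eapply Rle_trans; [apply Cnorm_triang|]. lra.
Qed.
Lemma Csum_re M f : Cre (Csum M f) = rsum M (fun n => Cre (f n)).
Proof. induction M; simpl; [easy|]. now rewrite <- IHM. Qed.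
Lemma Csum_im M f : Cim (Csum M f) = rsum M (fun n => Cim (f n)).
Proof. induction M; simpl; [easy|]. now rewrite <- IHM. Qed.

(** * Convergence of complex sequences and absolutely convergent series *)

Lemma Ccv_norm s l : Ccv s l <->
  (forall eps, 0 < eps -> exists M0, forall M, (M0 <= M)%nat -> Cnorm (s M - l)%cx <= eps).
Proof.
  split.
  - intros [H1 H2] eps He.
    destruct (H1 (eps / 2)) as [M1 h1]; [lra|].
    destruct (H2 (eps / 2)) as [M2 h2]; [lra|].
    exists (max M1 M2); intros M HM.
    specialize (h1 M ltac:(lia)); specialize (h2 M ltac:(lia)). unfold Rdist in *.
    eapply Rle_trans; [apply Cnorm_le_sum|].
    replace (Cre (s M - l)%cx) with (Cre (s M) - Cre l) by (cx_unfold; ring).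
    replace (Cim (s M - l)%cx) with (Cim (s M) - Cim l) by (cx_unfold; ring). lra.
  - intros H; split; intros eps He;
    (destruct (H (eps / 2)) as [M0 h]; [lra|]; exists M0; intros M HM; specialize (h M HM); unfold Rdist).
    + replace (Cre (s M) - Cre l) with (Cre (s M - l)%cx) by (cx_unfold; ring).
      pose proof (Cre_le (s M - l)%cx); lra.
    + replace (Cim (s M) - Cim l) with (Cim (s M - l)%cx) by (cx_unfold; ring).
      pose proof (Cim_le (s M - l)%cx); lra.
Qed.

Lemma Ccv_unique s l l' : Ccv s l -> Ccv s l' -> l = l'.
Proof.
  intros [H1 H2] [H3 H4]. apply injective_projections; eapply UL_sequence; eassumption.
Qed.
Lemma Ccv_ext s s' l : (forall n, s n = s' n) -> Ccv s l -> Ccv s' l.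
Proof.
  intros E [H1 H2]; split; intros eps He.
  - destruct (H1 eps He) as [M h]; exists M; intros; rewrite <- E; auto.
  - destruct (H2 eps He) as [M h]; exists M; intros; rewrite <- E; auto.
Qed.
Lemma Ccv_const z : Ccv (fun _ => z) z.
Proof.
  apply Ccv_norm; intros eps He; exists 0%nat; intros.
  replace (z - z)%cx with C0 by ring. rewrite Cnorm_C0; lra.
Qed.
Lemma Ccv_add s s' l l' : Ccv s l -> Ccv s' l' -> Ccv (fun n => (s n + s' n)%cx) (l + l')%cx.
Proof. intros [H1 H2] [H3 H4]; split; apply CV_plus; auto. Qed.
Lemma Ccv_scal s l k : Ccv s l -> Ccv (fun n => (k * s n)%cx) (k * l)%cx.
Proof.
  rewrite !Ccv_norm; intros H eps He.
  pose proof (Cnorm_ge0 k).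
  destruct (H (eps / (1 + Cnorm k))) as [M0 h]; [apply Rdiv_lt_0_compat; lra|].
  exists M0; intros M HM; specialize (h M HM).
  replace (k * s M - k * l)%cx with (k * (s M - l))%cx by ring. rewrite Cnorm_mul.
  apply Rle_trans with (Cnorm k * (eps / (1 + Cnorm k))); [nra|].
  apply Rmult_le_reg_r with (1 + Cnorm k); [lra|]. field_simplify; nra.
Qed.
Lemma Ccv_sub s s' l l' : Ccv s l -> Ccv s' l' -> Ccv (fun n => (s n - s' n)%cx) (l - l')%cx.
Proof.
  intros H H'. pose proof (Ccv_add _ _ _ _ H (Ccv_scal _ _ (- C1)%cx H')) as E.
  replace (l - l')%cx with (l + - C1 * l')%cx by ring.
  eapply Ccv_ext; [|exact E]. intros; simpl; ring.
Qed.
Lemma Ccv_conj s l : Ccv s l -> Ccv (fun n => ((s n)^*)%cx) (l^*)%cx.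
Proof. intros [H1 H2]; split; [exact H1|]. apply CV_opp; exact H2. Qed.
Lemma Ccv_shift s l m : Ccv s l <-> Ccv (fun n => s (n + m)%nat) l.
Proof.
  rewrite !Ccv_norm; split; intros H eps He; destruct (H eps He) as [M0 h].
  - exists M0; intros; apply h; lia.
  - exists (M0 + m)%nat; intros M HM. replace M with (M - m + m)%nat by lia. apply h; lia.
Qed.
Lemma Ccv_bound s l B M0 : Ccv s l -> (forall M, (M0 <= M)%nat -> Cnorm (s M) <= B) -> Cnorm l <= B.
Proof.
  rewrite Ccv_norm; intros H HB. apply le_epsilon; intros eps He.
  destruct (H eps He) as [M1 h]. specialize (h (max M0 M1) ltac:(lia)).
  specialize (HB (max M0 M1) ltac:(lia)).
  pose proof (Cnorm_rev_triang l (s (max M0 M1))). rewrite Cnorm_sub_sym in H0. lra.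
Qed.

(** A total limit, so that scalar products are plain functions; its value means something only next
    to a [Ccv] statement, through [Ccv_Clim]. Infinite limits are sent to 0 by [real]. *)
Definition Clim (s : nat -> Cx) : Cx :=
  (real (Lim_seq (fun n => Cre (s n))), real (Lim_seq (fun n => Cim (s n)))).

Lemma Ccv_Clim s l : Ccv s l -> Clim s = l.
Proof.
  intros [H1 H2]; apply injective_projections; unfold Clim; cbn [fst snd];
  (erewrite is_lim_seq_unique; [|apply is_lim_seq_Reals; eassumption]); easy.
Qed.

Lemma Ccv_abs f B : (forall M, rsum M (fun n => Cnorm (f n)) <= B) -> Ccv (fun M => Csum M f) (Clim (fun M => Csum M f)).
Proof.
  intros H.
  set (p := fun M => rsum M (fun n => Cnorm (f n))).
  assert (Hp : Cauchy_crit p).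
  { apply CV_Cauchy. apply growing_cv.
    - intros n. unfold p; simpl. pose proof (Cnorm_ge0 (f n)); lra.
    - exists B; intros x [i ->]; apply H. }
  assert (Hd : forall M K, Cnorm (Csum (M + K) f - Csum M f)%cx <= p (M + K)%nat - p M).
  { intros M K. induction K.
    - rewrite Nat.add_0_r. replace (Csum M f - Csum M f)%cx with C0 by ring. rewrite Cnorm_C0; lra.
    - rewrite Nat.add_succ_r; unfold p; simpl; fold (p (M + K)%nat); fold (p M).
      replace (Csum (M + K) f + f (M + K)%nat - Csum M f)%cx
        with ((Csum (M + K) f - Csum M f) + f (M + K)%nat)%cx by ring.
      eapply Rle_trans; [apply Cnorm_triang|]. lra. }
  assert (Hd' : forall M K, Cnorm (Csum M f - Csum K f)%cx <= Rabs (p M - p K)).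
  { intros M K. destruct (Nat.le_ge_cases K M) as [h|h].
    - replace M with (K + (M - K))%nat by lia. eapply Rle_trans; [apply Hd|apply Rle_abs].
    - replace K with (M + (K - M))%nat by lia. rewrite Cnorm_sub_sym, Rabs_minus_sym.
      eapply Rle_trans; [apply Hd|apply Rle_abs]. }
  assert (exists l, Ccv (fun M => Csum M f) l) as [l Hl].
  { destruct (R_complete (fun M => Cre (Csum M f))) as [l1 h1].
    { intros eps He. destruct (Hp eps He) as [N h]; exists N; intros m n Hm Hn.
      unfold Rdist in *. eapply Rle_lt_trans; [|apply (h m n Hm Hn)].
      eapply Rle_trans; [|apply Hd'].
      replace (Cre (Csum m f) - Cre (Csum n f)) with (Cre (Csum m f - Csum n f)%cx) by (cx_unfold; ring).
      apply Cre_le. }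
    destruct (R_complete (fun M => Cim (Csum M f))) as [l2 h2].
    { intros eps He. destruct (Hp eps He) as [N h]; exists N; intros m n Hm Hn.
      unfold Rdist in *. eapply Rle_lt_trans; [|apply (h m n Hm Hn)].
      eapply Rle_trans; [|apply Hd'].
      replace (Cim (Csum m f) - Cim (Csum n f)) with (Cim (Csum m f - Csum n f)%cx) by (cx_unfold; ring).
      apply Cim_le. }
    exists (l1, l2); split; easy. }
  now rewrite (Ccv_Clim _ _ Hl).
Qed.

(** * Weighted sequence spaces *)

Definition dlt (k : nat) : nat -> Cx := fun n => if Nat.eqb n k then C1 else C0.
(** The [m]-th power of the adjoint shift; its adjoint [rsh] is multiplication by [z^m]. *)
Definition shift (m : nat) (x : nat -> Cx) : nat -> Cx := fun n => x (n + m)%nat.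
Definition rsh (m : nat) (x : nat -> Cx) : nat -> Cx :=
  fun n => if Nat.leb m n then x (n - m)%nat else C0.
Definition trunc (M : nat) (x : nat -> Cx) : nat -> Cx := fun n => if Nat.ltb n M then x n else C0.
Definition tail (M : nat) (x : nat -> Cx) : nat -> Cx := fun n => if Nat.ltb n M then C0 else x n.
Definition sadd (x y : nat -> Cx) : nat -> Cx := fun n => (x n + y n)%cx.
Definition sscal (k : Cx) (x : nat -> Cx) : nat -> Cx := fun n => (k * x n)%cx.

Ltac seq_ext n := apply functional_extensionality; intros n.

(* The weights of L^2, H^{1/4} and H^{1/2} on the Fourier side. *)
Definition w1 (n : nat) : R := 1.
Definition wY (n : nat) : R := sqrt (1 + INR n).
Definition wH (n : nat) : R := 1 + INR n.

(** [B] bounds the square of the weighted norm. Bounds on partial sums replace norms, so that every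
    estimate is one on finite sums with an explicit constant. *)
Definition bnd (w : nat -> R) (x : nat -> Cx) (B : R) : Prop :=
  forall M, rsum M (fun n => w n * Cnorm2 (x n)) <= B.
Definition fin (w : nat -> R) (x : nat -> Cx) : Prop := exists B, bnd w x B.

Definition weight (w : nat -> R) : Prop := (forall n, 0 <= w n) /\ (forall n m, (n <= m)%nat -> w n <= w m).

Lemma weight_w1 : weight w1.
Proof. split; unfold w1; intros; lra. Qed.
Lemma weight_wY : weight wY.
Proof.
  split; unfold wY; intros; [apply sqrt_pos|]. apply sqrt_le_1_alt.
  apply le_INR in H; lra.
Qed.
Lemma weight_wH : weight wH.
Proof.
  split; unfold wH; intros; [pose proof (pos_INR n); lra|]. apply le_INR in H; lra.
Qed.
Lemma wY_ge1 n : 1 <= wY n.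
Proof. unfold wY. rewrite <- sqrt_1 at 1. apply sqrt_le_1_alt. pose proof (pos_INR n); lra. Qed.
Lemma wY_sqr n : wY n * wY n = 1 + INR n.
Proof. apply sqrt_sqrt. pose proof (pos_INR n); lra. Qed.
Lemma wY_le_wH n : wY n <= wH n.
Proof. unfold wH. rewrite <- wY_sqr. pose proof (wY_ge1 n); nra. Qed.

Lemma bnd_term_ge0 w x n : weight w -> 0 <= w n * Cnorm2 (x n).
Proof. intros [H _]. apply Rmult_le_pos; [auto|apply Cnorm2_ge0]. Qed.
Lemma bnd_ge0 w x B : bnd w x B -> 0 <= B.
Proof. intros H; exact (H 0%nat). Qed.
Lemma bnd_le w x B B' : bnd w x B -> B <= B' -> bnd w x B'.
Proof. intros H h M. specialize (H M); lra. Qed.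
Lemma bnd_weight w w' x B : (forall n, w n <= w' n) -> bnd w' x B -> bnd w x B.
Proof.
  intros H h M. eapply Rle_trans; [|apply (h M)]. apply rsum_le; intros.
  apply Rmult_le_compat_r; [apply Cnorm2_ge0|auto].
Qed.
Lemma bnd_Y1 x B : bnd wY x B -> bnd w1 x B.
Proof. apply bnd_weight. apply wY_ge1. Qed.
Lemma bnd_HY x B : bnd wH x B -> bnd wY x B.
Proof. apply bnd_weight. apply wY_le_wH. Qed.
Lemma bnd_add w x y A B : weight w -> bnd w x A -> bnd w y B -> bnd w (sadd x y) (2 * A + 2 * B).
Proof.
  intros [Hw _] HA HB M.
  apply Rle_trans with (2 * rsum M (fun n => w n * Cnorm2 (x n)) + 2 * rsum M (fun n => w n * Cnorm2 (y n))).
  - rewrite <- !rsum_scal, <- rsum_plus. apply rsum_le; intros n _.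
    unfold sadd. pose proof (Cnorm2_add_le (x n) (y n)). specialize (Hw n). nra.
  - specialize (HA M); specialize (HB M); lra.
Qed.
Lemma bnd_scal w x A k : bnd w x A -> bnd w (sscal k x) (Cnorm2 k * A).
Proof.
  intros HA M.
  rewrite (rsum_ext M _ (fun n => Cnorm2 k * (w n * Cnorm2 (x n)))).
  - rewrite rsum_scal. apply Rmult_le_compat_l; [apply Cnorm2_ge0|apply HA].
  - intros; unfold sscal; rewrite Cnorm2_mul; ring.
Qed.
Lemma seq_sub_sadd x y : seq_sub x y = sadd x (sscal (- C1)%cx y).
Proof. seq_ext n. unfold seq_sub, sadd, sscal. ring. Qed.
Lemma bnd_sub w x y A B : weight w -> bnd w x A -> bnd w y B -> bnd w (seq_sub x y) (2 * A + 2 * B).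
Proof.
  intros Hw HA HB. rewrite seq_sub_sadd. replace B with (Cnorm2 (- C1)%cx * B) by (cx_unfold; ring).
  apply bnd_add; auto. now apply bnd_scal.
Qed.
Lemma bnd_shift w x A m : weight w -> bnd w x A -> bnd w (shift m x) A.
Proof.
  intros Hw HA M. eapply Rle_trans; [|apply (HA (M + m)%nat)].
  eapply Rle_trans; [|apply (rsum_shift_le M m (fun n => w n * Cnorm2 (x n)))].
  - apply rsum_le; intros n _. unfold shift. apply Rmult_le_compat_r; [apply Cnorm2_ge0|].
    apply Hw; lia.
  - intros; now apply bnd_term_ge0.
Qed.
Lemma bnd_dom w x y A : weight w -> (forall n, Cnorm2 (y n) <= Cnorm2 (x n)) -> bnd w x A -> bnd w y A.
Proof.
  intros [Hw _] H HA M. eapply Rle_trans; [|apply (HA M)]. apply rsum_le; intros.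
  apply Rmult_le_compat_l; auto.
Qed.
Lemma bnd_trunc w x A M : weight w -> bnd w x A -> bnd w (trunc M x) A.
Proof.
  intros Hw. apply bnd_dom; auto. intros n; unfold trunc.
  destruct (Nat.ltb n M); [lra|]. rewrite Cnorm2_C0; apply Cnorm2_ge0.
Qed.
Lemma bnd_dlt w k : weight w -> bnd w (dlt k) (w k).
Proof.
  intros [Hw _] M.
  cut (rsum M (fun n => w n * Cnorm2 (dlt k n)) = if Nat.ltb k M then w k else 0).
  { intros ->. specialize (Hw k). destruct (Nat.ltb k M); lra. }
  induction M; simpl; [easy|]. rewrite IHM. unfold dlt.
  destruct (Nat.eqb_spec M k) as [->|h].
  - rewrite Nat.ltb_irrefl. replace (Nat.ltb k (S k)) with true by (symmetry; apply Nat.ltb_lt; lia).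
    cx_unfold; ring.
  - rewrite Cnorm2_C0. destruct (Nat.ltb_spec k M), (Nat.ltb_spec k (S M)); try lia; ring.
Qed.
Lemma bnd_point w x A n : weight w -> bnd w x A -> w n * Cnorm2 (x n) <= A.
Proof.
  intros Hw HA. eapply Rle_trans; [|apply (HA (S n))].
  apply (rsum_term_le (S n) (fun n => w n * Cnorm2 (x n))); [intros; now apply bnd_term_ge0|lia].
Qed.

Lemma rsum_zero M f : (forall n, (n < M)%nat -> f n = 0) -> rsum M f = 0.
Proof. intros H. induction M; simpl; [easy|]. rewrite IHM, H; auto; ring. Qed.

Lemma bnd_tail_small w x : weight w -> fin w x ->
  forall eps, 0 < eps -> exists M0, forall M, (M0 <= M)%nat -> bnd w (tail M x) eps.
Proof.
  intros Hw [B HB] eps He.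
  set (p := fun M => rsum M (fun n => w n * Cnorm2 (x n))).
  assert (Hp : Cauchy_crit p).
  { apply CV_Cauchy, growing_cv.
    - intros n; unfold p; simpl. pose proof (bnd_term_ge0 w x n Hw); lra.
    - exists B; intros y [i ->]; apply HB. }
  destruct (Hp eps He) as [M0 h]. exists M0. intros M HM K.
  assert (E : forall K, rsum K (fun n => w n * Cnorm2 (tail M x n)) = if Nat.leb K M then 0 else p K - p M).
  { clear K. induction K as [|K IH]; [easy|]. cbn [rsum]. rewrite IH. unfold tail at 1.
    destruct (Nat.ltb_spec K M), (Nat.leb_spec K M), (Nat.leb_spec (S K) M); try lia; try rewrite Cnorm2_C0.
    - ring.
    - replace K with M by lia. unfold p; simpl; ring.
    - unfold p; simpl; ring. }
  rewrite E. destruct (Nat.leb_spec K M); [lra|].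
  assert (Hr : Rdist (p K) (p M) < eps) by (apply h; lia).
  unfold Rdist in Hr. pose proof (Rle_abs (p K - p M)). lra.
Qed.

Lemma fin_Y1 x : fin wY x -> fin w1 x.
Proof. intros [B H]; exists B; now apply bnd_Y1. Qed.
Lemma fin_HY x : fin wH x -> fin wY x.
Proof. intros [B H]; exists B; now apply bnd_HY. Qed.
Lemma fin_add w x y : weight w -> fin w x -> fin w y -> fin w (sadd x y).
Proof. intros Hw [A HA] [B HB]; eexists; eapply bnd_add; eauto. Qed.
Lemma fin_scal w x k : fin w x -> fin w (sscal k x).
Proof. intros [A HA]; eexists; eapply bnd_scal; eauto. Qed.
Lemma fin_sub w x y : weight w -> fin w x -> fin w y -> fin w (seq_sub x y).
Proof. intros Hw [A HA] [B HB]; eexists; eapply bnd_sub; eauto. Qed.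
Lemma fin_shift w x m : weight w -> fin w x -> fin w (shift m x).
Proof. intros Hw [A HA]; eexists; eapply bnd_shift; eauto. Qed.
Lemma fin_trunc w x M : weight w -> fin w x -> fin w (trunc M x).
Proof. intros Hw [A HA]; eexists; eapply bnd_trunc; eauto. Qed.
Lemma fin_dlt w k : weight w -> fin w (dlt k).
Proof. intros Hw; eexists; now apply bnd_dlt. Qed.
Lemma tail_sub M x : tail M x = seq_sub x (trunc M x).
Proof. seq_ext n. unfold tail, seq_sub, trunc. destruct (Nat.ltb n M); ring. Qed.
Lemma trunc_add_tail M x : sadd (trunc M x) (tail M x) = x.
Proof. seq_ext n. unfold tail, sadd, trunc. destruct (Nat.ltb n M); ring. Qed.
Lemma fin_tail w x M : weight w -> fin w x -> fin w (tail M x).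
Proof. intros Hw H. rewrite tail_sub. apply fin_sub; auto. now apply fin_trunc. Qed.

Create HintDb seqfin.
#[local] Hint Resolve weight_w1 weight_wY weight_wH fin_add fin_scal fin_sub fin_shift fin_trunc fin_dlt fin_tail : seqfin.
#[local] Hint Resolve fin_Y1 fin_HY | 5 : seqfin.
Ltac sf := auto 8 with seqfin.

(** * The scalar product of L^2, linear on the left and antilinear on the right *)

Definition ip (x y : nat -> Cx) : Cx := Clim (fun M => Csum M (fun n => (x n * (y n)^*)%cx)).

Lemma rsum_ip_bound M x y A B : bnd w1 x A -> bnd w1 y B ->
  rsum M (fun n => Cnorm (x n * (y n)^*)%cx) <= sqrt A * sqrt B.
Proof.
  intros HA HB.
  rewrite <- sqrt_mult by (eapply bnd_ge0; eauto).
  rewrite <- (sqrt_square (rsum _ _)) by (apply rsum_ge0; intros; apply Cnorm_ge0).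
  apply sqrt_le_1_alt.
  rewrite (rsum_ext M _ (fun n => Cnorm (x n) * Cnorm (y n))) by (intros; now rewrite Cnorm_mul, Cnorm_conj).
  eapply Rle_trans; [apply rsum_cauchy_schwarz|].
  apply Rmult_le_compat; try (apply rsum_ge0; intros; rewrite Cnorm_sqr; apply Cnorm2_ge0).
  - erewrite rsum_ext; [apply (HA M)|]. intros; unfold w1; cbn; rewrite Cnorm_sqr; ring.
  - erewrite rsum_ext; [apply (HB M)|]. intros; unfold w1; cbn; rewrite Cnorm_sqr; ring.
Qed.
Lemma ip_cv x y : fin w1 x -> fin w1 y -> Ccv (fun M => Csum M (fun n => (x n * (y n)^*)%cx)) (ip x y).
Proof.
  intros [A HA] [B HB]. apply Ccv_abs with (sqrt A * sqrt B). intros M. now apply rsum_ip_bound.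
Qed.
Lemma ip_unique x y l : Ccv (fun M => Csum M (fun n => (x n * (y n)^*)%cx)) l -> ip x y = l.
Proof. apply Ccv_Clim. Qed.
Lemma ip_bound x y A B : bnd w1 x A -> bnd w1 y B -> Cnorm (ip x y) <= sqrt A * sqrt B.
Proof.
  intros HA HB. apply (Ccv_bound (fun M => Csum M (fun n => (x n * (y n)^*)%cx)) _ _ 0).
  - apply ip_cv; eexists; eauto.
  - intros M _. eapply Rle_trans; [apply Csum_norm_le|now apply rsum_ip_bound].
Qed.
Lemma ip_conj x y : fin w1 x -> fin w1 y -> ((ip x y)^* = ip y x)%cx.
Proof.
  intros HA HB. symmetry; apply ip_unique.
  eapply Ccv_ext; [|apply Ccv_conj, (ip_cv x y); auto].
  intros M; cbn. rewrite <- Csum_conj. apply Csum_ext; intros. rewrite Cconj_mul, Cconj_conj. ring.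
Qed.
Lemma ip_add_l x y z : fin w1 x -> fin w1 y -> fin w1 z -> (ip (sadd x y) z = ip x z + ip y z)%cx.
Proof.
  intros Hx Hy Hz. apply ip_unique.
  eapply Ccv_ext; [|apply Ccv_add; apply ip_cv; eauto].
  intros M; cbn. rewrite <- Csum_add. apply Csum_ext; intros; unfold sadd; ring.
Qed.
Lemma ip_scal_l k x z : fin w1 x -> fin w1 z -> (ip (sscal k x) z = k * ip x z)%cx.
Proof.
  intros Hx Hz. apply ip_unique.
  eapply Ccv_ext; [|apply Ccv_scal; apply ip_cv; eauto].
  intros M; cbn. rewrite <- Csum_scal. apply Csum_ext; intros; unfold sscal; ring.
Qed.
Lemma ip_add_r x y z : fin w1 x -> fin w1 y -> fin w1 z -> (ip z (sadd x y) = ip z x + ip z y)%cx.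
Proof.
  intros. rewrite <- (ip_conj (sadd x y) z) by sf.
  rewrite ip_add_l, Cconj_add, !ip_conj by auto. easy.
Qed.
Lemma ip_scal_r k x z : fin w1 x -> fin w1 z -> (ip z (sscal k x) = k^* * ip z x)%cx.
Proof.
  intros. rewrite <- (ip_conj (sscal k x) z) by sf.
  rewrite ip_scal_l, Cconj_mul, !ip_conj by auto. easy.
Qed.
Lemma ip_sub_l x y z : fin w1 x -> fin w1 y -> fin w1 z -> (ip (seq_sub x y) z = ip x z - ip y z)%cx.
Proof. intros. rewrite seq_sub_sadd, ip_add_l, ip_scal_l by sf. ring. Qed.
Lemma ip_sub_r x y z : fin w1 x -> fin w1 y -> fin w1 z -> (ip z (seq_sub x y) = ip z x - ip z y)%cx.
Proof. intros. rewrite seq_sub_sadd, ip_add_r, ip_scal_r by sf. rewrite Cconj_opp, Cconj_C1. ring. Qed.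
Lemma ip_finite x y K : (forall n, (K <= n)%nat -> (x n * (y n)^* = C0)%cx) ->
  ip x y = Csum K (fun n => (x n * (y n)^*)%cx).
Proof.
  intros H. apply ip_unique. apply Ccv_shift with K.
  eapply Ccv_ext; [|apply Ccv_const]. intros M; cbn. rewrite Nat.add_comm, Csum_split.
  rewrite (Csum_zero M) by (intros; apply H; lia). ring.
Qed.
Lemma ip_trunc_l M x y : ip (trunc M x) y = Csum M (fun n => (x n * (y n)^*)%cx).
Proof.
  rewrite (ip_finite _ _ M).
  - apply Csum_ext; intros n Hn. unfold trunc. now rewrite (proj2 (Nat.ltb_lt n M) Hn).
  - intros n Hn. unfold trunc. rewrite (proj2 (Nat.ltb_ge n M) Hn). ring.
Qed.
Lemma ip_dlt_r k x : ip x (dlt k) = x k.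
Proof.
  rewrite (ip_finite _ _ (S k)).
  - cbn [Csum]. unfold dlt at 2. rewrite Nat.eqb_refl, Cconj_C1.
    rewrite Csum_zero; [ring|]. intros n Hn. unfold dlt.
    destruct (Nat.eqb_spec n k); [lia|]. rewrite Cconj_C0; ring.
  - intros n Hn. unfold dlt. destruct (Nat.eqb_spec n k); [lia|]. rewrite Cconj_C0; ring.
Qed.
Lemma ip_rsh_r m e a : fin w1 e -> fin w1 a -> ip e (rsh m a) = ip (shift m e) a.
Proof.
  intros He Ha. apply ip_unique. apply Ccv_shift with m.
  eapply Ccv_ext; [|apply ip_cv; [apply fin_shift; sf|exact Ha]].
  intros M; cbn. rewrite Nat.add_comm, Csum_split.
  rewrite (Csum_zero m).
  - match goal with |- ?a = (C0 + ?b)%cx => replace (C0 + b)%cx with b by ring end.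
    apply Csum_ext; intros n _. unfold rsh, shift.
    rewrite (proj2 (Nat.leb_le m (m + n)%nat)) by lia. f_equal; [f_equal; lia|]. f_equal. f_equal. lia.
  - intros n Hn. unfold rsh. rewrite (proj2 (Nat.leb_gt m n) Hn), Cconj_C0. ring.
Qed.
Lemma bnd_rsh m a A : bnd w1 a A -> bnd w1 (rsh m a) A.
Proof.
  intros H M.
  cut (rsum M (fun n => w1 n * Cnorm2 (rsh m a n)) = rsum (M - m) (fun n => w1 n * Cnorm2 (a n))).
  { intros ->; apply H. }
  induction M; [easy|]. cbn [rsum]. rewrite IHM. unfold rsh, w1.
  destruct (Nat.leb_spec m M).
  - replace (S M - m)%nat with (S (M - m)) by lia. easy.
  - replace (S M - m)%nat with 0%nat by lia. replace (M - m)%nat with 0%nat by lia. rewrite Cnorm2_C0. cbn; ring.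
Qed.
Lemma fin_rsh m a : fin w1 a -> fin w1 (rsh m a).
Proof. intros [A H]; exists A; now apply bnd_rsh. Qed.
#[local] Hint Resolve fin_rsh : seqfin.
Lemma ip_rsh_l m e a : fin w1 e -> fin w1 a -> ip (rsh m a) e = ip a (shift m e).
Proof.
  intros. rewrite <- (ip_conj e) by sf. rewrite ip_rsh_r by auto. apply ip_conj; sf.
Qed.
Lemma ip_Csum_l m (k : nat -> Cx) (s : nat -> nat -> Cx) y : (forall p, fin w1 (s p)) -> fin w1 y ->
  ip (fun n => Csum m (fun p => (k p * s p n)%cx)) y = Csum m (fun p => (k p * ip (s p) y)%cx).
Proof.
  intros Hs Hy. cut (fin w1 (fun n => Csum m (fun p => (k p * s p n)%cx)) /\
    ip (fun n => Csum m (fun p => (k p * s p n)%cx)) y = Csum m (fun p => (k p * ip (s p) y)%cx)); [tauto|].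
  induction m as [|m [IH1 IH2]]; cbn [Csum].
  - split.
    + exists 0. intros M. rewrite rsum_zero; [lra|]. intros; rewrite Cnorm2_C0; ring.
    + apply ip_unique. eapply Ccv_ext; [|apply Ccv_const]. intros; cbn. rewrite Csum_zero; [easy|]. intros; ring.
  - change (fun n => (Csum m (fun p => (k p * s p n)%cx) + k m * s m n)%cx)
      with (sadd (fun n => Csum m (fun p => (k p * s p n)%cx)) (sscal (k m) (s m))).
    split; [sf|]. rewrite ip_add_l, ip_scal_l, IH2 by sf. easy.
Qed.

(** * Cauchy products and Hankel operators *)

Definition conv (a b : nat -> Cx) : nat -> Cx :=
  fun m => Csum (S m) (fun j => (a j * b (m - j)%nat)%cx).
(** The coefficients of Pi(e conj(x)): the Hankel operator of symbol [e], antilinear in [x]. *)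
Definition hank (e x : nat -> Cx) : nat -> Cx := fun n => ip (shift n e) x.

Lemma conv_comm a b : conv a b = conv b a.
Proof.
  seq_ext m. unfold conv. rewrite Csum_rev. apply Csum_ext; intros j Hj.
  replace (S m - 1 - j)%nat with (m - j)%nat by lia. replace (m - (m - j))%nat with j by lia. ring.
Qed.
Lemma conv_add_l a a' b : conv (sadd a a') b = sadd (conv a b) (conv a' b).
Proof.
  seq_ext m. unfold conv, sadd at 2. rewrite <- Csum_add. apply Csum_ext; intros; unfold sadd; ring.
Qed.
Lemma conv_scal_l k a b : conv (sscal k a) b = sscal k (conv a b).
Proof.
  seq_ext m. unfold conv, sscal at 2. rewrite <- Csum_scal. apply Csum_ext; intros; unfold sscal; ring.
Qed.
Lemma conv_add_r a b b' : conv a (sadd b b') = sadd (conv a b) (conv a b').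
Proof. now rewrite conv_comm, conv_add_l, !(conv_comm _ a). Qed.
Lemma conv_scal_r k a b : conv a (sscal k b) = sscal k (conv a b).
Proof. now rewrite conv_comm, conv_scal_l, (conv_comm b). Qed.
Lemma conv_dlt_l k b : conv (dlt k) b = rsh k b.
Proof.
  seq_ext m. unfold conv, rsh. destruct (Nat.leb_spec k m).
  - replace (S m) with (k + S (m - k))%nat by lia. rewrite Csum_split, Csum_zero, Csum_head, Csum_zero.
    + unfold dlt. rewrite Nat.add_0_r, Nat.eqb_refl. ring.
    + intros n Hn. unfold dlt. destruct (Nat.eqb_spec (k + S n) k); [lia|ring].
    + intros n Hn. unfold dlt. destruct (Nat.eqb_spec n k); [lia|ring].
  - apply Csum_zero. intros n Hn. unfold dlt. destruct (Nat.eqb_spec n k); [lia|ring].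
Qed.

(** Telescoping: [wY M] is the square root of M + 1, and 1 / sqrt(M+1) <= 2 (sqrt(M+1) - sqrt M). *)
Lemma inv_sqrt_sum M : rsum M (fun j => / wY j) <= 2 * sqrt (INR M).
Proof.
  induction M; cbn [rsum]; [change (INR 0) with 0; rewrite sqrt_0; lra|].
  assert (wY M = sqrt (INR (S M))) as E by (unfold wY; rewrite S_INR; f_equal; ring).
  rewrite E. pose proof (wY_ge1 M) as h1. rewrite E in h1.
  pose proof (sqrt_sqrt (INR (S M)) (pos_INR _)) as e1.
  pose proof (sqrt_sqrt (INR M) (pos_INR _)) as e2. rewrite S_INR in e1 at 3.
  set (s := sqrt (INR (S M))) in *. set (r := sqrt (INR M)) in *.
  assert (0 <= r) by apply sqrt_pos.
  cut (/ s <= 2 * (s - r)); [lra|].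
  apply Rmult_le_reg_r with s; [lra|]. rewrite Rinv_l by lra. nra.
Qed.
Lemma rsum_rev_S m f : rsum (S m) f = rsum (S m) (fun j => f (m - j)%nat).
Proof. rewrite rsum_rev. apply rsum_ext; intros; f_equal; lia. Qed.
Lemma inv_wY_sum m : rsum (S m) (fun j => / wY j) <= 2 * wY m.
Proof.
  eapply Rle_trans; [apply inv_sqrt_sum|]. unfold wY. rewrite S_INR, Rplus_comm. lra.
Qed.
(* [1/sqrt(xy) <= (1/sqrt x + 1/sqrt y)/sqrt(x+y)], here with [x + y = m + 2]. *)
Lemma inv_wY_conv_sum m : rsum (S m) (fun j => / (wY j * wY (m - j))) <= 4.
Proof.
  apply Rle_trans with (rsum (S m) (fun j => / wY m * (/ wY j + / wY (m - j)))).
  - apply rsum_le; intros j Hj.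
    pose proof (wY_ge1 j); pose proof (wY_ge1 (m - j)); pose proof (wY_ge1 m).
    assert (hs : wY m <= wY j + wY (m - j)).
    { apply Rsqr_incr_0_var; [|lra]. unfold Rsqr. rewrite wY_sqr.
      replace ((wY j + wY (m - j)) * (wY j + wY (m - j)))
        with (wY j * wY j + wY (m - j) * wY (m - j) + 2 * (wY j * wY (m - j))) by ring.
      rewrite !wY_sqr. rewrite minus_INR by lia. nra. }
    replace (/ wY m * (/ wY j + / wY (m - j)))
      with ((wY j + wY (m - j)) / wY m * / (wY j * wY (m - j))) by (field; lra).
    rewrite <- (Rmult_1_l (/ (wY j * wY (m - j)))) at 1.
    apply Rmult_le_compat_r; [left; apply Rinv_0_lt_compat; nra|].
    apply Rmult_le_reg_r with (wY m); [lra|]. unfold Rdiv. rewrite Rmult_assoc, Rinv_l by lra. lra.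
  - rewrite rsum_scal, rsum_plus.
    pose proof (rsum_rev_S m (fun j => / wY j)) as E. cbn beta in E. rewrite <- E.
    pose proof (inv_wY_sum m). pose proof (wY_ge1 m).
    apply Rmult_le_reg_l with (wY m); [lra|].
    rewrite <- Rmult_assoc, Rinv_r by lra. lra.
Qed.
Lemma rsum_triangle M (F : nat -> nat -> R) :
  rsum M (fun m => rsum (S m) (fun j => F j (m - j)%nat)) = rsum M (fun j => rsum (M - j) (F j)).
Proof.
  induction M; [easy|]. cbn [rsum]. cbn [rsum] in IHM. rewrite IHM.
  rewrite (rsum_ext M (fun j => rsum (S M - j) (F j)) (fun j => rsum (M - j) (F j) + F j (M - j)%nat)).
  - rewrite rsum_plus. replace (S M - M)%nat with 1%nat by lia. cbn [rsum].
    rewrite Nat.sub_diag. ring.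
  - intros j Hj. replace (S M - j)%nat with (S (M - j)) by lia. easy.
Qed.

(** The discrete counterpart of the embedding of H^{1/4} into L^4. Cauchy-Schwarz on each
    antidiagonal uses the weights [wY j * wY (m - j)], whose reciprocals sum to at most 4 by
    [inv_wY_conv_sum]; summing the antidiagonals then gives the product of the two norms. *)
Lemma conv_bnd a b A B : bnd wY a A -> bnd wY b B -> bnd w1 (conv a b) (4 * A * B).
Proof.
  intros HA HB M.
  set (al := fun j => wY j * Cnorm2 (a j)). set (be := fun j => wY j * Cnorm2 (b j)).
  assert (Hal : forall j, 0 <= al j) by (intros; apply bnd_term_ge0, weight_wY).
  assert (Hbe : forall j, 0 <= be j) by (intros; apply bnd_term_ge0, weight_wY).
  apply Rle_trans with (rsum M (fun m => 4 * rsum (S m) (fun j => al j * be (m - j)%nat))).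
  - apply rsum_le; intros m _. unfold w1; rewrite Rmult_1_l.
    set (s := fun j => sqrt (wY j * wY (m - j))).
    assert (Hs0 : forall j, 0 < wY j * wY (m - j)).
    { intros j. pose proof (wY_ge1 j); pose proof (wY_ge1 (m - j)); nra. }
    assert (Hs : forall j, 0 < s j) by (intros j; apply sqrt_lt_R0, Hs0).
    assert (Hss : forall j, s j * s j = wY j * wY (m - j)) by (intros j; apply sqrt_sqrt; left; apply Hs0).
    pose proof (Csum_norm_le (S m) (fun j => (a j * b (m - j)%nat)%cx)) as h1. fold (conv a b m) in h1.
    rewrite (rsum_ext (S m) _ (fun j => (s j * (Cnorm (a j) * Cnorm (b (m - j)%nat))) * / s j)) in h1.
    2:{ intros j _; cbn. rewrite Cnorm_mul. specialize (Hs j). field; lra. }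
    pose proof (rsum_cauchy_schwarz (S m) (fun j => s j * (Cnorm (a j) * Cnorm (b (m - j)%nat))) (fun j => / s j)) as h2. cbn beta in h2.
    rewrite (rsum_ext (S m) (fun j => / s j * / s j) (fun j => / (wY j * wY (m - j)))) in h2.
    2:{ intros j _. rewrite <- Hss. specialize (Hs j). field; lra. }
    rewrite (rsum_ext (S m) (fun j => s j * (Cnorm (a j) * Cnorm (b (m - j)%nat)) * (s j * (Cnorm (a j) * Cnorm (b (m - j)%nat))))
      (fun j => al j * be (m - j)%nat)) in h2.
    2:{ intros j _. unfold al, be. rewrite <- !Cnorm_sqr.
        transitivity ((s j * s j) * (Cnorm (a j) * Cnorm (a j)) * (Cnorm (b (m - j)%nat) * Cnorm (b (m - j)%nat))); [ring|].
        rewrite Hss; ring. }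
    pose proof (inv_wY_conv_sum m) as h3.
    assert (h4 : 0 <= rsum (S m) (fun j => al j * be (m - j)%nat)).
    { apply rsum_ge0; intros. apply Rmult_le_pos; auto. }
    rewrite <- Cnorm_sqr. pose proof (Cnorm_ge0 (conv a b m)).
    set (X := rsum (S m) (fun j => s j * (Cnorm (a j) * Cnorm (b (m - j)%nat)) * / s j)) in *.
    apply Rle_trans with (X * X); [apply Rmult_le_compat; auto|].
    eapply Rle_trans; [exact h2|]. rewrite (Rmult_comm 4). apply Rmult_le_compat_l; auto.
  - rewrite rsum_scal, (rsum_triangle M (fun j k => al j * be k)), Rmult_assoc.
    apply Rmult_le_compat_l; [lra|].
    apply Rle_trans with (rsum M (fun j => B * al j)).
    + apply rsum_le; intros j _. rewrite rsum_scal, (Rmult_comm B).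
      apply Rmult_le_compat_l; auto; apply HB.
    + rewrite rsum_scal, Rmult_comm. apply Rmult_le_compat_r; [eapply bnd_ge0; eauto|apply HA].
Qed.
Lemma fin_conv a b : fin wY a -> fin wY b -> fin w1 (conv a b).
Proof. intros [A HA] [B HB]; eexists; eapply conv_bnd; eauto. Qed.
#[local] Hint Resolve fin_conv : seqfin.

Lemma rsum_Un_cv M (f : nat -> nat -> R) (l : nat -> R) :
  (forall n, (n < M)%nat -> Un_cv (fun J => f J n) (l n)) -> Un_cv (fun J => rsum M (f J)) (rsum M l).
Proof.
  induction M; intros H; cbn [rsum].
  - intros eps He; exists 0%nat; intros. unfold Rdist. rewrite Rminus_diag, Rabs_R0; auto.
  - apply (CV_plus (fun J => rsum M (f J)) (fun J => f J M)); auto.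
Qed.
Lemma Un_cv_const r : Un_cv (fun _ => r) r.
Proof. intros eps He; exists 0%nat; intros. unfold Rdist. rewrite Rminus_diag, Rabs_R0; auto. Qed.
Lemma Ccv_norm2 s l : Ccv s l -> Un_cv (fun n => Cnorm2 (s n)) (Cnorm2 l).
Proof.
  intros [H1 H2]. unfold Cnorm2.
  apply (CV_plus (fun n => Cre (s n) * Cre (s n)) (fun n => Cim (s n) * Cim (s n)));
  [apply (CV_mult (fun n => Cre (s n)) (fun n => Cre (s n)))|apply (CV_mult (fun n => Cim (s n)) (fun n => Cim (s n)))]; auto.
Qed.

(** Weighted Cauchy-Schwarz bounds the square of the [n]-th coefficient by [A] times the sum over
    [j] of |e_{n+j}|^2 / [wY j]. Multiplied by [wY n] and regrouped along m = n + j, the factor of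
    |e_m|^2 is at most [wY m] times the sum of the [/ wY j] for j <= m, hence at most [2 * wH m]:
    the weight of H^{1/2} appears as the square of that of H^{1/4}. *)
Lemma hank_bnd e x E A : bnd wH e E -> bnd wY x A -> bnd wY (hank e x) (2 * E * A).
Proof.
  intros HE HA M.
  set (p := fun J n => Csum J (fun j => (shift n e j * (x j)^*)%cx)).
  assert (Hcv : Un_cv (fun J => rsum M (fun n => wY n * Cnorm2 (p J n))) (rsum M (fun n => wY n * Cnorm2 (hank e x n)))).
  { apply (rsum_Un_cv M (fun J n => wY n * Cnorm2 (p J n)) (fun n => wY n * Cnorm2 (hank e x n))).
    intros n _. apply (CV_mult (fun _ => wY n) (fun J => Cnorm2 (p J n))); [apply Un_cv_const|].
    apply Ccv_norm2. apply ip_cv.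
    - apply fin_shift; sf. exists E. now apply bnd_Y1, bnd_HY.
    - exists A; now apply bnd_Y1. }
  (* The inner series is cut at [J]; the bound is uniform in [J] and passes to the limit. *)
  eapply Rle_cv_lim; [|exact Hcv|apply Un_cv_const]. intros J; cbn beta.
  assert (HA0 : 0 <= A) by (eapply bnd_ge0; eauto).
  set (F := fun n j => wY n * / wY j * Cnorm2 (e (n + j)%nat)).
  assert (HF : forall n j, 0 <= F n j).
  { intros n j. unfold F. pose proof (wY_ge1 n); pose proof (wY_ge1 j). pose proof (Cnorm2_ge0 (e (n + j)%nat)).
    apply Rmult_le_pos; auto. apply Rmult_le_pos; [lra|left; apply Rinv_0_lt_compat; lra]. }
  apply Rle_trans with (rsum M (fun n => A * rsum J (F n))).
  - apply rsum_le; intros n _.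
    assert (h : Cnorm2 (p J n) <= A * rsum J (fun j => / wY j * Cnorm2 (e (n + j)%nat))).
    { pose proof (Csum_norm_le J (fun j => (shift n e j * (x j)^*)%cx)) as h1. fold (p J n) in h1.
      set (s := fun j => sqrt (wY j)).
      assert (Hs : forall j, 0 < s j) by (intros j; apply sqrt_lt_R0; pose proof (wY_ge1 j); lra).
      assert (Hss : forall j, s j * s j = wY j) by (intros j; apply sqrt_sqrt; pose proof (wY_ge1 j); lra).
      rewrite (rsum_ext J _ (fun j => (s j * Cnorm (x j)) * (/ s j * Cnorm (e (n + j)%nat)))) in h1.
      2:{ intros j _; cbn. rewrite Cnorm_mul, Cnorm_conj. unfold shift. rewrite (Nat.add_comm j n). specialize (Hs j). field; lra. }
      pose proof (rsum_cauchy_schwarz J (fun j => s j * Cnorm (x j)) (fun j => / s j * Cnorm (e (n + j)%nat))) as h2. cbn beta in h2.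
      rewrite (rsum_ext J (fun j => s j * Cnorm (x j) * (s j * Cnorm (x j))) (fun j => wY j * Cnorm2 (x j))) in h2.
      2:{ intros j _. rewrite <- Cnorm_sqr, <- Hss. ring. }
      rewrite (rsum_ext J (fun j => / s j * Cnorm (e (n + j)%nat) * (/ s j * Cnorm (e (n + j)%nat)))
        (fun j => / wY j * Cnorm2 (e (n + j)%nat))) in h2.
      2:{ intros j _. rewrite <- Cnorm_sqr, <- Hss. specialize (Hs j). field; lra. }
      rewrite <- Cnorm_sqr. pose proof (Cnorm_ge0 (p J n)).
      eapply Rle_trans; [apply Rmult_le_compat; eauto|].
      eapply Rle_trans; [exact h2|]. apply Rmult_le_compat_r; [|apply HA].
      apply rsum_ge0; intros j _. pose proof (wY_ge1 j).
      apply Rmult_le_pos; [left; apply Rinv_0_lt_compat; lra|apply Cnorm2_ge0]. }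
    unfold F. rewrite (rsum_ext J _ (fun j => wY n * (/ wY j * Cnorm2 (e (n + j)%nat)))) by (intros; ring).
    rewrite rsum_scal. pose proof (wY_ge1 n). nra.
  - rewrite rsum_scal. rewrite (Rmult_comm (2 * E)). apply Rmult_le_compat_l; auto.
    set (K := (M + J)%nat).
    apply Rle_trans with (rsum K (fun n => rsum (K - n) (F n))).
    + apply Rle_trans with (rsum M (fun n => rsum (K - n) (F n))).
      * apply rsum_le; intros n Hn. apply rsum_mono; auto. unfold K; lia.
      * apply rsum_mono; [|unfold K; lia]. intros; apply rsum_ge0; auto.
    + rewrite <- (rsum_triangle K F).
      apply Rle_trans with (rsum K (fun m => 2 * (wH m * Cnorm2 (e m)))).
      * apply rsum_le; intros m _.
        rewrite (rsum_ext (S m) _ (fun j => Cnorm2 (e m) * (wY j * / wY (m - j)))).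
        2:{ intros j Hj. unfold F. replace (j + (m - j))%nat with m by lia. ring. }
        rewrite rsum_scal.
        replace (2 * (wH m * Cnorm2 (e m))) with (Cnorm2 (e m) * (2 * wH m)) by ring.
        apply Rmult_le_compat_l; [apply Cnorm2_ge0|].
        apply Rle_trans with (rsum (S m) (fun j => wY m * / wY (m - j))).
        { apply rsum_le; intros j Hj. apply Rmult_le_compat_r.
          - left; apply Rinv_0_lt_compat; pose proof (wY_ge1 (m - j)); lra.
          - apply weight_wY; lia. }
        rewrite rsum_scal. pose proof (rsum_rev_S m (fun j => / wY j)) as Er. cbn beta in Er. rewrite <- Er.
        pose proof (inv_wY_sum m). unfold wH. rewrite <- wY_sqr. pose proof (wY_ge1 m). nra.
      * rewrite rsum_scal. apply Rmult_le_compat_l; [lra|apply HE].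
Qed.
Lemma fin_hank e x : fin wH e -> fin wY x -> fin wY (hank e x).
Proof. intros [A HA] [B HB]; eexists; eapply hank_bnd; eauto. Qed.
#[local] Hint Resolve fin_hank : seqfin.

Lemma trunc_S M x : trunc (S M) x = sadd (trunc M x) (sscal (x M) (dlt M)).
Proof.
  seq_ext n. unfold trunc, sadd, sscal, dlt.
  destruct (Nat.ltb_spec n (S M)), (Nat.ltb_spec n M), (Nat.eqb_spec n M); try lia; subst; ring.
Qed.

(** Truncating [y] makes the exchange of sums finite: a unit vector [dlt M] turns [conv] into a
    forward shift, the adjoint of the backward shift inside [hank]. *)
Lemma hank_partial e a y M : fin w1 e -> fin wY a -> fin wY y ->
  Csum M (fun n => (hank e a n * (y n)^*)%cx) = ip e (conv a (trunc M y)).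
Proof.
  intros He Ha Hy. induction M; cbn [Csum].
  - symmetry. apply ip_unique. eapply Ccv_ext; [|apply Ccv_const]. intros M; cbn beta.
    rewrite Csum_zero; [easy|]. intros n _.
    replace (conv a (trunc 0 y) n) with C0; [rewrite Cconj_C0; ring|].
    symmetry. apply Csum_zero. intros; unfold trunc; cbn; ring.
  - rewrite trunc_S, conv_add_r, ip_add_r, <- IHM by sf. f_equal.
    rewrite conv_scal_r, ip_scal_r by sf.
    rewrite (conv_comm a), conv_dlt_l, ip_rsh_r by sf. unfold hank. ring.
Qed.

(* The one exchange of summations used throughout: both sides are
   [sum_{n,j} e_{n+j} conj(a_j) conj(y_n)]. *)
Lemma hank_pairing e a y : fin w1 e -> fin wY a -> fin wY y ->
  Ccv (fun M => Csum M (fun n => (hank e a n * (y n)^*)%cx)) (ip e (conv a y)).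
Proof.
  intros He Ha Hy. apply Ccv_norm; intros eps Heps.
  destruct He as [E HE]; destruct Ha as [A HA].
  assert (HE0 : 0 <= E) by (eapply bnd_ge0; eauto). assert (HA0 : 0 <= A) by (eapply bnd_ge0; eauto).
  (* Makes [E * (4 * A * eta)] at most [eps * eps]; the added 1 allows for vanishing bounds. *)
  set (eta := eps * eps / (4 * (1 + E) * (1 + A))).
  assert (Heta : 0 < eta) by (unfold eta; apply Rdiv_lt_0_compat; nra).
  destruct (bnd_tail_small wY y weight_wY Hy eta Heta) as [M0 h].
  exists M0; intros M HM. specialize (h M HM).
  rewrite hank_partial; [|exists E; auto|exists A; auto|auto].
  rewrite <- (trunc_add_tail M y) at 2.
  rewrite conv_add_r, ip_add_r; [|apply fin_conv; sf; exists A; auto|apply fin_conv; sf; exists A; auto|exists E; auto].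
  match goal with |- Cnorm (?a - (?a + ?b))%cx <= _ => replace (a - (a + b))%cx with (- b)%cx by ring end.
  rewrite Cnorm_opp.
  pose proof (conv_bnd _ _ _ _ HA h) as h2.
  eapply Rle_trans; [apply (ip_bound _ _ _ _ HE h2)|].
  rewrite <- sqrt_mult by (auto; nra).
  rewrite <- (sqrt_square eps) by lra. apply sqrt_le_1_alt.
  unfold eta. replace (E * (4 * A * (eps * eps / (4 * (1 + E) * (1 + A))))) with
   (eps * eps * ((E / (1 + E)) * (A / (1 + A)))) by (field; lra).
  rewrite <- (Rmult_1_r (eps * eps)) at 2. apply Rmult_le_compat_l; [nra|].
  assert (0 <= E / (1 + E) <= 1) by (split; [apply Rmult_le_pos; [lra|left; apply Rinv_0_lt_compat; lra]|
    apply Rmult_le_reg_r with (1 + E); [lra|]; unfold Rdiv; rewrite Rmult_assoc, Rinv_l; lra]).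
  assert (0 <= A / (1 + A) <= 1) by (split; [apply Rmult_le_pos; [lra|left; apply Rinv_0_lt_compat; lra]|
    apply Rmult_le_reg_r with (1 + A); [lra|]; unfold Rdiv; rewrite Rmult_assoc, Rinv_l; lra]).
  nra.
Qed.
Lemma ip_hank e a y : fin w1 e -> fin wY a -> fin wY y -> ip (hank e a) y = ip e (conv a y).
Proof. intros; apply ip_unique; now apply hank_pairing. Qed.
Lemma hank_partial_bound e a y M E A B : bnd w1 e E -> bnd wY a A -> bnd wY y B ->
  Cnorm (Csum M (fun n => (hank e a n * (y n)^*)%cx)) <= sqrt E * sqrt (4 * A * B).
Proof.
  intros HE HA HB. rewrite hank_partial; [|exists E; auto|exists A; auto|exists B; auto].
  apply ip_bound; auto. apply conv_bnd; auto. apply bnd_trunc; auto. apply weight_wY.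
Qed.
Lemma hank_add_l e e' x : fin w1 e -> fin w1 e' -> fin w1 x -> hank (sadd e e') x = sadd (hank e x) (hank e' x).
Proof. intros. seq_ext n. unfold hank, sadd at 2. rewrite <- ip_add_l by sf. easy. Qed.
Lemma hank_scal_l k e x : fin w1 e -> fin w1 x -> hank (sscal k e) x = sscal k (hank e x).
Proof. intros. seq_ext n. unfold hank, sscal at 2. rewrite <- ip_scal_l by sf. easy. Qed.
Lemma hank_add_r e x x' : fin w1 e -> fin w1 x' -> fin w1 x -> hank e (sadd x x') = sadd (hank e x) (hank e x').
Proof. intros. seq_ext n. unfold hank, sadd at 2. rewrite ip_add_r by sf. easy. Qed.
Lemma hank_scal_r k e x : fin w1 e -> fin w1 x -> hank e (sscal k x) = sscal (k^*)%cx (hank e x).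
Proof. intros. seq_ext n. unfold hank, sscal at 2. rewrite ip_scal_r by sf. easy. Qed.

(** * The Lax identity and differentiation of pairings *)

(* [Top c] is the Toeplitz operator T_{|u|^2}; [Gop 0 c] and [Gop 1 c] are the
   antilinear Hankel operators H_u and K_u = S^* H_u, where u has coefficients [c]. *)
Definition Top (c x : nat -> Cx) : nat -> Cx := hank (conv c x) c.
Definition Gop (s : nat) (c x : nat -> Cx) : nat -> Cx := hank (shift s c) x.

Lemma fin_Gop s c x : fin wH c -> fin wY x -> fin wY (Gop s c x).
Proof. intros; unfold Gop; sf. Qed.
#[local] Hint Resolve fin_Gop : seqfin.

Lemma shift_shift m k x : shift m (shift k x) = shift (m + k) x.
Proof. seq_ext n. unfold shift. f_equal; lia. Qed.
Lemma shift_0 x : shift 0 x = x.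
Proof. seq_ext n. unfold shift. f_equal; lia. Qed.
Lemma hank_shift r e x : hank (shift r e) x = shift r (hank e x).
Proof. seq_ext n. unfold hank, shift at 3. now rewrite shift_shift. Qed.
Lemma rsh_0 x : rsh 0 x = x.
Proof. seq_ext n. unfold rsh; cbn. f_equal; lia. Qed.
(** The adjoint shift commutes with multiplication up to [m] boundary terms, one for each
    coefficient of [a] below [m]. These terms produce the commutators of the Lax identity. *)
Lemma conv_shift m a b :
  shift m (conv a b) = sadd (fun k => Csum m (fun p => (a p * shift (m - p) b k)%cx)) (conv (shift m a) b).
Proof.
  seq_ext k. unfold shift at 1, conv at 1, sadd.
  replace (S (k + m)) with (m + S k)%nat by lia. rewrite Csum_split. f_equal.
  - apply Csum_ext; intros p Hp. unfold shift. do 2 f_equal. lia.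
  - unfold conv. apply Csum_ext; intros j Hj. unfold shift. f_equal; f_equal; lia.
Qed.
Lemma conv_head a b : conv a b = sadd (sscal (a 0%nat) b) (rsh 1 (conv (shift 1 a) b)).
Proof.
  seq_ext k. unfold sadd, sscal, rsh. destruct k; cbn [Nat.leb].
  - unfold conv; cbn. ring.
  - unfold conv at 1. rewrite Csum_head. f_equal.
    replace (S k - 1)%nat with k by lia. unfold conv. apply Csum_ext; intros j Hj.
    unfold shift. f_equal; f_equal; lia.
Qed.

(** A common form for H and K. For [s = 1] the constant coefficient of [shift n c] is split off by
    [conv_head]: the boundary sum gains the term p = n, and the remaining product involves
    [shift (n + 1) c], delayed by one. *)
Lemma shift_conv_split s n c v : (s <= 1)%nat ->
  shift n (conv c v) =
  sadd (fun k => Csum (n + s) (fun p => (c p * shift (n - p) v k)%cx)) (rsh s (conv (shift (n + s) c) v)).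
Proof.
  intros Hs. rewrite conv_shift. destruct s as [|[|]]; [| |lia].
  - now rewrite rsh_0, Nat.add_0_r.
  - rewrite (conv_head (shift n c)), shift_shift, (Nat.add_comm n 1).
    seq_ext k. unfold sadd. cbn [Nat.add Csum].
    replace (n - n)%nat with 0%nat by lia. rewrite shift_0. unfold sscal.
    replace (shift n c 0%nat) with (c n) by (unfold shift; f_equal; lia). ring.
Qed.

(* The Lax identity H_{Pi(|u|^2 u)} = T H + H T - H^3 (and its analogue for K_u),
   evaluated at x, component n; the two terms on the left are H_{Pi(|u|^2u)} x and H T x. *)
Lemma lax_identity s c x n : (s <= 1)%nat -> fin wH c -> fin wY x ->
  (ip (shift (n + s) (conv c c)) (conv c x) - ip (conv c (shift (n + s) c)) (conv c x)
   = Top c (Gop s c x) n - Gop s c (Gop s c (Gop s c x)) n)%cx.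
Proof.
  intros Hs Hc Hx. set (m := (n + s)%nat). set (v := Gop s c x).
  assert (Hv : fin wY v) by (apply fin_Gop; auto).
  assert (HcY : fin wY c) by sf.
  assert (Hfs : forall p, fin w1 (shift (m - p) c)) by (intros; sf).
  (* The bulk term [conv (shift m c) c] cancels and only boundary terms remain; [ip_hank] rewrites
     each of them as a pairing of a shift of [v] with [c]. The same sum comes out of [Top c v]
     below. *)
  assert (HL : (ip (shift m (conv c c)) (conv c x) - ip (conv c (shift m c)) (conv c x)
     = Csum m (fun p => c p * ip (shift (n - p) v) c))%cx).
  { rewrite conv_shift.
    assert (E : ip (fun k => Csum m (fun p => (c p * shift (m - p) c k)%cx)) (conv c x)
       = Csum m (fun p => (c p * ip (shift (m - p) c) (conv c x))%cx)) by (apply ip_Csum_l; sf).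
    assert (F : fin w1 (fun k => Csum m (fun p => (c p * shift (m - p) c k)%cx))).
    { replace (fun k => Csum m (fun p => (c p * shift (m - p) c k)%cx))
        with (seq_sub (shift m (conv c c)) (conv (shift m c) c)) by
        (rewrite conv_shift; seq_ext k; unfold seq_sub, sadd; ring). sf. }
    rewrite ip_add_l by sf. rewrite E, (conv_comm c (shift m c)).
    rewrite (Csum_ext m (fun p => (c p * ip (shift (n - p) v) c)%cx) (fun p => (c p * ip (shift (m - p) c) (conv c x))%cx)).
    - ring.
    - intros p Hp. f_equal. rewrite (conv_comm c x), <- ip_hank by sf. f_equal.
      replace (m - p)%nat with ((n - p) + s)%nat by (unfold m in *; lia).
      rewrite <- shift_shift, hank_shift. easy. }
  rewrite HL. unfold Top. unfold hank at 1.
  rewrite (shift_conv_split s n c v Hs). fold m.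
  assert (F : fin w1 (fun k => Csum m (fun p => (c p * shift (n - p) v k)%cx))).
  { replace (fun k => Csum m (fun p => (c p * shift (n - p) v k)%cx))
        with (seq_sub (shift n (conv c v)) (rsh s (conv (shift m c) v))) by
        (rewrite (shift_conv_split s n c v Hs); fold m; seq_ext k; unfold seq_sub, sadd; ring). sf. }
  rewrite ip_add_l by sf. rewrite ip_Csum_l by (sf; intros; sf).
  rewrite ip_rsh_l by sf.
  (* What [Top c v] contains beyond the boundary sum is exactly the cubic term of the identity. *)
  assert (E : Gop s c (Gop s c v) n = ip (conv (shift m c) v) (shift s c)).
  { unfold Gop at 1. unfold hank. rewrite shift_shift. fold m.
    rewrite <- ip_conj by sf. unfold Gop. rewrite ip_hank by sf. rewrite ip_conj by sf.
    now rewrite conv_comm. }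
  rewrite E. change (fun p => c p * ip (fun n0 => shift (n - p) v n0) c)%cx with (fun p => c p * ip (shift (n - p) v) c)%cx. ring.
Qed.

(** Both sides pair the shifted symbol with the product of [x] and [y]. This symmetry of the
    antilinear G makes G^2 a self-adjoint linear operator. *)
Lemma Gop_sym s c x y : fin wH c -> fin wY x -> fin wY y -> ip (Gop s c x) y = ip (Gop s c y) x.
Proof. intros. unfold Gop. rewrite !ip_hank by sf. now rewrite conv_comm. Qed.
Lemma Gop2_sym s c x y : fin wH c -> fin wY x -> fin wY y ->
  ip (Gop s c (Gop s c x)) y = ip x (Gop s c (Gop s c y)).
Proof.
  intros. rewrite Gop_sym by sf. rewrite <- (ip_conj _ x) by sf.
  rewrite (Gop_sym s c (Gop s c y) x), ip_conj by sf. easy.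
Qed.

(** * Derivatives of complex functions and of scalar products *)

Definition Cder (f : R -> Cx) (t : R) (d : Cx) : Prop :=
  derivable_pt_lim (fun s => Cre (f s)) t (Cre d) /\ derivable_pt_lim (fun s => Cim (f s)) t (Cim d).

Lemma derivable_pt_lim_ext f g t d : (forall s, f s = g s) -> derivable_pt_lim f t d -> derivable_pt_lim g t d.
Proof.
  intros E H eps He. destruct (H eps He) as [dl h]; exists dl; intros; rewrite <- !E; auto.
Qed.
Lemma Cder_ext f g t d : (forall s, f s = g s) -> Cder f t d -> Cder g t d.
Proof.
  intros E [H1 H2]; split; (eapply derivable_pt_lim_ext; [|eassumption]); intros; cbn; now rewrite E.
Qed.
Lemma Cder_const z t : Cder (fun _ => z) t C0.
Proof. split; apply derivable_pt_lim_const. Qed.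
Lemma Cder_add f g t a b : Cder f t a -> Cder g t b -> Cder (fun s => (f s + g s)%cx) t (a + b)%cx.
Proof.
  intros [H1 H2] [H3 H4]; split.
  - apply (derivable_pt_lim_plus (fun s => Cre (f s)) (fun s => Cre (g s))); auto.
  - apply (derivable_pt_lim_plus (fun s => Cim (f s)) (fun s => Cim (g s))); auto.
Qed.
Lemma Cder_mul f g t a b : Cder f t a -> Cder g t b ->
  Cder (fun s => (f s * g s)%cx) t (a * g t + f t * b)%cx.
Proof.
  intros [H1 H2] [H3 H4]; split.
  - pose proof (derivable_pt_lim_minus _ _ _ _ _ (derivable_pt_lim_mult _ _ _ _ _ H1 H3)
      (derivable_pt_lim_mult _ _ _ _ _ H2 H4)) as E.
    replace (Cre (a * g t + f t * b)%cx) with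
      (Cre a * Cre (g t) + Cre (f t) * Cre b - (Cim a * Cim (g t) + Cim (f t) * Cim b)) by (cx_unfold; ring).
    exact E.
  - pose proof (derivable_pt_lim_plus _ _ _ _ _ (derivable_pt_lim_mult _ _ _ _ _ H1 H4)
      (derivable_pt_lim_mult _ _ _ _ _ H2 H3)) as E.
    replace (Cim (a * g t + f t * b)%cx) with
      (Cre a * Cim (g t) + Cre (f t) * Cim b + (Cim a * Cre (g t) + Cim (f t) * Cre b)) by (cx_unfold; ring).
    exact E.
Qed.
Lemma Cder_scal k f t a : Cder f t a -> Cder (fun s => (k * f s)%cx) t (k * a)%cx.
Proof.
  intros H. replace (k * a)%cx with (C0 * f t + k * a)%cx by ring.
  apply (Cder_mul (fun _ => k)); [apply Cder_const|auto].
Qed.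
Lemma Cder_conj f t a : Cder f t a -> Cder (fun s => ((f s)^*)%cx) t (a^*)%cx.
Proof. intros [H1 H2]; split; [exact H1|]. apply (derivable_pt_lim_opp (fun s => Cim (f s))); auto. Qed.
Lemma Cder_sum M (f : R -> nat -> Cx) (d : nat -> Cx) t :
  (forall n, Cder (fun s => f s n) t (d n)) -> Cder (fun s => Csum M (f s)) t (Csum M d).
Proof.
  intros H; induction M; cbn [Csum]; [apply Cder_const|].
  apply (Cder_add (fun s => Csum M (f s)) (fun s => f s M)); auto.
Qed.
Lemma Cder_eq f t a b : Cder f t a -> a = b -> Cder f t b.
Proof. congruence. Qed.

Lemma mvt_bound (f f' : R -> R) t h K d : (forall s, derivable_pt_lim f s (f' s)) ->
  (forall s, Rabs (s - t) < d -> Rabs (f' s) <= K) -> Rabs h < d ->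
  Rabs (f (t + h) - f t) <= K * Rabs h.
Proof.
  intros Hf HK Hh. destruct (Rtotal_order h 0) as [h0|[->|h0]].
  - destruct (MVT_cor2 f f' (t + h) t) as [c [E Hc]]; [lra|auto|].
    rewrite Rabs_minus_sym, E, Rabs_mult. rewrite (Rabs_minus_sym t).
    replace (t + h - t) with h by ring. apply Rmult_le_compat_r; [apply Rabs_pos|].
    apply HK. rewrite Rabs_left in * by lra. lra.
  - rewrite Rplus_0_r, Rminus_diag, Rabs_R0. lra.
  - destruct (MVT_cor2 f f' t (t + h)) as [c [E Hc]]; [lra|auto|].
    rewrite E, Rabs_mult.
    replace (t + h - t) with h by ring. apply Rmult_le_compat_r; [apply Rabs_pos|].
    apply HK. rewrite (Rabs_pos_eq h) in Hh by lra. rewrite Rabs_pos_eq by lra. lra.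
Qed.
Lemma Un_cv_bound u l B M0 : Un_cv u l -> (forall M, (M0 <= M)%nat -> Rabs (u M) <= B) -> Rabs l <= B.
Proof.
  intros H HB. apply le_epsilon; intros eps He. destruct (H eps He) as [M1 h].
  specialize (h (max M0 M1) ltac:(lia)). specialize (HB (max M0 M1) ltac:(lia)).
  unfold Rdist in h. pose proof (Rabs_triang (l - u (max M0 M1)) (u (max M0 M1))) as h2.
  replace (l - u (max M0 M1) + u (max M0 M1)) with l in h2 by ring.
  rewrite Rabs_minus_sym in h. lra.
Qed.

(** Termwise differentiation at one point: the derivatives need a limit only at [t], while near [t]
    they stay close to the one of rank [M0]. The mean value theorem transfers this closeness to
    difference quotients. *)
Lemma derive_limit (F F' : nat -> R -> R) (f : R -> R) (t D : R) :
  (forall M s, derivable_pt_lim (F M) s (F' M s)) ->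
  (forall s, Un_cv (fun M => F M s) (f s)) ->
  Un_cv (fun M => F' M t) D ->
  (forall eps, 0 < eps -> exists M0 d, 0 < d /\
     forall M s, (M0 <= M)%nat -> Rabs (s - t) < d -> Rabs (F' M s - F' M0 s) <= eps) ->
  derivable_pt_lim f t D.
Proof.
  intros HF Hf HD Hu eps He.
  destruct (Hu (eps / 4)) as [M0 [d [Hd h]]]; [lra|].
  destruct (HF M0 t (eps / 4)) as [d1 h1]; [lra|].
  assert (Hm : 0 < Rmin d d1) by (apply Rmin_pos; [auto|apply cond_pos]).
  exists (mkposreal _ Hm). intros k Hk0 Hk. cbn in Hk.
  assert (Hk1 : Rabs k < d) by (eapply Rlt_le_trans; [exact Hk|apply Rmin_l]).
  assert (Hk2 : Rabs k < d1) by (eapply Rlt_le_trans; [exact Hk|apply Rmin_r]).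
  specialize (h1 k Hk0 Hk2).
  assert (hD : Rabs (D - F' M0 t) <= eps / 4).
  { apply (Un_cv_bound (fun M => F' M t - F' M0 t) _ _ M0).
    - apply (CV_minus (fun M => F' M t)); [auto|apply Un_cv_const].
    - intros M HM. apply h; auto. rewrite Rminus_diag, Rabs_R0; auto. }
  assert (hf : Rabs ((f (t + k) - F M0 (t + k)) - (f t - F M0 t)) <= eps / 4 * Rabs k).
  { apply (Un_cv_bound (fun M => (F M (t + k) - F M0 (t + k)) - (F M t - F M0 t)) _ _ M0).
    - apply (CV_minus (fun M => F M (t + k) - F M0 (t + k)) (fun M => F M t - F M0 t));
      [apply (CV_minus (fun M => F M (t + k)))|apply (CV_minus (fun M => F M t))]; auto; apply Un_cv_const.
    - intros M HM.
      apply (mvt_bound (fun s => F M s - F M0 s) (fun s => F' M s - F' M0 s) t k (eps / 4) d); auto.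
      intros s; apply (derivable_pt_lim_minus (F M) (F M0)); auto. }
  replace ((f (t + k) - f t) / k - D) with
    (((f (t + k) - F M0 (t + k)) - (f t - F M0 t)) / k + ((F M0 (t + k) - F M0 t) / k - F' M0 t) - (D - F' M0 t))
    by (field; auto).
  assert (h2 : Rabs ((f (t + k) - F M0 (t + k) - (f t - F M0 t)) / k) <= eps / 4).
  { unfold Rdiv at 1. rewrite Rabs_mult, Rabs_inv.
    apply Rmult_le_reg_r with (Rabs k); [now apply Rabs_pos_lt|].
    rewrite Rmult_assoc, Rinv_l by (apply Rabs_no_R0; auto). lra. }
  eapply Rle_lt_trans; [apply Rabs_triang|]. rewrite Rabs_Ropp.
  eapply Rle_lt_trans; [apply Rplus_le_compat_r, Rabs_triang|]. lra.
Qed.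

Definition contw (w : nat -> R) (x : R -> nat -> Cx) : Prop :=
  (forall t, fin w (x t)) /\
  (forall t eps, 0 < eps -> exists d, 0 < d /\
     forall s, Rabs (s - t) < d -> bnd w (seq_sub (x s) (x t)) eps).
(* Local boundedness of [X] in the dual of H^{1/4}. *)
Definition dualb (X : R -> nat -> Cx) (t : R) : Prop :=
  exists L d, 0 <= L /\ 0 < d /\ forall s, Rabs (s - t) < d ->
    forall y B M, bnd wY y B -> Cnorm (Csum M (fun n => (X s n * (y n)^*)%cx)) <= L * sqrt B.

Lemma contw_local w x t : weight w -> contw w x ->
  exists B d, 0 < d /\ forall s, Rabs (s - t) < d -> bnd w (x s) B.
Proof.
  intros Hw [H1 H2]. destruct (H1 t) as [A HA]. destruct (H2 t 1) as [d [Hd h]]; [lra|].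
  exists (2 * 1 + 2 * A), d; split; auto. intros s Hs.
  replace (x s) with (sadd (seq_sub (x s) (x t)) (x t)).
  - apply bnd_add; auto.
  - seq_ext n. unfold sadd, seq_sub. ring.
Qed.
Lemma Csum_tail M0 M (f z : nat -> Cx) : (M0 <= M)%nat ->
  (Csum M (fun n => f n * (tail M0 z n)^*) = Csum M (fun n => f n * (z n)^*) - Csum M0 (fun n => f n * (z n)^*))%cx.
Proof.
  induction 1 as [|M H IH]; cbn [Csum].
  - rewrite Csum_zero; [ring|]. intros n Hn. unfold tail. rewrite (proj2 (Nat.ltb_lt n M0) Hn), Cconj_C0; ring.
  - rewrite IH. unfold tail. rewrite (proj2 (Nat.ltb_ge M M0) H). ring.
Qed.
Lemma tail_uniform x t : contw wY x -> forall eps, 0 < eps ->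
  exists M0 d, 0 < d /\ forall M s, (M0 <= M)%nat -> Rabs (s - t) < d -> bnd wY (tail M (x s)) eps.
Proof.
  intros [H1 H2] eps He.
  destruct (bnd_tail_small wY (x t) weight_wY (H1 t) (eps / 4)) as [M0 h]; [lra|].
  destruct (H2 t (eps / 4)) as [d [Hd h2]]; [lra|].
  exists M0, d; split; auto. intros M s HM Hs.
  replace (tail M (x s)) with (sadd (tail M (x t)) (tail M (seq_sub (x s) (x t)))).
  - replace eps with (2 * (eps / 4) + 2 * (eps / 4)) by lra. apply bnd_add; [sf|auto|].
    apply bnd_dom with (seq_sub (x s) (x t)); [sf| |auto].
    intros n; unfold tail. destruct (Nat.ltb n M); [rewrite Cnorm2_C0; apply Cnorm2_ge0|lra].
  - seq_ext n. unfold sadd, seq_sub, tail. destruct (Nat.ltb n M); ring.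
Qed.

(** In the differentiated series, the part beyond [M0] is a derivative tested against the tail of
    the other factor: the dual bound times an H^{1/4} norm that is small uniformly near [t]. This is
    the uniformity required by [derive_limit]. The values [a] and [b] enter as limits of partial
    sums, so no summability of [X t] or [Z t] is presupposed. *)
Lemma pair_derive x z X Z t a b :
  contw wY x -> contw wY z ->
  (forall n s, Cder (fun r => x r n) s (X s n)) -> (forall n s, Cder (fun r => z r n) s (Z s n)) ->
  dualb X t -> dualb Z t ->
  Ccv (fun M => Csum M (fun n => (X t n * (z t n)^*)%cx)) a ->
  Ccv (fun M => Csum M (fun n => (Z t n * (x t n)^*)%cx)) b ->
  Cder (fun s => ip (x s) (z s)) t (a + b^*)%cx.
Proof.
  intros Hx Hz HX HZ [L [d [HL [Hd HLX]]]] [L' [d' [HL' [Hd' HLZ]]]] Ha Hb.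
  set (F := fun M s => Csum M (fun n => (x s n * (z s n)^*)%cx)).
  set (F' := fun M s => Csum M (fun n => (X s n * (z s n)^* + x s n * (Z s n)^*)%cx)).
  assert (HF : forall M s, Cder (F M) s (F' M s)).
  { intros M s. apply (Cder_sum M (fun s n => (x s n * (z s n)^*)%cx) (fun n => (X s n * (z s n)^* + x s n * (Z s n)^*)%cx)).
    intros n. apply (Cder_mul (fun r => x r n) (fun r => ((z r n)^*)%cx)); auto. apply Cder_conj; auto. }
  assert (Hf : forall s, Ccv (fun M => F M s) (ip (x s) (z s))).
  { intros s; apply ip_cv; apply fin_Y1; [apply Hx|apply Hz]. }
  assert (EF : forall M s, F' M s = (Csum M (fun n => X s n * (z s n)^*) + (Csum M (fun n => Z s n * (x s n)^*))^*)%cx).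
  { intros M s. unfold F'. rewrite Csum_add. f_equal. rewrite <- Csum_conj. apply Csum_ext; intros.
    rewrite Cconj_mul, Cconj_conj; ring. }
  assert (HD : Ccv (fun M => F' M t) (a + b^*)%cx).
  { eapply Ccv_ext; [|apply Ccv_add; [exact Ha|apply Ccv_conj; exact Hb]]. intros M; cbn beta. now rewrite EF. }
  assert (Hu : forall eps, 0 < eps -> exists M0 d, 0 < d /\
     forall M s, (M0 <= M)%nat -> Rabs (s - t) < d -> Cnorm (F' M s - F' M0 s)%cx <= eps).
  { intros eps He.
    set (eta := (eps / (2 * (1 + L + L'))) * (eps / (2 * (1 + L + L')))).
    assert (He2 : 0 < eps / (2 * (1 + L + L'))) by (apply Rdiv_lt_0_compat; lra).
    assert (Heta : 0 < eta) by (unfold eta; nra).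
    assert (Hse : sqrt eta = eps / (2 * (1 + L + L'))) by (unfold eta; apply sqrt_square; lra).
    destruct (tail_uniform x t Hx eta Heta) as [M1 [d1 [Hd1 h1]]].
    destruct (tail_uniform z t Hz eta Heta) as [M2 [d2 [Hd2 h2]]].
    exists (max M1 M2), (Rmin (Rmin d d') (Rmin d1 d2)); split.
    { repeat apply Rmin_pos; auto. }
    intros M s HM Hs.
    assert (Rabs (s - t) < d /\ Rabs (s - t) < d' /\ Rabs (s - t) < d1 /\ Rabs (s - t) < d2) as (q1 & q2 & q3 & q4).
    { pose proof (Rmin_l (Rmin d d') (Rmin d1 d2)). pose proof (Rmin_r (Rmin d d') (Rmin d1 d2)).
      pose proof (Rmin_l d d'). pose proof (Rmin_r d d'). pose proof (Rmin_l d1 d2). pose proof (Rmin_r d1 d2).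
      repeat split; lra. }
    rewrite !EF.
    match goal with |- Cnorm (?a + ?b^* - (?c + ?d^*))%cx <= _ =>
      replace (a + b^* - (c + d^*))%cx with ((a - c) + (b - d)^*)%cx by (rewrite Cconj_sub; ring) end.
    rewrite <- !Csum_tail by auto.
    eapply Rle_trans; [apply Cnorm_triang|]. rewrite Cnorm_conj.
    assert (e1 := HLX s q1 _ _ M (h2 (max M1 M2) s ltac:(lia) q4)).
    assert (e2 := HLZ s q2 _ _ M (h1 (max M1 M2) s ltac:(lia) q3)).
    eapply Rle_trans; [apply Rplus_le_compat; eassumption|].
    rewrite Hse.
    replace (L * (eps / (2 * (1 + L + L'))) + L' * (eps / (2 * (1 + L + L')))) with
      (eps * ((L + L') / (2 * (1 + L + L')))) by (field; lra).
    rewrite <- (Rmult_1_r eps) at 2. apply Rmult_le_compat_l; [lra|].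
    apply Rmult_le_reg_r with (2 * (1 + L + L')); [lra|]. unfold Rdiv. rewrite Rmult_assoc, Rinv_l; lra. }
  split.
  - apply (derive_limit (fun M s => Cre (F M s)) (fun M s => Cre (F' M s))).
    + intros; apply HF.
    + intros s; apply (Hf s).
    + apply HD.
    + intros eps He. destruct (Hu eps He) as [M0 [dd [Hdd h]]]. exists M0, dd; split; auto.
      intros M s HM Hs. eapply Rle_trans; [|apply (h M s HM Hs)].
      eapply Rle_trans; [|apply Cre_le]. right. f_equal.
  - apply (derive_limit (fun M s => Cim (F M s)) (fun M s => Cim (F' M s))).
    + intros; apply HF.
    + intros s; apply (Hf s).
    + apply HD.
    + intros eps He. destruct (Hu eps He) as [M0 [dd [Hdd h]]]. exists M0, dd; split; auto.
      intros M s HM Hs. eapply Rle_trans; [|apply (h M s HM Hs)].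
      eapply Rle_trans; [|apply Cim_le]. right. f_equal.
Qed.

(** * Evolution of vectors under the Lax pair *)

Definition rhs (s : nat) (c : nat -> Cx) (lam : R) (x : nat -> Cx) (n : nat) : Cx :=
  (- Ci * (Top c x n - Cof lam * Gop s c (Gop s c x) n))%cx.

(** x' = -i T x + i [lam] G^2 x. The real number [lam] separates the vectors at hand: it is 0 for
    the solution itself, whose equation is u' = -i T u, and 1 for the constant function 1 when G =
    H. *)
Definition evol (s : nat) (c : R -> nat -> Cx) (lam : R) (x : R -> nat -> Cx) : Prop :=
  contw wY x /\ forall n t, Cder (fun r => x r n) t (rhs s (c t) lam (x t) n).

Lemma Csum_rhs s c lam x y M :
  Csum M (fun n => (rhs s c lam x n * (y n)^*)%cx) =
  (- Ci * (Csum M (fun n => Top c x n * (y n)^*) - Cof lam * Csum M (fun n => Gop s c (Gop s c x) n * (y n)^*)))%cx.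
Proof.
  rewrite <- !Csum_scal, <- Csum_sub, <- Csum_scal. apply Csum_ext; intros; unfold rhs; ring.
Qed.

(** Tested against [y], the Toeplitz term is the pairing of the products c x and c y, both in L^2 by
    [conv_bnd]; the term in G^2 is even bounded in H^{1/4}. *)
Lemma dualb_rhs s c lam x t : contw wH c -> contw wY x -> dualb (fun r => rhs s (c r) lam (x r)) t.
Proof.
  intros Hc Hx.
  destruct (contw_local wH c t weight_wH Hc) as [C [d [Hd hC]]].
  destruct (contw_local wY x t weight_wY Hx) as [A [d' [Hd' hA]]].
  exists (sqrt (4 * C * A) * sqrt (4 * C) + Rabs lam * sqrt (2 * C * (2 * C * A))), (Rmin d d').
  split; [|split; [now apply Rmin_pos|]].
  { pose proof (sqrt_pos (4 * C * A)); pose proof (sqrt_pos (4 * C)).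
    pose proof (Rabs_pos lam); pose proof (sqrt_pos (2 * C * (2 * C * A))).
    apply Rplus_le_le_0_compat; apply Rmult_le_pos; auto. }
  intros r Hr y B M HB.
  assert (HcC : bnd wH (c r) C) by (apply hC; eapply Rlt_le_trans; [exact Hr|apply Rmin_l]).
  assert (HxA : bnd wY (x r) A) by (apply hA; eapply Rlt_le_trans; [exact Hr|apply Rmin_r]).
  assert (HC0 : 0 <= C) by (eapply bnd_ge0; eauto).
  assert (HB0 : 0 <= B) by (eapply bnd_ge0; eauto).
  rewrite Csum_rhs, Cnorm_mul, Cnorm_opp, Cnorm_Ci, Rmult_1_l.
  eapply Rle_trans; [apply Cnorm_sub_le|]. rewrite Cnorm_mul, Cnorm_Cof, Rmult_plus_distr_r.
  apply Rplus_le_compat.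
  - rewrite Rmult_assoc, <- (sqrt_mult (4 * C)) by lra. apply hank_partial_bound; auto.
    + apply conv_bnd; auto. now apply bnd_HY.
    + now apply bnd_HY.
  - rewrite Rmult_assoc. apply Rmult_le_compat_l; [apply Rabs_pos|].
    eapply Rle_trans; [apply Csum_norm_le|]. apply rsum_ip_bound; apply bnd_Y1; auto.
    apply hank_bnd; [apply bnd_shift; sf|]. apply hank_bnd; auto. apply bnd_shift; sf.
Qed.

Lemma rhs_pairing s c lam x y : fin wH c -> fin wY x -> fin wY y ->
  Ccv (fun M => Csum M (fun n => (rhs s c lam x n * (y n)^*)%cx))
   (- Ci * (ip (conv c x) (conv c y) - Cof lam * ip (Gop s c (Gop s c x)) y))%cx.
Proof.
  intros. eapply Ccv_ext; [intros M; symmetry; apply Csum_rhs|].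
  apply Ccv_scal, Ccv_sub; [|apply Ccv_scal, ip_cv; sf].
  apply hank_pairing; sf.
Qed.

(** T and G^2 are self-adjoint: the Toeplitz terms cancel and only the difference of the two
    parameters survives. Equal parameters give a conserved scalar product. *)
Lemma evol_pair s c lam lam' x z t : contw wH c -> evol s c lam x -> evol s c lam' z ->
  Cder (fun r => ip (x r) (z r)) t (Ci * Cof (lam - lam') * ip (Gop s (c t) (Gop s (c t) (x t))) (z t))%cx.
Proof.
  intros Hc [Hx Hx'] [Hz Hz'].
  assert (hc : fin wH (c t)) by apply Hc.
  assert (hx : fin wY (x t)) by apply Hx. assert (hz : fin wY (z t)) by apply Hz.
  eapply Cder_eq.
  - eapply (pair_derive x z (fun r => rhs s (c r) lam (x r)) (fun r => rhs s (c r) lam' (z r))); auto.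
    + now apply dualb_rhs.
    + now apply dualb_rhs.
    + now apply rhs_pairing.
    + now apply rhs_pairing.
  - rewrite !Cconj_mul, Cconj_sub, Cconj_mul, Cconj_opp, Cconj_Cof.
    rewrite (ip_conj (conv (c t) (z t))) by sf. rewrite (ip_conj (Gop _ _ _)) by sf.
    rewrite <- (Gop2_sym s (c t) (x t) (z t)) by sf.
    set (u := ip _ _). set (v := ip _ _). cx_ring.
Qed.

Lemma contw_weaken c : contw wH c -> contw wY c.
Proof.
  intros [H1 H2]; split; [intros; sf|]. intros t eps He. destruct (H2 t eps He) as [d [Hd h]].
  exists d; split; auto. intros. now apply bnd_HY, h.
Qed.
Lemma contw_shift m w c : weight w -> contw w c -> contw w (fun t => shift m (c t)).
Proof.
  intros Hw [H1 H2]; split; [intros; sf|]. intros t eps He. destruct (H2 t eps He) as [d [Hd h]].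
  exists d; split; auto. intros r Hr.
  change (seq_sub (shift m (c r)) (shift m (c t))) with (shift m (seq_sub (c r) (c t))).
  apply bnd_shift; auto.
Qed.
Lemma hank_diff e e' x x' : fin w1 e -> fin w1 e' -> fin w1 x -> fin w1 x' ->
  seq_sub (hank e x) (hank e' x') = sadd (hank (seq_sub e e') x) (hank e' (seq_sub x x')).
Proof.
  intros. rewrite !seq_sub_sadd. rewrite hank_add_l, hank_add_r, hank_scal_l, hank_scal_r by sf.
  seq_ext n. unfold sadd, sscal. rewrite Cconj_opp, Cconj_C1. ring.
Qed.
Lemma hank_diff_bnd e e' x x' a A b B : bnd wH (seq_sub e e') a -> bnd wY x A -> bnd wH e' B ->
  bnd wY (seq_sub x x') b -> fin w1 e -> fin w1 x' ->
  bnd wY (seq_sub (hank e x) (hank e' x')) (2 * (2 * a * A) + 2 * (2 * B * b)).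
Proof.
  intros H1 H2 H3 H4 He Hx'. rewrite hank_diff; auto.
  - apply bnd_add; sf; apply hank_bnd; auto.
  - exists B; now apply bnd_Y1, bnd_HY.
  - exists A; now apply bnd_Y1.
Qed.
Lemma contw_hank e x : contw wH e -> contw wY x -> contw wY (fun t => hank (e t) (x t)).
Proof.
  intros He Hx. split.
  - intros t. pose proof (proj1 He t); pose proof (proj1 Hx t); sf.
  - intros t eps Heps.
    destruct (contw_local wY x t weight_wY Hx) as [A [d1 [Hd1 hA]]].
    destruct (proj1 He t) as [B HB].
    assert (HB0 : 0 <= B) by (eapply bnd_ge0; eauto).
    assert (HA0 : 0 <= A).
    { apply (bnd_ge0 wY (x t)), hA. rewrite Rminus_diag, Rabs_R0; auto. }
    destruct (proj2 He t (eps / (8 * (1 + A)))) as [d2 [Hd2 h2]]; [apply Rdiv_lt_0_compat; lra|].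
    destruct (proj2 Hx t (eps / (8 * (1 + B)))) as [d3 [Hd3 h3]]; [apply Rdiv_lt_0_compat; lra|].
    exists (Rmin d1 (Rmin d2 d3)); split; [repeat apply Rmin_pos; auto|].
    intros s Hs.
    assert (Rabs (s - t) < d1 /\ Rabs (s - t) < d2 /\ Rabs (s - t) < d3) as (q1 & q2 & q3).
    { pose proof (Rmin_l d1 (Rmin d2 d3)). pose proof (Rmin_r d1 (Rmin d2 d3)).
      pose proof (Rmin_l d2 d3). pose proof (Rmin_r d2 d3). repeat split; lra. }
    eapply bnd_le.
    + apply hank_diff_bnd; [apply h2; auto|apply hA; auto|exact HB|apply h3; auto| |].
      * pose proof (proj1 He s); sf.
      * pose proof (proj1 Hx t); sf.
    + assert (eps / (8 * (1 + A)) * A <= eps / 8).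
      { apply Rmult_le_reg_r with (8 * (1 + A)); [lra|]. field_simplify; nra. }
      assert (eps / (8 * (1 + B)) * B <= eps / 8).
      { apply Rmult_le_reg_r with (8 * (1 + B)); [lra|]. field_simplify; nra. }
      nra.
Qed.

(** The symbol contributes -i (T G + G T - G^3) x by the Lax identity. By antilinearity G x' equals
    i G T x - i [lam] G^3 x. The terms in G T cancel and leave -i T G x + i (1 - [lam]) G^3 x. *)
Lemma evol_Gop s c lam x : (s <= 1)%nat -> contw wH c -> evol s c 0 c -> evol s c lam x ->
  evol s c (1 - lam) (fun t => Gop s (c t) (x t)).
Proof.
  intros Hs Hc [HcY Hc'] [Hx Hx']. split.
  - unfold Gop. apply (contw_hank (fun t => shift s (c t))); auto. apply contw_shift; sf.
  - intros n t. unfold Gop at 1. unfold hank.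
    assert (hc : fin wH (c t)) by apply Hc.
    assert (hx : fin wY (x t)) by apply Hx.
    set (X := fun r => shift (n + s) (rhs s (c r) 0 (c r))).
    apply (Cder_ext (fun r => ip (shift (n + s) (c r)) (x r))); [intros; now rewrite shift_shift|].
    eapply Cder_eq.
    + eapply (pair_derive (fun t => shift (n + s) (c t)) x X (fun r => rhs s (c r) lam (x r))); auto.
      * apply contw_shift; sf.
      * intros j r. unfold shift, X. apply Hc'.
      * destruct (contw_local wH c t weight_wH Hc) as [C [d [Hd hC]]].
        exists (sqrt (4 * C * C) * sqrt (4 * C)), d.
        split; [apply Rmult_le_pos; apply sqrt_pos|split; auto].
        intros r Hr y B M HB. specialize (hC r Hr).
        assert (HC0 : 0 <= C) by (eapply bnd_ge0; eauto).
        assert (HB0 : 0 <= B) by (eapply bnd_ge0; eauto).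
        rewrite (Csum_ext M _ (fun j => (- Ci * (hank (shift (n + s) (conv (c r) (c r))) (c r) j * (y j)^*))%cx)).
        2:{ intros j _. unfold X, rhs, shift at 1. unfold Top. rewrite hank_shift. unfold shift at 1. change (Cof 0) with C0. ring. }
        rewrite Csum_scal, Cnorm_mul, Cnorm_opp, Cnorm_Ci, Rmult_1_l, Rmult_assoc, <- (sqrt_mult (4 * C)) by lra.
        apply hank_partial_bound; auto; [|now apply bnd_HY].
        apply bnd_shift; sf. apply conv_bnd; now apply bnd_HY.
      * now apply dualb_rhs.
      * instantiate (1 := (- Ci * ip (shift (n + s) (conv (c t) (c t))) (conv (c t) (x t)))%cx).
        eapply Ccv_ext; [|apply Ccv_scal, hank_pairing; sf].
        intros M; cbn beta. rewrite <- Csum_scal. apply Csum_ext; intros j _.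
        unfold X, rhs, shift at 2. unfold Top. rewrite hank_shift. unfold shift at 1. change (Cof 0) with C0. ring.
      * apply rhs_pairing; sf.
    + assert (E : Gop s (c t) (Gop s (c t) (Gop s (c t) (x t))) n
                  = ((ip (Gop s (c t) (Gop s (c t) (x t))) (shift (n + s) (c t)))^*)%cx).
      { rewrite ip_conj by sf. unfold Gop at 1. unfold hank. now rewrite shift_shift. }
      pose proof (lax_identity s (c t) (x t) n Hs hc hx) as Lx.
      unfold rhs. unfold Gop at 5. 
      rewrite !Cconj_mul, Cconj_sub, Cconj_mul, Cconj_opp, Cconj_Cof, <- E.
      rewrite (ip_conj (conv (c t) (x t))) by sf.
      assert (Lx' : Top (c t) (Gop s (c t) (x t)) n = (ip (shift (n + s) (conv (c t) (c t))) (conv (c t) (x t)) -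
         ip (conv (c t) (shift (n + s) (c t))) (conv (c t) (x t)) + Gop s (c t) (Gop s (c t) (Gop s (c t) (x t))) n)%cx)
       by (rewrite Lx; ring).
      unfold Gop in *. rewrite Lx'.
      match goal with |- (_ * ?p + _ * (?q - _ * ?r))%cx = _ => generalize p q r end.
      cx_ring.
Qed.

Lemma contw_add w x y : weight w -> contw w x -> contw w y -> contw w (fun t => sadd (x t) (y t)).
Proof.
  intros Hw [H1 H2] [H3 H4]; split; [intros; sf|]. intros t eps He.
  destruct (H2 t (eps / 4)) as [d [Hd h]]; [lra|]. destruct (H4 t (eps / 4)) as [d' [Hd' h']]; [lra|].
  exists (Rmin d d'); split; [now apply Rmin_pos|]. intros s Hs.
  pose proof (Rmin_l d d'); pose proof (Rmin_r d d').
  replace (seq_sub (sadd (x s) (y s)) (sadd (x t) (y t))) with (sadd (seq_sub (x s) (x t)) (seq_sub (y s) (y t)))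
    by (seq_ext n; unfold sadd, seq_sub; ring).
  replace eps with (2 * (eps / 4) + 2 * (eps / 4)) by lra.
  apply bnd_add; auto; [apply h|apply h']; lra.
Qed.
Lemma contw_scal w x k : weight w -> contw w x -> contw w (fun t => sscal k (x t)).
Proof.
  intros Hw [H1 H2]; split; [intros; sf|]. intros t eps He.
  pose proof (Cnorm2_ge0 k).
  destruct (H2 t (eps / (1 + Cnorm2 k))) as [d [Hd h]]; [apply Rdiv_lt_0_compat; lra|].
  exists d; split; auto. intros s Hs.
  replace (seq_sub (sscal k (x s)) (sscal k (x t))) with (sscal k (seq_sub (x s) (x t)))
    by (seq_ext n; unfold sscal, seq_sub; ring).
  eapply bnd_le; [apply bnd_scal, h; auto|].
  apply Rmult_le_reg_r with (1 + Cnorm2 k); [lra|]. field_simplify; nra.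
Qed.
Lemma rhs_lin s c lam k x y : fin wH c -> fin wY x -> fin wY y ->
  rhs s c lam (sadd x (sscal (Cof k) y)) = sadd (rhs s c lam x) (sscal (Cof k) (rhs s c lam y)).
Proof.
  intros. seq_ext n. unfold rhs, sadd at 3, sscal at 3. unfold Top, Gop.
  rewrite conv_add_r, conv_scal_r, hank_add_l, hank_scal_l by sf.
  rewrite hank_add_r, hank_scal_r, Cconj_Cof by sf.
  rewrite hank_add_r, hank_scal_r, Cconj_Cof by sf.
  unfold sadd, sscal, rhs, Top, Gop. ring.
Qed.
Lemma evol_lin s c lam k x y : contw wH c -> evol s c lam x -> evol s c lam y ->
  evol s c lam (fun t => sadd (x t) (sscal (Cof k) (y t))).
Proof.
  intros Hc [Hx Hx'] [Hy Hy']; split.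
  - apply contw_add; [sf|auto|apply contw_scal; sf].
  - intros n t. rewrite rhs_lin; [|apply Hc|apply Hx|apply Hy].
    unfold sadd, sscal. apply (Cder_add (fun r => x r n) (fun r => (Cof k * y r n)%cx)); auto.
    apply Cder_scal; auto.
Qed.
(** Since H_u 1 = u, both T 1 and H_u^2 1 equal Pi(|u|^2), so the vector field with parameter 1
    vanishes at 1. *)
Lemma evol_dlt0 c : contw wH c -> evol 0 c 1 (fun _ => dlt 0).
Proof.
  intros Hc; split.
  - split; [intros; sf|]. intros t eps He; exists 1; split; [lra|]. intros s _ M.
    rewrite rsum_zero; [lra|]. intros n _. unfold seq_sub.
    replace (dlt 0 n - dlt 0 n)%cx with C0 by ring. rewrite Cnorm2_C0; ring.
  - intros n t. eapply Cder_eq; [apply Cder_const|].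
    assert (Hct : fin wH (c t)) by apply Hc.
    unfold rhs, Top, Gop. rewrite conv_comm, conv_dlt_l, rsh_0.
    replace (hank (shift 0 (c t)) (dlt 0)) with (c t).
    + rewrite shift_0. change (Cof 1) with C1. ring.
    + seq_ext j. unfold hank. rewrite ip_dlt_r, shift_0. unfold shift. easy.
Qed.

(** * The H^{1/2} norm and the equation in terms of weighted bounds *)

Lemma is_hnorm_bnd c r : is_hnorm c r -> bnd wH c (r * r).
Proof.
  intros [Hr H] M.
  set (f := fun k => (1 + INR k) * Cnorm2 (c k)) in *.
  assert (Hf : forall n, 0 <= f n) by (intros n; apply (bnd_term_ge0 wH c n weight_wH)).
  apply le_epsilon; intros eps He. destruct (H eps He) as [N h].
  specialize (h (max N M) ltac:(lia)). rewrite <- rsum_sum_f_R0 in h. unfold Rdist in h.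
  pose proof (Rle_abs (rsum (S (max N M)) f - r * r)).
  assert (rsum M f <= rsum (S (max N M)) f) by (apply rsum_mono; auto; lia).
  change (rsum M f <= r * r + eps). lra.
Qed.
Lemma fin_is_hnorm c : fin wH c -> exists r, is_hnorm c r.
Proof.
  intros [B HB]. set (f := fun k => (1 + INR k) * Cnorm2 (c k)).
  assert (Hf : forall n, 0 <= f n) by (intros n; apply (bnd_term_ge0 wH c n weight_wH)).
  destruct (growing_cv (sum_f_R0 f)) as [l Hl].
  - intros n; cbn. specialize (Hf (S n)); lra.
  - exists B. intros x [n ->]. rewrite <- rsum_sum_f_R0. apply HB.
  - assert (0 <= l).
    { eapply Rle_cv_lim; [|apply Un_cv_const|exact Hl]. intros n. rewrite <- rsum_sum_f_R0.
      apply rsum_ge0; auto. }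
    exists (sqrt l); split; [apply sqrt_pos|]. rewrite sqrt_sqrt by auto. exact Hl.
Qed.
Lemma H12_fin c : H12 c <-> fin wH c.
Proof.
  split; [intros [r H]; exists (r * r); now apply is_hnorm_bnd|apply fin_is_hnorm].
Qed.

Lemma conv_trunc_ip a b y K : fin wY a -> fin wY b -> fin w1 y ->
  ip (conv (trunc K a) b) y = Csum K (fun j => (a j * ip b (shift j y))%cx).
Proof.
  intros Ha Hb Hy. induction K; cbn [Csum].
  - apply ip_unique. eapply Ccv_ext; [|apply Ccv_const]. intros M; cbn beta.
    rewrite Csum_zero; [easy|]. intros n _.
    replace (conv (trunc 0 a) b n) with C0; [ring|].
    symmetry. apply Csum_zero. intros; unfold trunc; cbn; ring.
  - rewrite trunc_S, conv_add_l, conv_scal_l, ip_add_l, ip_scal_l, IHK by sf.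
    now rewrite conv_dlt_l, ip_rsh_l by sf.
Qed.
(** The square truncation in [j] and [l] is the product of the truncated series with itself.
    Convergence of the cubic sum thus becomes continuity of the product from H^{1/4} to L^2. *)
Lemma cubic_partial_ip c n M : fin wY c ->
  cubic_partial c n M = ip (conv (trunc (S M) c) (trunc (S M) c)) (rsh n c).
Proof.
  intros Hc. rewrite conv_trunc_ip by sf. apply Csum_ext; intros j _.
  rewrite ip_trunc_l, <- Csum_scal. apply Csum_ext; intros l _.
  unfold shift, rsh. rewrite (Nat.add_comm l j). destruct (Nat.leb n (j + l)).
  - ring.
  - rewrite Cconj_C0; ring.
Qed.
Lemma cubic_coef_Top c n : fin wY c -> cubic_coef c n (Top c c n).
Proof.
  intros Hc. unfold cubic_coef.
  eapply Ccv_ext; [intros M; symmetry; now apply cubic_partial_ip|].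
  unfold Top, hank. rewrite <- ip_rsh_r by sf.
  apply Ccv_norm; intros eps He.
  assert (Hc' := Hc). destruct Hc' as [A HA].
  assert (HA0 : 0 <= A) by (eapply bnd_ge0; eauto).
  (* With [a] the truncation and [b] the tail of [c], the errors [conv a b] and [conv b c] each cost
     at most [2 * q * A]. *)
  set (q := eps / (4 * (1 + A))). assert (Hq : 0 < q) by (apply Rdiv_lt_0_compat; lra).
  destruct (bnd_tail_small wY c weight_wY Hc (q * q)) as [M0 h]; [nra|].
  exists M0; intros M HM. specialize (h (S M) ltac:(lia)).
  set (a := trunc (S M) c) in *. set (b := tail (S M) c) in *.
  assert (Ha : bnd wY a A) by (apply bnd_trunc; sf).
  assert (Ea : c = sadd a b) by (symmetry; apply trunc_add_tail).
  assert (Fa : fin wY a) by (exists A; auto). assert (Fb : fin wY b) by (eexists; eauto).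
  assert (E : conv c c = sadd (conv a a) (sadd (conv a b) (conv b c))).
  { rewrite Ea at 1 2. rewrite conv_add_l. rewrite conv_add_r. rewrite <- Ea.
    seq_ext k. unfold sadd. ring. }
  rewrite E, !ip_add_l by sf.
  match goal with |- Cnorm (?a - (?a + ?b))%cx <= _ => replace (a - (a + b))%cx with (- b)%cx by ring end.
  rewrite Cnorm_opp.
  assert (B1 : Cnorm (ip (conv a b) (rsh n c)) <= 2 * q * A).
  { eapply Rle_trans; [apply ip_bound; [apply conv_bnd; [exact Ha|exact h]|apply bnd_rsh, bnd_Y1; exact HA]|].
    rewrite <- sqrt_mult by (auto; nra). rewrite <- (sqrt_square (2 * q * A)) by nra.
    apply sqrt_le_1_alt. right; ring. }
  assert (B2 : Cnorm (ip (conv b c) (rsh n c)) <= 2 * q * A).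
  { eapply Rle_trans; [apply ip_bound; [apply conv_bnd; [exact h|exact HA]|apply bnd_rsh, bnd_Y1; exact HA]|].
    rewrite <- sqrt_mult by (auto; nra). rewrite <- (sqrt_square (2 * q * A)) by nra.
    apply sqrt_le_1_alt. right; ring. }
  eapply Rle_trans; [apply Cnorm_triang|].
  assert (q * (4 * (1 + A)) = eps) by (unfold q; field; lra). nra.
Qed.

Lemma szego_contw u : szego_sol u -> contw wH u.
Proof.
  intros (H1 & H2 & _); split.
  - intros t; now apply H12_fin.
  - intros t eps He. destruct (H2 t (sqrt eps)) as [d [Hd h]]; [now apply sqrt_lt_R0|].
    exists d; split; auto. intros s Hs. destruct (h s Hs) as [r [Hr1 Hr2]].
    eapply bnd_le; [apply is_hnorm_bnd; eassumption|].
    destruct Hr1 as [Hr0 _]. rewrite <- (sqrt_sqrt eps) by lra. nra.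
Qed.
Lemma szego_evol s u : szego_sol u -> evol s u 0 u.
Proof.
  intros H. pose proof (szego_contw u H) as Hc. split; [now apply contw_weaken|].
  intros n t. destruct H as (_ & _ & H3). destruct (H3 n t) as [w (Hw & D1 & D2)].
  assert (w = Top (u t) (u t) n) as ->.
  { eapply Ccv_unique; [exact Hw|]. apply cubic_coef_Top. apply fin_HY, Hc. }
  assert (rhs s (u t) 0 (u t) n = (- Ci * Top (u t) (u t) n)%cx) as E.
  { unfold rhs. change (Cof 0) with C0. ring. }
  rewrite E. split.
  - replace (Cre (- Ci * Top (u t) (u t) n)%cx) with (Cim (Top (u t) (u t) n)) by (cx_unfold; ring). exact D1.
  - replace (Cim (- Ci * Top (u t) (u t) n)%cx) with (- Cre (Top (u t) (u t) n)) by (cx_unfold; ring). exact D2.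
Qed.

(** * The observable and its perturbation *)

(* [Giter 0 c k = H_u^k 1] and [Giter 1 c k = K_u^k u]. *)
Fixpoint Giter (s : nat) (c : nat -> Cx) (k : nat) : nat -> Cx :=
  match k with
  | O => match s with O => dlt 0 | _ => c end
  | S k => Gop s c (Giter s c k)
  end.
Definition Theta (s : nat) (c : nat -> Cx) : Cx := ip (Giter s c 1) (Giter s c 2).

Lemma fin_Giter s c k : fin wH c -> fin wY (Giter s c k).
Proof. intros H; induction k; cbn [Giter]; [destruct s|]; sf. Qed.
#[local] Hint Resolve fin_Giter : seqfin.

Lemma bnd_approx w x y A B : weight w -> bnd w y A -> bnd w (seq_sub x y) B -> bnd w x (2 * B + 2 * A).
Proof.
  intros Hw HA HB. replace x with (sadd (seq_sub x y) y) by (seq_ext n; unfold sadd, seq_sub; ring).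
  now apply bnd_add.
Qed.

Lemma Giter_lipschitz_k s K k : exists L, 0 <= L /\ forall psi u rho,
  bnd wH psi K -> bnd wH (seq_sub u psi) (rho * rho) -> 0 <= rho <= 1 ->
  bnd wY (Giter s psi k) L /\ bnd wY (seq_sub (Giter s u k) (Giter s psi k)) (L * (rho * rho)).
Proof.
  destruct (Rle_dec 0 K) as [HK0|HK0].
  2:{ exists 0; split; [lra|]. intros psi u rho HK. elim HK0. eapply bnd_ge0; eauto. }
  induction k as [|k [L [HL IH]]].
  - exists (1 + K); split; [lra|]. intros psi u rho HK Hu Hr. cbn [Giter]. destruct s.
    + split.
      * eapply bnd_le; [apply bnd_dlt; sf|]. unfold wY; cbn. rewrite Rplus_0_r, sqrt_1. lra.
      * intros M. rewrite rsum_zero; [nra|]. intros n _. unfold seq_sub.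
        replace (dlt 0 n - dlt 0 n)%cx with C0 by ring. rewrite Cnorm2_C0; ring.
    + split.
      * eapply bnd_le; [apply bnd_HY; eassumption|lra].
      * eapply bnd_le; [apply bnd_HY; eassumption|nra].
  (* The first term bounds the new iterate. In the difference, [16 * L] accounts for the change of
     symbol, the perturbed iterate being bounded by [4 * L], and [4 * K * L] for the change of
     argument. *)
  - exists (2 * K * L + 16 * L + 4 * K * L); split; [nra|].
    intros psi u rho HK Hu Hr. destruct (IH psi u rho HK Hu Hr) as [h1 h2].
    assert (Hr2 : 0 <= rho * rho <= 1) by nra.
    assert (Fpsi : fin wH psi) by (exists K; auto).
    assert (Fu : fin wH u) by (eexists; apply (bnd_approx wH u psi _ _ weight_wH HK Hu)).
    assert (0 <= K * L) by nra.
    cbn [Giter]. split.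
    + eapply bnd_le; [apply hank_bnd; [apply bnd_shift; [sf|exact HK]|exact h1]|]. lra.
    + eapply bnd_le.
      * apply hank_diff_bnd.
        -- change (seq_sub (shift s u) (shift s psi)) with (shift s (seq_sub u psi)). apply bnd_shift; [sf|eassumption].
        -- apply (bnd_approx wY _ _ _ _ weight_wY h1 h2).
        -- apply bnd_shift; [sf|eassumption].
        -- exact h2.
        -- sf.
        -- sf.
      * assert (L * (rho * rho) <= L) by nra. nra.
Qed.
Lemma Giter_lipschitz s K : exists L, 0 <= L /\ forall psi u rho k,
  bnd wH psi K -> bnd wH (seq_sub u psi) (rho * rho) -> 0 <= rho <= 1 -> (k <= 4)%nat ->
  bnd wY (Giter s psi k) L /\ bnd wY (seq_sub (Giter s u k) (Giter s psi k)) (L * (rho * rho)).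
Proof.
  cut (forall n, exists L, 0 <= L /\ forall psi u rho k,
    bnd wH psi K -> bnd wH (seq_sub u psi) (rho * rho) -> 0 <= rho <= 1 -> (k < n)%nat ->
    bnd wY (Giter s psi k) L /\ bnd wY (seq_sub (Giter s u k) (Giter s psi k)) (L * (rho * rho))).
  { intros H. destruct (H 5%nat) as [L [HL h]]. exists L; split; auto. intros; apply h; auto; lia. }
  induction n as [|n [L [HL IH]]].
  - exists 0; split; [lra|]; intros; lia.
  - destruct (Giter_lipschitz_k s K n) as [L' [HL' h']]. exists (L + L'); split; [lra|].
    intros psi u rho k HK Hu Hr Hk. assert (0 <= rho * rho) by nra.
    destruct (Nat.eq_dec k n) as [->|Hkn].
    + destruct (h' psi u rho HK Hu Hr) as [h1 h2]. split; (eapply bnd_le; [eassumption|]); nra.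
    + destruct (IH psi u rho k HK Hu Hr ltac:(lia)) as [h1 h2]. split; (eapply bnd_le; [eassumption|]); nra.
Qed.

Lemma sqrt_mul_sqr L r : 0 <= L -> 0 <= r -> sqrt (L * (r * r)) = sqrt L * r.
Proof. intros. rewrite sqrt_mult by nra. now rewrite sqrt_square. Qed.

Lemma ip_diff_bound x y x' y' L r : 0 <= r <= 1 -> bnd w1 x' L -> bnd w1 y' L ->
  bnd w1 (seq_sub x x') (L * (r * r)) -> bnd w1 (seq_sub y y') (L * (r * r)) ->
  Cnorm (ip x y - ip x' y')%cx <= 3 * L * r.
Proof.
  intros Hr Hx' Hy' Hx Hy.
  assert (HL : 0 <= L) by (eapply bnd_ge0; eauto).
  assert (Hyb : bnd w1 y (4 * L)).
  { eapply bnd_le; [apply (bnd_approx w1 _ _ _ _ weight_w1 Hy' Hy)|]. assert (r * r <= 1) by nra. nra. }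
  assert (Hxb : bnd w1 x (4 * L)).
  { eapply bnd_le; [apply (bnd_approx w1 _ _ _ _ weight_w1 Hx' Hx)|]. assert (r * r <= 1) by nra. nra. }
  assert (fin w1 x /\ fin w1 y /\ fin w1 x' /\ fin w1 y') as (? & ? & ? & ?) by (repeat split; eexists; eauto).
  replace (ip x y - ip x' y')%cx with (ip (seq_sub x x') y + ip x' (seq_sub y y'))%cx.
  - eapply Rle_trans; [apply Cnorm_triang|].
    pose proof (ip_bound _ _ _ _ Hx Hyb) as h1. pose proof (ip_bound _ _ _ _ Hx' Hy) as h2.
    rewrite sqrt_mul_sqr in h1, h2 by lra.
    replace (4 * L) with (L * (2 * 2)) in h1 by ring. rewrite sqrt_mul_sqr in h1 by lra.
    pose proof (sqrt_sqrt L HL). nra.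
  - rewrite ip_sub_l, ip_sub_r by sf. ring.
Qed.
Lemma Theta_lipschitz s K : exists L, 0 <= L /\ forall psi u rho,
  bnd wH psi K -> bnd wH (seq_sub u psi) (rho * rho) -> 0 <= rho <= 1 ->
  Cnorm (Theta s u - Theta s psi)%cx <= L * rho.
Proof.
  destruct (Giter_lipschitz s K) as [L [HL h]]. exists (3 * L); split; [lra|].
  intros psi u rho HK Hu Hr. unfold Theta.
  destruct (h psi u rho 1%nat HK Hu Hr ltac:(lia)) as [a1 a2].
  destruct (h psi u rho 2%nat HK Hu Hr ltac:(lia)) as [b1 b2].
  apply ip_diff_bound; auto using bnd_Y1.
Qed.

(** * Perturbation of the symbol in a single frequency *)

Lemma shift_dlt s : shift s (dlt s) = dlt 0.
Proof.
  seq_ext n. unfold shift, dlt. destruct (Nat.eqb_spec (n + s) s), (Nat.eqb_spec n 0); try lia; easy.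
Qed.
Lemma hank_dlt0 x : hank (dlt 0) x = sscal ((x 0%nat)^*)%cx (dlt 0).
Proof.
  seq_ext n. unfold hank, sscal. rewrite (ip_finite _ _ 1).
  - cbn [Csum]. unfold shift, dlt. cbn [Nat.add]. destruct (Nat.eqb n 0); ring.
  - intros j Hj. unfold shift, dlt. destruct (Nat.eqb_spec (j + n) 0); [lia|ring].
Qed.
(** Reason for perturbing in frequency [s]: the shifted perturbation is a constant, whose Hankel
    operator has rank one and sees only the zeroth coefficient. *)
Lemma Gop_perturb s c a x : fin w1 c -> fin w1 x ->
  Gop s (sadd c (sscal a (dlt s))) x = sadd (Gop s c x) (sscal (a * (x 0%nat)^*)%cx (dlt 0)).
Proof.
  intros. unfold Gop.
  change (shift s (sadd c (sscal a (dlt s)))) with (sadd (shift s c) (sscal a (shift s (dlt s)))).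
  rewrite shift_dlt, hank_add_l, hank_scal_l, hank_dlt0 by sf.
  seq_ext n. unfold sadd, sscal. ring.
Qed.
Lemma Gop_add s c x y : fin w1 c -> fin w1 x -> fin w1 y ->
  Gop s c (sadd x y) = sadd (Gop s c x) (Gop s c y).
Proof. intros; apply hank_add_r; sf. Qed.
Lemma Gop_scal s c k x : fin w1 c -> fin w1 x -> Gop s c (sscal k x) = sscal (k^*)%cx (Gop s c x).
Proof. intros; apply hank_scal_r; sf. Qed.

(** (G^2 - k) G^j y, with y = 1 for H and y = u for K. *)
Definition resid (s : nat) (c : nat -> Cx) (k : R) (j : nat) : nat -> Cx :=
  sadd (Giter s c (j + 2)) (sscal (Cof (- k)) (Giter s c j)).

(** The coefficient of eps in <(G^2 - k) G y, G^2 y> along the symbols c + eps eta z^s; up to a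
    factor -i or i it is the first-order initial velocity of the observable in the rotating frame.
    It is only real linear in [eta]. *)
Definition drift (s : nat) (c : nat -> Cx) (eta : Cx) : Cx :=
  (eta * (Giter s c 2 0%nat)^* * ip (Giter s c 1) (Gop s c (dlt 0))
   + eta^* * (Giter s c 3 0%nat * Giter s c 1 0%nat))%cx.

Section Perturbation.
Variables (s : nat) (c : nat -> Cx) (k : R) (eta : Cx).
Hypothesis Hs : (s <= 1)%nat.
Hypothesis Hc : fin wH c.
Hypothesis Heig : Giter s c 3 = sscal (Cof k) (Giter s c 1).
Hypothesis Heta : Cnorm eta = 1.

Let u0 (eps : R) := sadd c (sscal (Cof eps * eta)%cx (dlt s)).

Lemma u0_close eps : 0 <= eps -> bnd wH (seq_sub (u0 eps) c) ((2 * eps) * (2 * eps)).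
Proof.
  intros He.
  replace (seq_sub (u0 eps) c) with (sscal (Cof eps * eta)%cx (dlt s))
    by (unfold u0; seq_ext n; unfold seq_sub, sadd, sscal; ring).
  eapply bnd_le; [apply bnd_scal, bnd_dlt; sf|].
  rewrite Cnorm2_mul, Cnorm2_Cof, <- (Cnorm_sqr eta), Heta. unfold wH.
  apply le_INR in Hs. cbn in Hs. nra.
Qed.

Lemma resid_zero j : (j <= 2)%nat -> (1 <= j)%nat -> resid s c k j = fun _ => C0.
Proof.
  intros H1 H2.
  assert (E4 : Giter s c 4 = sscal (Cof k) (Giter s c 2)).
  { change (Giter s c 4) with (Gop s c (Giter s c 3)). rewrite Heig, Gop_scal, Cconj_Cof by sf. easy. }
  assert (j = 1%nat \/ j = 2%nat) as [->| ->] by lia; unfold resid; cbn [Nat.add];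
  (rewrite ?E4, ?Heig; seq_ext n; unfold sadd, sscal; cx_ring).
Qed.

(** All factors of <(G^2 - k) G y, G^2 y> vary, including y when [s = 1]. Replacing the right factor
    by its unperturbed value [z] costs O(eps^2), as the residual is O(eps). Self-adjointness then
    moves G^2 - k onto [z], which the unperturbed operator annihilates, so the variation of G y also
    enters at second order only. *)
Lemma perturbation_estimates : exists C, 0 <= C /\ forall eps, 0 < eps <= 1 / 2 ->
  Cnorm (Theta s (u0 eps) - Theta s c)%cx <= C * eps /\
  Cnorm (ip (resid s (u0 eps) k 1) (Giter s (u0 eps) 2) - Cof eps * drift s c eta)%cx <= C * (eps * eps) /\
  bnd w1 (resid s (u0 eps) k 1) (C * (eps * eps)) /\
  bnd w1 (resid s (u0 eps) k 2) (C * (eps * eps)).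
Proof.
  assert (Hc' := Hc). destruct Hc' as [K HK].
  destruct (Theta_lipschitz s K) as [L1 [HL1 hT]].
  destruct (Giter_lipschitz s K) as [L [HL hG]].
  set (z := Giter s c 2).
  (* The first-order part of (G^2 - k) [z] for the perturbed G, one term for each of the two factors
     G. *)
  set (v := sadd (sscal (eta^* * z 0%nat)%cx (Gop s c (dlt 0))) (sscal (eta * (Giter s c 3 0%nat)^*)%cx (dlt 0))).
  assert (Fz : fin wY z) by (unfold z; sf).
  assert (Fv : fin w1 v) by (unfold v; sf).
  assert (Fv' := Fv). destruct Fv' as [V HV].
  assert (HV0 : 0 <= V) by (eapply bnd_ge0; eauto).
  set (LR := 4 * (2 * L + 2 * (k * k * L))).
  assert (HLR : 0 <= LR) by (unfold LR; pose proof (Rle_0_sqr k) as hk; unfold Rsqr in hk; nra).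
  set (Z := Cnorm (z 0%nat)). assert (HZ : 0 <= Z) by apply Cnorm_ge0.
  (* Three second-order errors: the residual against the variation of [z], the variation of G y
     against [v], and the product of the two rank one terms. *)
  set (C2 := sqrt LR * (sqrt L * 2) + sqrt L * 2 * sqrt V + Z * sqrt (4 * L)).
  assert (HC2 : 0 <= C2).
  { unfold C2. repeat apply Rplus_le_le_0_compat; repeat apply Rmult_le_pos; auto using sqrt_pos; lra. }
  exists (2 * L1 + LR + C2). split; [lra|].
  intros eps He.
  assert (Hrho : 0 <= 2 * eps <= 1) by lra.
  pose proof (u0_close eps ltac:(lra)) as Hu. set (u := u0 eps) in *.
  assert (Fu : fin wH u) by (unfold u, u0; sf).
  assert (HR : forall j, (1 <= j)%nat -> (j <= 2)%nat -> bnd w1 (resid s u k j) (LR * (eps * eps))).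
  { intros j h1 h2.
    replace (resid s u k j) with (seq_sub (resid s u k j) (resid s c k j))
      by (rewrite (resid_zero j h2 h1); seq_ext n; unfold seq_sub; ring).
    replace (seq_sub (resid s u k j) (resid s c k j)) with
      (sadd (seq_sub (Giter s u (j + 2)) (Giter s c (j + 2))) (sscal (Cof (- k)) (seq_sub (Giter s u j) (Giter s c j))))
      by (unfold resid; seq_ext n; unfold seq_sub, sadd, sscal; ring).
    destruct (hG c u (2 * eps) (j + 2)%nat HK Hu Hrho ltac:(lia)) as [_ a1].
    destruct (hG c u (2 * eps) j HK Hu Hrho ltac:(lia)) as [_ a2].
    apply bnd_Y1 in a1, a2.
    eapply bnd_le; [apply bnd_add; [sf|exact a1|apply bnd_scal; exact a2]|].
    rewrite Cnorm2_Cof. unfold LR. right; ring. }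
  destruct (hG c u (2 * eps) 1%nat HK Hu Hrho ltac:(lia)) as [g1 d1].
  destruct (hG c u (2 * eps) 2%nat HK Hu Hrho ltac:(lia)) as [g2 d2].
  fold z in g2, d2.
  assert (Hee : 0 <= eps * eps) by nra.
  split; [|split; [|split]].
  - eapply Rle_trans; [apply (hT c u (2 * eps)); auto|]. nra.
  - assert (FR : fin w1 (resid s u k 1)) by (eexists; apply HR; lia).
    assert (EG : seq_sub (Gop s u (Gop s u z)) (sscal (Cof k) z)
       = sadd (sscal (Cof eps) v) (sscal (Cof (eps * eps) * z 0%nat)%cx (dlt 0))).
    { unfold u, u0. rewrite (Gop_perturb s c _ z) by sf. rewrite Gop_perturb by sf.
      rewrite Gop_add, Gop_scal by sf.
      assert (E4 : Gop s c (Gop s c z) = sscal (Cof k) z).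
      { unfold z. change (Gop s c (Gop s c (Giter s c 2))) with (Gop s c (Giter s c 3)).
        rewrite Heig, Gop_scal, Cconj_Cof by sf. easy. }
      rewrite E4. change (Gop s c z 0%nat) with (Giter s c 3 0%nat).
      seq_ext n. unfold v, seq_sub, sadd, sscal.
      change (Gop s c z 0%nat) with (Giter s c 3 0%nat).
      replace (dlt 0 0%nat) with C1 by easy.
      rewrite !Cconj_add, !Cconj_mul, !Cconj_conj, Cconj_C1, Cconj_Cof.
      assert (Ee : (eta * eta^* = C1)%cx) by (rewrite Cmul_Cconj, <- Cnorm_sqr, Heta; cx_ring).
      assert (Eq : Cof (eps * eps) = (Cof eps * Cof eps)%cx) by cx_ring. rewrite Eq.
      set (e := Cof eps). set (p := Gop s c (dlt 0) n). set (q := dlt 0 n). set (g := (Giter s c 3 0%nat)^*%cx).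
      transitivity (e * (eta^* * z 0%nat) * p + e * (eta * g) * q + e * e * (eta * eta^*) * z 0%nat * q)%cx; [ring|].
      rewrite Ee; ring. }
    assert (E1 : (ip (resid s u k 1) z = Cof eps * ip (Giter s u 1) v + Cof (eps * eps) * (z 0%nat)^* * Giter s u 1 0%nat)%cx).
    { unfold resid. cbn [Nat.add]. rewrite ip_add_l, ip_scal_l by sf.
      change (Giter s u 3) with (Gop s u (Gop s u (Giter s u 1))). rewrite Gop2_sym by sf.
      transitivity (ip (Giter s u 1) (seq_sub (Gop s u (Gop s u z)) (sscal (Cof k) z))).
      - rewrite ip_sub_r, ip_scal_r, Cconj_Cof by sf. set (a := ip _ _). set (b := ip _ _). cx_ring.
      - rewrite EG, ip_add_r, !ip_scal_r, ip_dlt_r, !Cconj_mul, !Cconj_Cof by sf. ring. }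
    assert (E2 : ip (Giter s c 1) v = drift s c eta).
    { unfold v, drift. rewrite ip_add_r, !ip_scal_r, ip_dlt_r, !Cconj_mul, !Cconj_conj by sf. fold z. ring. }
    replace (ip (resid s u k 1) (Giter s u 2)) with (ip (resid s u k 1) z + ip (resid s u k 1) (seq_sub (Giter s u 2) z))%cx
      by (rewrite ip_sub_r by sf; ring).
    rewrite E1, <- E2.
    replace (Cof eps * ip (Giter s u 1) v + Cof (eps * eps) * (z 0%nat)^* * Giter s u 1 0%nat +
       ip (resid s u k 1) (seq_sub (Giter s u 2) z) - Cof eps * ip (Giter s c 1) v)%cx with
      (ip (resid s u k 1) (seq_sub (Giter s u 2) z) + Cof eps * ip (seq_sub (Giter s u 1) (Giter s c 1)) v
       + Cof (eps * eps) * (z 0%nat)^* * Giter s u 1 0%nat)%cx by (rewrite ip_sub_l by sf; ring).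
    eapply Rle_trans; [apply Cnorm_triang|].
    eapply Rle_trans; [apply Rplus_le_compat_r, Cnorm_triang|].
    rewrite !Cnorm_mul, !Cnorm_Cof, Cnorm_conj. fold Z.
    rewrite (Rabs_pos_eq eps) by lra. rewrite (Rabs_pos_eq (eps * eps)) by nra.
    pose proof (ip_bound _ _ _ _ (HR 1%nat ltac:(lia) ltac:(lia)) (bnd_Y1 _ _ d2)) as b1.
    rewrite !sqrt_mul_sqr in b1 by lra.
    pose proof (ip_bound _ _ _ _ (bnd_Y1 _ _ d1) HV) as b2. rewrite sqrt_mul_sqr in b2 by lra.
    assert (b3 : Cnorm (Giter s u 1 0%nat) <= sqrt (4 * L)).
    { apply sqrt_le_1_alt.
      assert (h : bnd wY (Giter s u 1) (2 * (L * (2 * eps * (2 * eps))) + 2 * L)) by (apply (bnd_approx wY _ _ _ _ weight_wY g1 d1)).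
      apply bnd_Y1 in h.
      pose proof (bnd_point _ _ _ 0%nat weight_w1 h) as h1. unfold w1 in h1.
      assert (2 * eps * (2 * eps) <= 1) by nra. nra. }
    pose proof (Cnorm_ge0 (Giter s u 1 0%nat)).
    set (B1 := Cnorm (ip (resid s u k 1) _)) in *. set (B2 := Cnorm (ip (seq_sub _ _) v)) in *.
    set (B3 := Cnorm (Giter s u 1 0%nat)) in *.
    apply Rle_trans with (C2 * (eps * eps)); [|nra].
    unfold C2.
    assert (eps * B2 <= eps * (sqrt L * (2 * eps) * sqrt V)) by (apply Rmult_le_compat_l; lra).
    assert (eps * eps * Z * B3 <= eps * eps * Z * sqrt (4 * L)) by (apply Rmult_le_compat_l; [apply Rmult_le_pos; lra|lra]).
    lra.
  - eapply bnd_le; [apply HR; lia|]. nra.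
  - eapply bnd_le; [apply HR; lia|]. nra.
Qed.
End Perturbation.

(** * The instability criterion *)

Lemma Cexpi_add a b : Cexpi (a + b) = (Cexpi a * Cexpi b)%cx.
Proof.
  apply injective_projections; unfold Cexpi; cx_unfold; [rewrite cos_plus|rewrite sin_plus]; ring.
Qed.
Lemma Cexpi_norm2 a : Cnorm2 (Cexpi a) = 1.
Proof. unfold Cnorm2, Cexpi; cbn. pose proof (sin2_cos2 a) as H. unfold Rsqr in H. lra. Qed.
Lemma Cexpi_norm a : Cnorm (Cexpi a) = 1.
Proof. unfold Cnorm. rewrite Cexpi_norm2. apply sqrt_1. Qed.
Lemma Cexpi_0 : Cexpi 0 = C1.
Proof. unfold Cexpi. now rewrite cos_0, sin_0. Qed.
Lemma Cexpi_mul_conj a : (Cexpi a * (Cexpi a)^* = C1)%cx.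
Proof. now rewrite Cmul_Cconj, Cexpi_norm2. Qed.
Lemma Cder_Cexpi m t : Cder (fun r => Cexpi (m * r)) t (Ci * Cof m * Cexpi (m * t))%cx.
Proof.
  assert (D : derivable_pt_lim (fun r => m * r) t m).
  { pose proof (derivable_pt_lim_scal _ m _ _ (derivable_pt_lim_id t)) as H.
    rewrite Rmult_1_r in H. exact H. }
  split.
  - replace (Cre (Ci * Cof m * Cexpi (m * t))%cx) with (- sin (m * t) * m) by (unfold Cexpi; cx_unfold; ring).
    apply (derivable_pt_lim_comp (fun r => m * r) cos); [exact D|apply derivable_pt_lim_cos].
  - replace (Cim (Ci * Cof m * Cexpi (m * t))%cx) with (cos (m * t) * m) by (unfold Cexpi; cx_unfold; ring).
    apply (derivable_pt_lim_comp (fun r => m * r) sin); [exact D|apply derivable_pt_lim_sin].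
Qed.

Lemma ip_prod_ext x y x' y' : (forall n, (x n * (y n)^* = x' n * (y' n)^*)%cx) -> ip x y = ip x' y'.
Proof.
  intros H. unfold ip. f_equal. apply functional_extensionality; intros M. apply Csum_ext; auto.
Qed.
(** The rotation in [b] acts on every iterate as on the symbol. The remaining phase is conjugated at
    each application of G, and only its modulus matters for |Theta|. *)
Lemma Giter_rot s c a b k : fin wH c -> exists zeta, Cnorm zeta = 1 /\
  forall n, Giter s (rot a b c) k n = (zeta * Cexpi (INR n * b) * Giter s c k n)%cx.
Proof.
  intros Hc. induction k as [|k [zeta [Hz IH]]]; cbn [Giter].
  - destruct s.
    + exists C1. split; [apply Cnorm_C1|]. intros n. unfold dlt. destruct (Nat.eqb_spec n 0) as [->|]; [|ring].
      cbn [INR]. rewrite Rmult_0_l, Cexpi_0. ring.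
    + exists (Cexpi a). split; [apply Cexpi_norm|]. intros n. unfold rot. now rewrite Cexpi_add.
  - exists (Cexpi (a + INR s * b) * zeta^*)%cx. split.
    + rewrite Cnorm_mul, Cexpi_norm, Cnorm_conj, Hz. ring.
    + intros n. unfold Gop, hank. rewrite <- ip_scal_l by sf.
      apply ip_prod_ext. intros j. rewrite IH. unfold sscal, shift, rot.
      replace (a + INR (j + n + s) * b) with ((a + INR s * b) + (INR n * b + INR j * b))
        by (rewrite !plus_INR; ring).
      rewrite !Cexpi_add, !Cconj_mul.
      transitivity (Cexpi a * Cexpi (INR s * b) * Cexpi (INR n * b) * (Cexpi (INR j * b) * (Cexpi (INR j * b))^*)
        * c (j + n + s)%nat * (zeta^* * (Giter s c k j)^*))%cx; [ring|].
      rewrite Cexpi_mul_conj. ring.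
Qed.
Lemma Theta_rot s c a b : fin wH c -> Cnorm (Theta s (rot a b c)) = Cnorm (Theta s c).
Proof.
  intros Hc. destruct (Giter_rot s c a b 1 Hc) as [z1 [h1 e1]]. destruct (Giter_rot s c a b 2 Hc) as [z2 [h2 e2]].
  unfold Theta. replace (ip (Giter s (rot a b c) 1) (Giter s (rot a b c) 2))
    with (z1 * z2^* * ip (Giter s c 1) (Giter s c 2))%cx.
  - rewrite !Cnorm_mul, Cnorm_conj, h1, h2. ring.
  - rewrite <- ip_scal_l by sf. apply ip_prod_ext. intros j. rewrite e1, e2. unfold sscal.
    rewrite !Cconj_mul.
    transitivity (z1 * z2^* * (Cexpi (INR j * b) * (Cexpi (INR j * b))^*) * Giter s c 1 j * (Giter s c 2 j)^*)%cx; [|ring].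
    rewrite Cexpi_mul_conj; ring.
Qed.
Lemma bnd_rot w c a b B : bnd w c B -> bnd w (rot a b c) B.
Proof.
  intros H M. erewrite rsum_ext; [apply (H M)|]. intros n _; cbn beta. unfold rot.
  rewrite Cnorm2_mul, Cexpi_norm2. ring.
Qed.

(** * Growth of the observable along a solution *)

Lemma second_order_lower (h h1 h2 : R -> R) K t : 0 < t ->
  (forall r, derivable_pt_lim h r (h1 r)) -> (forall r, derivable_pt_lim h1 r (h2 r)) ->
  (forall r, Rabs (h2 r) <= K) -> h 0 + h1 0 * t - K * t * t <= h t.
Proof.
  intros Ht H1 H2 HK.
  assert (HK0 : 0 <= K) by (eapply Rle_trans; [apply Rabs_pos|apply (HK 0)]).
  destruct (MVT_cor2 h h1 0 t Ht) as [r [E Hr]]; [auto|].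
  assert (E1 : Rabs (h1 (0 + r) - h1 0) <= K * Rabs r).
  { apply (mvt_bound h1 h2 0 r K (Rabs r + 1)); auto; lra. }
  rewrite Rplus_0_l, (Rabs_pos_eq r) in E1 by lra.
  apply Rcomplements.Rabs_le_between in E1. rewrite Rminus_0_r in E.
  assert (h1 r >= h1 0 - K * t) by nra. nra.
Qed.
Lemma Cder_zero_const f : (forall t, Cder f t C0) -> forall t, Cre (f t) = Cre (f 0).
Proof.
  intros H t.
  assert (E : Rabs (Cre (f (0 + t)) - Cre (f 0)) <= 0 * Rabs t).
  { apply (mvt_bound (fun s => Cre (f s)) (fun _ => 0) 0 t 0 (Rabs t + 1)); [|intros; rewrite Rabs_R0; lra|lra].
    intros s; apply (H s). }
  rewrite Rplus_0_l, Rmult_0_l in E. pose proof (Rabs_pos (Cre (f t) - Cre (f 0))).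
  assert (Rabs (Cre (f t) - Cre (f 0)) = 0) as E0 by lra.
  destruct (Req_dec (Cre (f t) - Cre (f 0)) 0) as [|n]; [lra|]. now elim (Rabs_no_R0 _ n).
Qed.
Lemma bnd_ip_self x : fin w1 x -> bnd w1 x (Cre (ip x x)).
Proof.
  intros Hx M. destruct (ip_cv x x Hx Hx) as [H _].
  set (p := fun M => rsum M (fun n => w1 n * Cnorm2 (x n))).
  assert (E : forall M, Cre (Csum M (fun n => (x n * (x n)^*)%cx)) = p M).
  { intros K. rewrite Csum_re. apply rsum_ext; intros. unfold w1. cx_unfold; ring. }
  apply le_epsilon; intros eps He. destruct (H eps He) as [N h].
  specialize (h (max N M) ltac:(lia)). rewrite E in h. unfold Rdist in h.
  pose proof (Rle_abs (p (max N M) - Cre (ip x x))).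
  assert (p M <= p (max N M)) by (apply rsum_mono; [intros; now apply bnd_term_ge0, weight_w1|lia]).
  change (p M <= Cre (ip x x) + eps). lra.
Qed.
Lemma ip_self_le x B : bnd w1 x B -> Cre (ip x x) <= B.
Proof.
  intros HB. eapply Rle_trans; [apply Rle_abs|]. eapply Rle_trans; [apply Cre_le|].
  eapply Rle_trans; [apply ip_bound; eassumption|]. rewrite sqrt_sqrt; [lra|eapply bnd_ge0; eauto].
Qed.

(** The parameter of [evol] for G^k y: it starts at 1 for y = 1 and at 0 for y = u, and [evol_Gop]
    flips it at every application of G. *)
Fixpoint lam (s k : nat) : R := match k with O => 1 - INR s | S k => 1 - lam s k end.

Lemma evol_Giter s u k : (s <= 1)%nat -> szego_sol u -> evol s u (lam s k) (fun t => Giter s (u t) k).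
Proof.
  intros Hs Hu. induction k; cbn [lam Giter].
  - destruct s as [|[|]]; [| |lia].
    + replace (1 - INR 0) with 1 by (cbn; ring). apply evol_dlt0. now apply szego_contw.
    + replace (1 - INR 1) with 0 by (cbn; ring). now apply szego_evol.
  - apply evol_Gop; auto; [now apply szego_contw|now apply szego_evol].
Qed.

Section Dynamics.
Variables (s : nat) (u : R -> nat -> Cx) (k : R).
Hypothesis Hs : (s <= 1)%nat.
Hypothesis Hu : szego_sol u.
(** This sign is [lam s 2 - lam s 1], opposite for H and K. *)
Let sg : R := 1 - 2 * INR s.
Let om : Cx := (- Ci * Cof sg)%cx.

Lemma fin_sol t : fin wH (u t).
Proof. apply (szego_contw u Hu). Qed.
Hint Resolve fin_sol : seqfin.

Lemma lam_succ_succ j : lam s (S (S j)) = lam s j.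
Proof. cbn [lam]. ring. Qed.
Lemma evol_resid j : evol s u (lam s j) (fun t => resid s (u t) k j).
Proof.
  unfold resid. apply evol_lin; [now apply szego_contw| |now apply evol_Giter].
  replace (j + 2)%nat with (S (S j)) by lia. rewrite <- lam_succ_succ. now apply evol_Giter.
Qed.
Lemma fin_resid t j : fin wY (resid s (u t) k j).
Proof. unfold resid. sf. Qed.
Hint Resolve fin_resid : seqfin.

Lemma resid_bound j B : bnd w1 (resid s (u 0) k j) B -> forall t, bnd w1 (resid s (u t) k j) B.
Proof.
  intros HB t. eapply bnd_le; [apply bnd_ip_self; sf|].
  rewrite (Cder_zero_const (fun t => ip (resid s (u t) k j) (resid s (u t) k j))).
  - now apply ip_self_le.
  - intros r. eapply Cder_eq.
    + apply (evol_pair s u (lam s j) (lam s j) (fun t => resid s (u t) k j) (fun t => resid s (u t) k j));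
      [now apply szego_contw|apply evol_resid|apply evol_resid].
    + rewrite Rminus_diag. change (Cof 0) with C0. ring.
Qed.

(** Differentiating F0 or F1 returns [k] times the same function plus the next one, up to the factor
    [om]. The chain stops at F2, a pairing of two residuals, bounded for all times by their
    conserved norms. *)
Let F0 t := Theta s (u t).
Let F1 t := ip (resid s (u t) k 1) (Giter s (u t) 2).
Let F2 t := ip (resid s (u t) k 1) (resid s (u t) k 2).

Lemma om_eq : (Ci * Cof (lam s 1 - lam s 2) = om)%cx.
Proof.
  unfold om, sg. replace (lam s 1 - lam s 2) with (- (1 - 2 * INR s)) by (cbn [lam]; ring). cx_ring.
Qed.
Lemma Cder_F0 t : Cder F0 t (om * (F1 t + Cof k * F0 t))%cx.
Proof.
  unfold F0, Theta. eapply Cder_eq.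
  - apply (evol_pair s u (lam s 1) (lam s 2) (fun t => Giter s (u t) 1) (fun t => Giter s (u t) 2));
    [now apply szego_contw|now apply evol_Giter|now apply evol_Giter].
  - rewrite om_eq. f_equal. unfold F1, resid. cbn [Nat.add]. rewrite ip_add_l, ip_scal_l by sf.
    change (Gop s (u t) (Gop s (u t) (Giter s (u t) 1))) with (Giter s (u t) 3).
    set (a := ip _ _). set (b := ip _ _). cx_ring.
Qed.
Lemma Cder_F1 t : Cder F1 t (om * (F2 t + Cof k * F1 t))%cx.
Proof.
  unfold F1. eapply Cder_eq.
  - apply (evol_pair s u (lam s 1) (lam s 2) (fun t => resid s (u t) k 1) (fun t => Giter s (u t) 2));
    [now apply szego_contw|apply evol_resid|now apply evol_Giter].
  - rewrite om_eq. f_equal. rewrite Gop2_sym by sf.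
    unfold F2. unfold resid at 3. cbn [Nat.add]. rewrite ip_add_r, ip_scal_r, Cconj_Cof by sf.
    change (Gop s (u t) (Gop s (u t) (Giter s (u t) 2))) with (Giter s (u t) 4).
    set (a := ip _ _). set (b := ip _ _). cx_ring.
Qed.

(* In the rotating frame the observable has velocity [om * F1] and acceleration [om^2 * F2]. *)
Lemma Theta_growth w B : 0 <= B -> Cnorm w = 1 ->
  bnd w1 (resid s (u 0) k 1) B -> bnd w1 (resid s (u 0) k 2) B ->
  forall t, 0 < t ->
  Cre (w^* * F0 0)%cx + Cre (w^* * (om * F1 0))%cx * t - B * t * t <= Cnorm (F0 t).
Proof.
  intros HB0 Hw HB1 HB2 t Ht.
  (* The frequency satisfies i m = - [om] k, so that multiplication by [E] removes the terms in [k]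
     from both derivatives. *)
  set (m := sg * k). set (E := fun r => Cexpi (m * r)).
  assert (Eom : (Ci * Cof m = - (om * Cof k))%cx) by (unfold om, m; cx_ring).
  assert (Hom : Cnorm om = 1).
  { unfold om. rewrite Cnorm_mul, Cnorm_opp, Cnorm_Ci, Cnorm_Cof. unfold sg.
    destruct s as [|[|]]; [| |lia]; cbn.
    - replace (1 - 2 * 0) with 1 by ring. rewrite Rabs_R1; ring.
    - replace (1 - 2 * 1) with (-1) by ring. rewrite Rabs_left by lra. ring. }
  assert (D0 : forall r, Cder (fun r => (w^* * (E r * F0 r))%cx) r (w^* * (om * (E r * F1 r)))%cx).
  { intros r. apply Cder_scal. eapply Cder_eq; [apply (Cder_mul E F0); [apply Cder_Cexpi|apply Cder_F0]|].
    rewrite Eom. fold (E r). ring. }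
  assert (D1 : forall r, Cder (fun r => (w^* * (om * (E r * F1 r)))%cx) r (w^* * (om * (om * (E r * F2 r))))%cx).
  { intros r. apply Cder_scal, Cder_scal. eapply Cder_eq; [apply (Cder_mul E F1); [apply Cder_Cexpi|apply Cder_F1]|].
    rewrite Eom. fold (E r). ring. }
  assert (HE : forall r, Cnorm (E r) = 1) by (intros; apply Cexpi_norm).
  assert (HE0 : E 0 = C1) by (unfold E; rewrite Rmult_0_r; apply Cexpi_0).
  assert (T : Cre (w^* * (E 0 * F0 0))%cx + Cre (w^* * (om * (E 0 * F1 0)))%cx * t - B * t * t <= Cre (w^* * (E t * F0 t))%cx).
  { apply (second_order_lower (fun r => Cre (w^* * (E r * F0 r))%cx) (fun r => Cre (w^* * (om * (E r * F1 r)))%cx)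
      (fun r => Cre (w^* * (om * (om * (E r * F2 r))))%cx)); auto.
    - intros r; apply D0.
    - intros r; apply D1.
    - intros r. eapply Rle_trans; [apply Cre_le|]. rewrite !Cnorm_mul, Cnorm_conj, Hw, Hom, HE, !Rmult_1_l.
      eapply Rle_trans; [apply ip_bound; apply resid_bound; eassumption|]. rewrite sqrt_sqrt; lra. }
  rewrite HE0 in T.
  replace (C1 * F0 0)%cx with (F0 0) in T by ring. replace (C1 * F1 0)%cx with (F1 0) in T by ring.
  eapply Rle_trans; [exact T|]. eapply Rle_trans; [apply Rle_abs|]. eapply Rle_trans; [apply Cre_le|].
  rewrite !Cnorm_mul, Cnorm_conj, Hw, HE. lra.
Qed.
End Dynamics.

Lemma hnorm_dlt_scal s a : is_hnorm (sscal a (dlt s)) (Cnorm a * sqrt (1 + INR s)).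
Proof.
  pose proof (pos_INR s). split.
  - apply Rmult_le_pos; [apply Cnorm_ge0|apply sqrt_pos].
  - replace (Cnorm a * sqrt (1 + INR s) * (Cnorm a * sqrt (1 + INR s))) with ((1 + INR s) * Cnorm2 a).
    2:{ rewrite <- Cnorm_sqr. transitivity (Cnorm a * Cnorm a * (sqrt (1 + INR s) * sqrt (1 + INR s))); [|ring].
        rewrite sqrt_sqrt by lra. ring. }
    intros eps He. exists s. intros n Hn. rewrite <- rsum_sum_f_R0.
    replace (rsum (S n) (fun k => (1 + INR k) * Cnorm2 (sscal a (dlt s) k))) with ((1 + INR s) * Cnorm2 a).
    { unfold Rdist. rewrite Rminus_diag, Rabs_R0. auto. }
    induction Hn as [|n Hn IH].
    + cbn [rsum]. rewrite rsum_zero.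
      * unfold sscal, dlt. rewrite Nat.eqb_refl. replace (a * C1)%cx with a by ring. ring.
      * intros j Hj. unfold sscal, dlt. destruct (Nat.eqb_spec j s); [lia|].
        replace (a * C0)%cx with C0 by ring. rewrite Cnorm2_C0; ring.
    + cbn [rsum]. cbn [rsum] in IH. rewrite <- IH. unfold sscal, dlt. destruct (Nat.eqb_spec (S n) s); [lia|].
      replace (a * C0)%cx with C0 by ring. rewrite Cnorm2_C0; ring.
Qed.

(** The perturbation sizes. The offset [n0] makes even the first one small enough, since every
    solution of the sequence has to leave the orbit by the same amount; the added 2 keeps them at
    most 1/2. *)
Lemma small_step (C D mu : R) : 0 <= C -> 0 < D -> 0 < mu -> exists n0, forall n,
  0 < / INR (n + n0 + 2) <= 1 / 2 /\ (C + C * mu) * / INR (n + n0 + 2) <= D * mu / 4.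
Proof.
  intros HC HD Hmu.
  assert (HDm : 0 < D * mu) by nra.
  destruct (INR_unbounded ((C + C * mu) * 4 / (D * mu))) as [n0 H].
  exists n0. intros n.
  assert (H2 : 2 <= INR (n + n0 + 2)).
  { rewrite plus_INR. cbn. pose proof (pos_INR (n + n0)). lra. }
  assert (H3 : INR n0 <= INR (n + n0 + 2)) by (apply le_INR; lia).
  split; [split|].
  - apply Rinv_0_lt_compat; lra.
  - apply Rmult_le_reg_r with (INR (n + n0 + 2)); [lra|]. rewrite Rinv_l; lra.
  - apply Rmult_le_reg_r with (INR (n + n0 + 2)); [lra|]. rewrite Rmult_assoc, Rinv_l by lra.
    assert ((C + C * mu) * 4 <= INR n0 * (D * mu)).
    { apply Rmult_le_reg_r with (/ (D * mu)); [now apply Rinv_0_lt_compat|].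
      rewrite (Rmult_assoc (INR n0)), Rinv_r by lra. unfold Rdiv in H. lra. }
    nra.
Qed.

(** [w] is the phase of [Theta] at the profile, arbitrary if [Theta] vanishes there. The positivity
    hypothesis says that the perturbation pushes [Theta] outward along [w], so that its modulus,
    constant on the orbit, grows. *)
Lemma instability_criterion s c k eta w :
  (s <= 1)%nat -> fin wH c ->
  Giter s c 3 = sscal (Cof k) (Giter s c 1) ->
  Cnorm eta = 1 -> Cnorm w = 1 ->
  Theta s c = (w * Cof (Cnorm (Theta s c)))%cx ->
  0 < Cre (w^* * (- Ci * Cof (1 - 2 * INR s) * drift s c eta))%cx ->
  orbitally_unstable c.
Proof.
  intros Hs Hc Heig Heta Hw HTh HD.
  set (om := (- Ci * Cof (1 - 2 * INR s))%cx) in *.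
  set (D := Cre (w^* * (om * drift s c eta))%cx) in *.
  destruct (perturbation_estimates s c k eta Hs Hc Heig Heta) as [C [HC hP]].
  assert (Hc' := Hc). destruct Hc' as [K HK].
  destruct (Theta_lipschitz s K) as [L [HL hL]].
  assert (Hom : Cnorm om = 1).
  { unfold om. rewrite Cnorm_mul, Cnorm_opp, Cnorm_Ci, Cnorm_Cof.
    destruct s as [|[|]]; [| |lia]; cbn.
    - replace (1 - 2 * 0) with 1 by ring. rewrite Rabs_R1; ring.
    - replace (1 - 2 * 1) with (-1) by ring. rewrite Rabs_left by lra. ring. }
  (* At time mu / eps the gain is [D * mu]. The acceleration takes at most [C * mu * mu], hence half
     of it by this choice, and the errors of order eps at most a quarter; the last quarter is
     [gam]. *)
  set (mu := D / (2 * (1 + C))). assert (Hmu : 0 < mu) by (apply Rdiv_lt_0_compat; lra).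
  destruct (small_step C D mu HC HD Hmu) as [n0 hn].
  set (gam := D * mu / 4). assert (Hgam : 0 < gam) by (unfold gam; nra).
  set (ep := fun n => / INR (n + n0 + 2)).
  set (u0 := fun n => sadd c (sscal (Cof (ep n) * eta)%cx (dlt s))).
  (* The Lipschitz bound holds within distance 1 only: either the distance to a rotated profile
     exceeds 1, or a gap [gam] in modulus forces it to be at least [gam / (1 + L)]. *)
  assert (He0 : 0 < Rmin 1 (gam / (1 + L))) by (apply Rmin_pos; [lra|apply Rdiv_lt_0_compat; lra]).
  exists (Rmin 1 (gam / (1 + L))); split; [exact He0|].
  exists u0. split; [|split].
  - intros n. apply H12_fin. unfold u0; sf.
  - exists (fun n => Cnorm (Cof (ep n) * eta)%cx * sqrt (1 + INR s)). split.
    + intros n. replace (seq_sub (u0 n) c) with (sscal (Cof (ep n) * eta)%cx (dlt s))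
        by (unfold u0; seq_ext j; unfold seq_sub, sadd, sscal; ring).
      apply hnorm_dlt_scal.
    + intros eps He.
      assert (Hsq : 0 < sqrt (1 + INR s)) by (apply sqrt_lt_R0; pose proof (pos_INR s); lra).
      destruct (INR_unbounded (sqrt (1 + INR s) / eps)) as [N HN].
      exists N. intros n Hn. unfold Rdist. rewrite Rminus_0_r, Cnorm_mul, Heta, Rmult_1_r, Cnorm_Cof.
      destruct (hn n) as [[h1 _] _]. fold (ep n) in h1.
      rewrite (Rabs_pos_eq (ep n)) by lra. rewrite Rabs_pos_eq by nra.
      assert (HI : INR N < INR (n + n0 + 2)) by (apply lt_INR; lia).
      assert (h3 : sqrt (1 + INR s) < eps * INR (n + n0 + 2)).
      { apply Rmult_lt_compat_l with (r := eps) in HN; [|lra].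
        replace (eps * (sqrt (1 + INR s) / eps)) with (sqrt (1 + INR s)) in HN by (field; lra). nra. }
      unfold ep. pose proof (pos_INR N).
      apply Rmult_lt_reg_l with (INR (n + n0 + 2)); [lra|].
      rewrite <- Rmult_assoc, Rinv_r by lra. lra.
  - intros n u Hu Hu0 eps Heps.
    assert (u 0 = u0 n) as E0 by (apply functional_extensionality; auto).
    destruct (hn n) as [hep hC2]. fold (ep n) in hep, hC2.
    destruct (hP (ep n) hep) as (p1 & p2 & p3 & p4).
    fold (u0 n) in p1, p2, p3, p4. rewrite <- E0 in p1, p2, p3, p4.
    set (e := ep n) in *. set (t := mu / e).
    assert (Ht : 0 < t) by (apply Rdiv_lt_0_compat; lra).
    assert (Hee : 0 <= C * (e * e)) by nra.
    pose proof (Theta_growth s u k Hs Hu w (C * (e * e)) Hee Hw p3 p4 t Ht) as HG.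
    assert (G : Cnorm (Theta s c) + gam <= Cnorm (Theta s (u t))).
    { eapply Rle_trans; [|exact HG].
      assert (a1 : Cnorm (Theta s c) - C * e <= Cre (w^* * Theta s (u 0))%cx).
      { replace (w^* * Theta s (u 0))%cx with (w^* * Theta s c + w^* * (Theta s (u 0) - Theta s c))%cx by ring.
        pose proof (Cre_le (w^* * (Theta s (u 0) - Theta s c))%cx) as q. rewrite Cnorm_mul, Cnorm_conj, Hw in q.
        apply Rcomplements.Rabs_le_between in q. 
        assert (Ew : (w^* * Theta s c = Cof (Cnorm (Theta s c)))%cx).
        { rewrite HTh at 1. transitivity (w * w^* * Cof (Cnorm (Theta s c)))%cx; [ring|].
          rewrite Cmul_Cconj, <- Cnorm_sqr, Hw. cx_ring. }
        rewrite Ew. change (Cre (Cof (Cnorm (Theta s c)) + w^* * (Theta s (u 0) - Theta s c))%cx)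
          with (Cnorm (Theta s c) + Cre (w^* * (Theta s (u 0) - Theta s c))%cx). lra. }
      assert (a2 : D * e - C * (e * e) <= Cre (w^* * (om * ip (resid s (u 0) k 1) (Giter s (u 0) 2)))%cx).
      { set (P := ip (resid s (u 0) k 1) (Giter s (u 0) 2)) in *.
        replace (w^* * (om * P))%cx with (w^* * (om * (Cof e * drift s c eta)) + w^* * (om * (P - Cof e * drift s c eta)))%cx by ring.
        pose proof (Cre_le (w^* * (om * (P - Cof e * drift s c eta)))%cx) as q.
        rewrite !Cnorm_mul, Cnorm_conj, Hw, Hom in q. apply Rcomplements.Rabs_le_between in q.
        replace (w^* * (om * (Cof e * drift s c eta)))%cx with (Cof e * (w^* * (om * drift s c eta)))%cx by ring.
        assert (Cre (Cof e * (w^* * (om * drift s c eta)) + w^* * (om * (P - Cof e * drift s c eta)))%cx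
          = e * D + Cre (w^* * (om * (P - Cof e * drift s c eta)))%cx) as ->.
        { unfold D. generalize (w^* * (om * drift s c eta))%cx, (w^* * (om * (P - Cof e * drift s c eta)))%cx. intros z1 z2. cx_unfold. ring. }
        lra. }
      fold om.
      assert (et : e * t = mu) by (unfold t; field; lra).
      apply Rle_trans with ((Cnorm (Theta s c) - C * e) + (D * e - C * (e * e)) * t - C * (e * e) * t * t).
      + replace ((D * e - C * (e * e)) * t) with (D * (e * t) - C * e * (e * t)) by ring.
        replace (C * (e * e) * t * t) with (C * ((e * t) * (e * t))) by ring. rewrite et.
        assert (mu * (2 * (1 + C)) = D) by (unfold mu; field; lra).
        assert (C * mu <= D / 2) by nra.
        assert (C * (mu * mu) <= D * mu / 2) by nra.
        unfold gam. nra.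
      + assert ((D * e - C * (e * e)) * t <= Cre (w^* * (om * ip (resid s (u 0) k 1) (Giter s (u 0) 2)))%cx * t)
          by (apply Rmult_le_compat_r; lra). lra. }
    exists t, (Rmin 1 (gam / (1 + L))). split; [exact Heps|].
    intros a b.
    assert (Fu : fin wH (u t)) by (apply (szego_contw u Hu)).
    assert (Fr : fin wH (rot a b c)) by (exists K; now apply bnd_rot).
    destruct (fin_is_hnorm (seq_sub (u t) (rot a b c))) as [r Hr]; [sf|].
    exists r; split; [exact Hr|].
    destruct (Rle_dec 1 r) as [h1|h1]; [eapply Rle_trans; [apply Rmin_l|exact h1]|].
    eapply Rle_trans; [apply Rmin_r|].
    assert (Hr0 : 0 <= r) by apply Hr.
    pose proof (hL (rot a b c) (u t) r (bnd_rot _ _ _ _ _ HK) (is_hnorm_bnd _ _ Hr) ltac:(lra)) as hT.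
    pose proof (Cnorm_rev_triang (Theta s (u t)) (Theta s (rot a b c))) as hT2.
    rewrite Theta_rot in hT2 by auto.
    apply Rmult_le_reg_r with (1 + L); [lra|]. unfold Rdiv. rewrite Rmult_assoc, Rinv_l by lra. nra.
Qed.

(** * Power series and the two criteria in closed form *)

Definition psum (c : nat -> Cx) (z l : Cx) : Prop :=
  Ccv (fun M => Csum M (fun k => (c k * Cpow z k)%cx)) l.

Lemma psum_sub c d z l m : psum c z l -> psum d z m -> psum (seq_sub c d) z (l - m)%cx.
Proof.
  intros H1 H2. eapply Ccv_ext; [|apply Ccv_sub; [exact H1|exact H2]].
  intros M; cbn beta. rewrite <- Csum_sub. apply Csum_ext; intros; unfold seq_sub; ring.
Qed.
Lemma psum_scal k c z l : psum c z l -> psum (sscal k c) z (k * l)%cx.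
Proof.
  intros H1. eapply Ccv_ext; [|apply Ccv_scal; exact H1].
  intros M; cbn beta. rewrite <- Csum_scal. apply Csum_ext; intros; unfold sscal; ring.
Qed.
Lemma Cpow_add z m n : Cpow z (m + n) = (Cpow z m * Cpow z n)%cx.
Proof. induction m; cbn [Cpow Nat.add]; [ring|]. rewrite IHm; ring. Qed.
Lemma psum_rsh m c z l : psum c z l -> psum (rsh m c) z (Cpow z m * l)%cx.
Proof.
  intros H. apply Ccv_shift with m. eapply Ccv_ext; [|apply Ccv_scal; exact H].
  intros M; cbn beta. rewrite Nat.add_comm, Csum_split, (Csum_zero m).
  - rewrite <- Csum_scal. match goal with |- _ = (C0 + ?b)%cx => replace (C0 + b)%cx with b by ring end.
    apply Csum_ext; intros k _. unfold rsh. rewrite (proj2 (Nat.leb_le m (m + k)%nat)) by lia.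
    replace (m + k - m)%nat with k by lia. rewrite Cpow_add. ring.
  - intros k Hk. unfold rsh. rewrite (proj2 (Nat.leb_gt m k) Hk). ring.
Qed.
Lemma psum_dlt0 z : psum (dlt 0) z C1.
Proof.
  apply Ccv_shift with 1%nat. eapply Ccv_ext; [|apply Ccv_const].
  intros M; cbn beta. rewrite Nat.add_1_r, Csum_head, Csum_zero; [unfold dlt; cbn [Nat.eqb Cpow]; ring|].
  intros; unfold dlt; cbn [Nat.eqb]; ring.
Qed.
Lemma rsh_dlt m : rsh m (dlt 0) = dlt m.
Proof.
  seq_ext n. unfold rsh, dlt. destruct (Nat.leb_spec m n), (Nat.eqb_spec (n - m) 0), (Nat.eqb_spec n m); try lia; easy.
Qed.
Lemma Cpow_Cof x k : Cpow (Cof x) k = Cof (x ^ k).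
Proof. induction k; [easy|]. cbn [Cpow pow]. rewrite IHk. cx_ring. Qed.
Lemma Cnorm_Cpow z k : Cnorm (Cpow z k) = Cnorm z ^ k.
Proof. induction k; cbn [Cpow pow]; [apply Cnorm_C1|]. now rewrite Cnorm_mul, IHk. Qed.

Lemma real_pseries_zero (a : nat -> R) :
  (forall x, Rabs x < 1 -> Un_cv (fun M => rsum M (fun k => a k * x ^ k)) 0) -> forall n, a n = 0.
Proof.
  intros H n.
  assert (HS : forall x, Rabs x < 1 -> infinite_sum (fun k => a k * x ^ k) 0).
  { intros x Hx eps He. destruct (H x Hx eps He) as [N h]. exists N. intros m Hm.
    rewrite <- rsum_sum_f_R0. apply h; lia. }
  assert (HP : forall x, Rabs x < 1 -> PSeries a x = 0).
  { intros x Hx. unfold PSeries. apply is_series_unique, is_series_Reals. auto. }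
  (* Convergence at one nonzero point bounds the terms there, which makes the radius of convergence
     positive. *)
  assert (Hb : exists B, forall k, Rabs (a k * (1 / 2) ^ k) <= B).
  { assert (H2 : Rabs (1 / 2) < 1) by (rewrite Rabs_pos_eq; lra).
    assert (Hc : Cauchy_crit (fun M => rsum M (fun k => a k * (1 / 2) ^ k))).
    { apply CV_Cauchy. exists 0. auto. }
    destruct (cauchy_maj _ Hc) as [U HU]. destruct (cauchy_min _ Hc) as [V HV].
    exists (Rabs U + Rabs V). intros k.
    assert (E : a k * (1 / 2) ^ k = rsum (S k) (fun k => a k * (1 / 2) ^ k) - rsum k (fun k => a k * (1 / 2) ^ k))
      by (cbn [rsum]; ring).
    assert (u1 := HU (rsum (S k) (fun k => a k * (1 / 2) ^ k)) ltac:(now exists (S k))).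
    assert (u2 := HU (rsum k (fun k => a k * (1 / 2) ^ k)) ltac:(now exists k)).
    assert (v1 := HV (opp_seq (fun M => rsum M (fun k => a k * (1 / 2) ^ k)) (S k)) ltac:(now exists (S k))).
    assert (v2 := HV (opp_seq (fun M => rsum M (fun k => a k * (1 / 2) ^ k)) k) ltac:(now exists k)).
    unfold opp_seq in v1, v2. rewrite E. pose proof (Rle_abs U); pose proof (Rle_abs V).
    apply Rabs_le. lra. }
  assert (Hr : Rbar_lt 0 (CV_radius a)).
  { destruct (CV_radius_bounded a) as [hub _]. specialize (hub (1 / 2) Hb).
    eapply Rbar_lt_le_trans; [|exact hub]. cbn. lra. }
  rewrite (PSeries_ext_recip a (fun _ => 0) n); auto.
  - rewrite CV_radius_const_0. easy.
  - exists (mkposreal 1 Rlt_0_1). intros x Hx. rewrite PSeries_const_0. apply HP.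
    assert (Hx' : Rabs (x - 0) < 1) by exact Hx. rewrite Rminus_0_r in Hx'. exact Hx'.
Qed.
(** Values at real points suffice: there the real and imaginary parts are two real power series. *)
Lemma psum_coef_unique c d : (forall z, Cnorm z < 1 -> exists l, psum c z l /\ psum d z l) -> c = d.
Proof.
  intros H.
  assert (H0 : forall x, Rabs x < 1 -> psum (seq_sub c d) (Cof x) C0).
  { intros x Hx. destruct (H (Cof x)) as [l [h1 h2]]; [now rewrite Cnorm_Cof|].
    replace C0 with (l - l)%cx by ring. now apply psum_sub. }
  seq_ext n. apply injective_projections.
  - cut (Cre (seq_sub c d n) = 0); [unfold seq_sub; cx_unfold; lra|].
    apply (real_pseries_zero (fun n => Cre (seq_sub c d n))). intros x Hx.
    destruct (H0 x Hx) as [h _]. intros eps He. destruct (h eps He) as [N hN]. exists N. intros m Hm.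
    specialize (hN m Hm). rewrite Csum_re in hN.
    erewrite rsum_ext; [exact hN|]. intros k _. cbn beta. rewrite Cpow_Cof. cx_unfold; ring.
  - cut (Cim (seq_sub c d n) = 0); [unfold seq_sub; cx_unfold; lra|].
    apply (real_pseries_zero (fun n => Cim (seq_sub c d n))). intros x Hx.
    destruct (H0 x Hx) as [_ h]. intros eps He. destruct (h eps He) as [N hN]. exists N. intros m Hm.
    specialize (hN m Hm). rewrite Csum_im in hN.
    erewrite rsum_ext; [exact hN|]. intros k _. cbn beta. rewrite Cpow_Cof. cx_unfold; ring.
Qed.

Lemma Cmul_Cinv z : z <> C0 -> (z * Cinv z = C1)%cx.
Proof.
  intros H. assert (Hn : Cnorm2 z <> 0).
  { intros E. apply H, Cnorm_eq0. unfold Cnorm. rewrite E. apply sqrt_0. }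
  apply injective_projections; unfold Cinv; cx_unfold; field; auto.
Qed.
Lemma one_sub_neq0 z : Cnorm z < 1 -> (C1 - z)%cx <> C0.
Proof.
  intros H E. pose proof (Cnorm_rev_triang C1 z) as h. rewrite E, Cnorm_C0, Cnorm_C1 in h. lra.
Qed.

(** Both kinds of profile are rational with poles off the closed disc. Geometric decay captures this
    and yields membership in H^{1/2} as well as convergence on the disc. *)
Definition geo (x : nat -> Cx) : Prop := exists C r, 0 <= C /\ 0 <= r < 1 /\ forall n, Cnorm (x n) <= C * r ^ n.

Lemma rsum_arith_geo M r : 0 <= r < 1 -> rsum M (fun n => (1 + INR n) * r ^ n) <= / ((1 - r) * (1 - r)).
Proof.
  intros Hr.
  assert (E : (1 - r) * (1 - r) * rsum M (fun n => (1 + INR n) * r ^ n) = 1 - r ^ M * (1 + INR M * (1 - r))).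
  { induction M; [cbn; ring|]. cbn [rsum]. rewrite Rmult_plus_distr_l, IHM, S_INR. cbn [pow]. ring. }
  apply Rmult_le_reg_l with ((1 - r) * (1 - r)); [nra|]. rewrite E, Rinv_r by nra.
  pose proof (pow_le r M ltac:(lra)). pose proof (pos_INR M).
  assert (0 <= INR M * (1 - r)) by nra. nra.
Qed.
Lemma geo_fin x : geo x -> fin wH x.
Proof.
  intros (C & r & HC & Hr & H). assert (Hr2 : 0 <= r * r < 1) by nra.
  exists (C * C * / ((1 - r * r) * (1 - r * r))). intros M.
  apply Rle_trans with (rsum M (fun n => C * C * ((1 + INR n) * (r * r) ^ n))).
  - apply rsum_le; intros n _. unfold wH. rewrite <- Cnorm_sqr, Rpow_mult_distr.
    specialize (H n). pose proof (Cnorm_ge0 (x n)). pose proof (pos_INR n).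
    replace (C * C * ((1 + INR n) * (r ^ n * r ^ n))) with ((1 + INR n) * ((C * r ^ n) * (C * r ^ n))) by ring.
    apply Rmult_le_compat_l; [lra|]. apply Rmult_le_compat; auto.
  - rewrite rsum_scal. apply Rmult_le_compat_l; [nra|]. now apply rsum_arith_geo.
Qed.
Lemma rsum_geo_le M q : 0 <= q < 1 -> rsum M (fun n => q ^ n) <= / (1 - q).
Proof.
  intros Hq.
  assert (E : (1 - q) * rsum M (fun n => q ^ n) = 1 - q ^ M).
  { induction M; [cbn; ring|]. cbn [rsum]. rewrite Rmult_plus_distr_l, IHM. cbn [pow]. ring. }
  apply Rmult_le_reg_l with (1 - q); [lra|]. rewrite E, Rinv_r by lra. pose proof (pow_le q M ltac:(lra)). lra.
Qed.
Lemma geo_psum x z : geo x -> Cnorm z < 1 -> exists l, psum x z l.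
Proof.
  intros (C & r & HC & Hr & H) Hz. eexists.
  apply (Ccv_abs _ (C * / (1 - r))). intros M.
  apply Rle_trans with (rsum M (fun n => C * r ^ n)).
  - apply rsum_le; intros n _. rewrite Cnorm_mul, Cnorm_Cpow.
    pose proof (Cnorm_ge0 z). pose proof (Cnorm_ge0 (x n)).
    assert (Cnorm z ^ n <= 1) by (rewrite <- (pow1 n); apply pow_incr; lra).
    pose proof (pow_le (Cnorm z) n ltac:(lra)). specialize (H n). nra.
  - rewrite rsum_scal. apply Rmult_le_compat_l; auto. now apply rsum_geo_le.
Qed.
Lemma geo_scal k x : geo x -> geo (sscal k x).
Proof.
  intros (C & r & HC & Hr & H). exists (Cnorm k * C), r. pose proof (Cnorm_ge0 k).
  split; [nra|split; auto]. intros n. unfold sscal. rewrite Cnorm_mul, Rmult_assoc.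
  apply Rmult_le_compat_l; auto.
Qed.
Lemma geo_dlt0 : geo (dlt 0).
Proof.
  exists 1, 0. split; [lra|split; [lra|]]. intros [|n]; unfold dlt; cbn [Nat.eqb].
  - rewrite Cnorm_C1; cbn; lra.
  - rewrite Cnorm_C0; cbn. lra.
Qed.

(** * Two special cases of the criterion: vanishing [Theta], and symbols of constant modulus *)

Lemma Giter1_0 c : Giter 0 c 1 = c.
Proof.
  seq_ext n. cbn [Giter]. unfold Gop, hank. rewrite ip_dlt_r, shift_0. unfold shift. easy.
Qed.
Lemma Cunit_spec z : z <> C0 -> let w := (z * Cof (/ Cnorm z))%cx in
  Cnorm w = 1 /\ z = (w * Cof (Cnorm z))%cx.
Proof.
  intros H. pose proof (Cnorm_pos z H) as Hp. cbn zeta. split.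
  - rewrite Cnorm_mul, Cnorm_Cof, Rabs_pos_eq by (left; now apply Rinv_0_lt_compat). field; lra.
  - apply injective_projections; cx_unfold; field; lra.
Qed.

(** Away from 0 every direction is outward, so the phase of the velocity itself can serve as [w]. *)
Lemma unstable_of_Theta_zero s c k : (s <= 1)%nat -> fin wH c ->
  Giter s c 3 = sscal (Cof k) (Giter s c 1) -> Theta s c = C0 -> drift s c C1 <> C0 -> orbitally_unstable c.
Proof.
  intros Hs Hc Heig HT Hd.
  set (z := (- Ci * Cof (1 - 2 * INR s) * drift s c C1)%cx).
  assert (Hz : Cnorm z = Cnorm (drift s c C1)).
  { unfold z. rewrite !Cnorm_mul, Cnorm_opp, Cnorm_Ci, Cnorm_Cof.
    destruct s as [|[|]]; [| |lia]; cbn.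
    - replace (1 - 2 * 0) with 1 by ring. rewrite Rabs_R1; ring.
    - replace (1 - 2 * 1) with (-1) by ring. rewrite Rabs_left by lra. ring. }
  pose proof (Cnorm_pos _ Hd) as Hp.
  assert (Hz0 : z <> C0) by (intros E; rewrite E, Cnorm_C0 in Hz; lra).
  destruct (Cunit_spec z Hz0) as [Hw1 Hw2]. set (w := (z * Cof (/ Cnorm z))%cx) in *.
  apply (instability_criterion s c k C1 w); auto.
  - apply Cnorm_C1.
  - rewrite HT, Cnorm_C0. change (Cof 0) with C0. ring.
  - fold z. rewrite Hw2. replace (w^* * (w * Cof (Cnorm z)))%cx with (w * w^* * Cof (Cnorm z))%cx by ring.
    rewrite Cmul_Cconj, <- Cnorm_sqr, Hw1.
    replace (Cre (Cof (1 * 1) * Cof (Cnorm z))%cx) with (Cnorm z) by (cx_unfold; ring). lra.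
Qed.

(** The hypothesis on [hank c c] says that |c|^2 = A on the circle, i.e. that c is sqrt A times an
    inner function; the strict inequality excludes constants. *)
Lemma unstable_of_inner c A : fin wH c -> hank c c = sscal (Cof A) (dlt 0) -> Cnorm2 (c 0%nat) < A ->
  orbitally_unstable c.
Proof.
  intros Hc Hin HA.
  pose proof (Cnorm2_ge0 (c 0%nat)) as Hc0.
  assert (G2 : Giter 0 c 2 = sscal (Cof A) (dlt 0)).
  { change (Giter 0 c 2) with (Gop 0 c (Giter 0 c 1)). rewrite Giter1_0. unfold Gop. now rewrite shift_0. }
  assert (G3 : Giter 0 c 3 = sscal (Cof A) c).
  { change (Giter 0 c 3) with (Gop 0 c (Giter 0 c 2)). rewrite G2, Gop_scal, Cconj_Cof by sf.
    change (Gop 0 c (dlt 0)) with (Giter 0 c 1). now rewrite Giter1_0. }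
  assert (exists b, Cnorm b = 1 /\ c 0%nat = (b * Cof (Cnorm (c 0%nat)))%cx) as [b [Hb1 Hb2]].
  { destruct (Req_dec (Cnorm (c 0%nat)) 0) as [E|E].
    - exists C1. split; [apply Cnorm_C1|]. rewrite E. rewrite (Cnorm_eq0 _ E). cx_ring.
    - assert (c 0%nat <> C0) as n0 by (intros e; rewrite e, Cnorm_C0 in E; auto).
      eexists; apply (Cunit_spec (c 0%nat) n0). }
  assert (HT : Theta 0 c = (Cof A * c 0%nat)%cx).
  { unfold Theta. rewrite G2, Giter1_0, ip_scal_r, ip_dlt_r, Cconj_Cof by sf. easy. }
  assert (Hbb : (b * b^* = C1)%cx) by (rewrite Cmul_Cconj, <- Cnorm_sqr, Hb1; cx_ring).
  (* Since the velocity is -i times the drift and [Theta] has the phase [b] of [c 0], the factor i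
     in [eta] makes the velocity radial, equal to A (A - |c 0|^2) along [b]. *)
  apply (instability_criterion 0 c A (Ci * b)%cx b); auto.
  - now rewrite G3, Giter1_0.
  - rewrite Cnorm_mul, Cnorm_Ci, Hb1; ring.
  - rewrite HT, Cnorm_mul, Cnorm_Cof, Rabs_pos_eq by lra. rewrite Hb2 at 1. cx_ring.
  - unfold drift. rewrite G2, G3, Giter1_0. change (Gop 0 c (dlt 0)) with (Giter 0 c 1). rewrite Giter1_0.
    assert (Ec : ip c c = Cof A).
    { transitivity (hank c c 0%nat); [unfold hank; now rewrite shift_0|]. rewrite Hin. unfold sscal, dlt; cbn [Nat.eqb]. ring. }
    rewrite Ec. unfold sscal, dlt; cbn [Nat.eqb INR].
    rewrite !Cconj_mul, Cconj_C1, Cconj_Cof.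
    set (n := Cnorm (c 0%nat)) in *.
    replace (b^* * (- Ci * Cof (1 - 2 * 0) * (Ci * b * (Cof A * C1) * Cof A + Ci^* * b^* * (Cof A * c 0%nat * c 0%nat))))%cx
      with (Cof A * (Cof A - Cof (n * n)))%cx.
    + unfold n. rewrite Cnorm_sqr. replace (Cre (Cof A * (Cof A - Cof (Cnorm2 (c 0%nat))))%cx)
        with (A * (A - Cnorm2 (c 0%nat))) by (cx_unfold; ring). nra.
    + rewrite Hb2. replace (Ci^*)%cx with (- Ci)%cx by cx_ring.
      replace (Cof (1 - 2 * 0)) with C1 by cx_ring.
      assert (Eii : (Ci * Ci = - C1)%cx) by cx_ring.
      transitivity (- (Ci * Ci) * Cof A * ((b * b^*) * Cof A - (b * b^*) * (b * b^*) * (Cof n * Cof n)))%cx; [|ring].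
      rewrite Eii, Hbb. replace (Cof (n * n)) with (Cof n * Cof n)%cx by cx_ring. ring.
Qed.

(** * Blaschke products and periodic profiles *)

(* Coefficients of [f(z) (z - conj p) / (1 - p z)] in terms of those of [f]. *)
Fixpoint bl (p : Cx) (f : nat -> Cx) (n : nat) : Cx :=
  match n with
  | O => (- (p^* * f 0%nat))%cx
  | S m => (p * bl p f m + f m - p^* * f (S m))%cx
  end.
Fixpoint Bseq (p : nat -> Cx) (m : nat) : nat -> Cx :=
  match m with O => dlt 0 | S m => bl (p m) (Bseq p m) end.

Lemma bl_eq p f : seq_sub (bl p f) (sscal p (rsh 1 (bl p f))) = seq_sub (rsh 1 f) (sscal (p^*)%cx f).
Proof.
  seq_ext n. unfold seq_sub, sscal, rsh. destruct n; cbn [Nat.leb bl].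
  - ring.
  - replace (S n - 1)%nat with n by lia. ring.
Qed.
Lemma geo_bl p f : Cnorm p < 1 -> geo f -> geo (bl p f).
Proof.
  intros Hp (C & r & HC & Hr & H). pose proof (Cnorm_ge0 p) as Hp0.
  (* A ratio strictly above |p|, so that the recursion of [bl] has no resonance with the decay of
     [f]. *)
  set (r' := (1 + Rmax r (Cnorm p)) / 2).
  pose proof (Rmax_l r (Cnorm p)). pose proof (Rmax_r r (Cnorm p)).
  assert (Rmax r (Cnorm p) < 1) by (apply Rmax_lub_lt; lra).
  assert (Hr1 : r <= r' < 1) by (unfold r'; lra). assert (Hr2 : Cnorm p < r') by (unfold r'; lra).
  assert (Hf : forall n, Cnorm (f n) <= C * r' ^ n).
  { intros n. eapply Rle_trans; [apply H|]. apply Rmult_le_compat_l; auto. apply pow_incr; lra. }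
  (* Chosen to close the induction, which needs [2 * C + Cnorm p * D <= D * r']. *)
  set (D := C + 2 * C / (r' - Cnorm p)).
  assert (HD : 2 * C + Cnorm p * D <= D * r').
  { assert (2 * C / (r' - Cnorm p) * (r' - Cnorm p) = 2 * C) by (field; lra). unfold D. nra. }
  assert (HD0 : C <= D).
  { unfold D. assert (0 <= 2 * C / (r' - Cnorm p)); [|lra].
    apply Rmult_le_pos; [lra|]. left; apply Rinv_0_lt_compat; lra. }
  exists D, r'. split; [lra|split; [lra|]].
  induction n as [|n IH]; cbn [bl].
  - rewrite Cnorm_opp, Cnorm_mul, Cnorm_conj. specialize (Hf 0%nat). cbn [pow] in *.
    pose proof (Cnorm_ge0 (f 0%nat)). nra.
  - eapply Rle_trans; [apply Cnorm_sub_le|]. eapply Rle_trans; [apply Rplus_le_compat_r, Cnorm_triang|].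
    rewrite !Cnorm_mul, Cnorm_conj. pose proof (Hf n) as h1. pose proof (Hf (S n)) as h2. cbn [pow] in *.
    pose proof (pow_le r' n ltac:(lra)) as Hpow. pose proof (Cnorm_ge0 (f (S n))).
    assert (Cnorm p * Cnorm (bl p f n) <= Cnorm p * (D * r' ^ n)) by (apply Rmult_le_compat_l; lra).
    assert (C * (r' * r' ^ n) <= C * r' ^ n) by (apply Rmult_le_compat_l; nra).
    assert (Cnorm p * Cnorm (f (S n)) <= Cnorm (f (S n))) by nra.
    assert ((2 * C + Cnorm p * D) * r' ^ n <= D * r' * r' ^ n) by (apply Rmult_le_compat_r; lra).
    lra.
Qed.

Lemma shift_S_rsh n x : shift (S n) (rsh 1 x) = shift n x.
Proof. seq_ext k. unfold shift, rsh. rewrite Nat.add_succ_r. cbn [Nat.leb]. f_equal; lia. Qed.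
Lemma shift_seq_sub n x y : shift n (seq_sub x y) = seq_sub (shift n x) (shift n y).
Proof. easy. Qed.
Lemma shift_sscal n k x : shift n (sscal k x) = sscal k (shift n x).
Proof. easy. Qed.

Section Autocorrelation.
Variables (p : Cx) (x : nat -> Cx).
Hypothesis Hx : fin w1 x.

(** On the circle |1 - p z| = |z - conj p|, so multiplication by either factor acts on
    autocorrelations through the same three-term formula, as this lemma and the three after it show.
    Index 0 is separate because its lower neighbour is a conjugate. *)
Lemma autocorr_den_S n :
  let h := seq_sub x (sscal p (rsh 1 x)) in
  (ip (shift (S n) h) h = (C1 + p * p^*) * hank x x (S n) - p^* * hank x x (S (S n)) - p * hank x x n)%cx.
Proof.
  cbn zeta. rewrite shift_seq_sub, shift_sscal, shift_S_rsh, ip_sub_l, !ip_sub_r, !ip_scal_l, !ip_scal_r by sf.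
  rewrite !ip_rsh_r, !shift_shift by sf. unfold hank. cbn [Nat.add]. ring.
Qed.
Lemma autocorr_den_0 :
  let h := seq_sub x (sscal p (rsh 1 x)) in
  (ip h h = (C1 + p * p^*) * hank x x 0 - p^* * hank x x 1 - p * (hank x x 1)^*)%cx.
Proof.
  cbn zeta. rewrite ip_sub_l, !ip_sub_r, !ip_scal_l, !ip_scal_r by sf.
  rewrite !ip_rsh_r, shift_S_rsh, ip_rsh_l, shift_0 by sf. unfold hank.
  rewrite ip_conj, shift_0 by sf. ring.
Qed.
Lemma autocorr_num_S n :
  let h := seq_sub (rsh 1 x) (sscal (p^*)%cx x) in
  (ip (shift (S n) h) h = (C1 + p * p^*) * hank x x (S n) - p^* * hank x x (S (S n)) - p * hank x x n)%cx.
Proof.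
  cbn zeta. rewrite shift_seq_sub, shift_sscal, shift_S_rsh, ip_sub_l, !ip_sub_r, !ip_scal_l, !ip_scal_r by sf.
  rewrite !ip_rsh_r, !shift_shift, Cconj_conj by sf. unfold hank. cbn [Nat.add]. ring.
Qed.
Lemma autocorr_num_0 :
  let h := seq_sub (rsh 1 x) (sscal (p^*)%cx x) in
  (ip h h = (C1 + p * p^*) * hank x x 0 - p^* * hank x x 1 - p * (hank x x 1)^*)%cx.
Proof.
  cbn zeta. rewrite ip_sub_l, !ip_sub_r, !ip_scal_l, !ip_scal_r by sf.
  rewrite !ip_rsh_r, shift_S_rsh, ip_rsh_l, shift_0, Cconj_conj by sf. unfold hank.
  rewrite ip_conj, shift_0 by sf. ring.
Qed.
End Autocorrelation.

Lemma ip_self_real x : fin w1 x -> ip x x = Cof (Cre (ip x x)).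
Proof.
  intros H. pose proof (ip_conj x x H H) as E. apply injective_projections; [easy|].
  assert (Cim (ip x x) = - Cim (ip x x)) as h by (rewrite <- E at 1; easy). change (Cim (ip x x) = 0). lra.
Qed.
Lemma zero_of_geometric_bound e q B : 0 <= q < 1 -> 0 <= e -> (forall m, e <= q ^ m * B) -> e = 0.
Proof.
  intros Hq He H. destruct (Req_dec e 0) as [|Hne]; auto. exfalso.
  assert (HB : 0 < B) by (specialize (H 0%nat); cbn in H; lra).
  destruct (pow_lt_1_zero q ltac:(rewrite Rabs_pos_eq; lra) (e / B)) as [m h]; [apply Rdiv_lt_0_compat; lra|].
  specialize (h m ltac:(lia)). specialize (H m). pose proof (Rle_abs (q ^ m)).
  assert (q ^ m * B < e / B * B) by (apply Rmult_lt_compat_r; lra).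
  replace (e / B * B) with e in * by (field; lra). lra.
Qed.

(* The difference [D] of the two autocorrelations satisfies
   [D (n+1) - p D n = conj p (D (n+2) - p D (n+1))] and is bounded, hence vanishes. *)
Lemma autocorr_bl p f : Cnorm p < 1 -> geo f -> hank (bl p f) (bl p f) = hank f f.
Proof.
  intros Hp Hf. pose proof (geo_bl p f Hp Hf) as Hg. set (g := bl p f) in *.
  apply geo_fin, fin_HY, fin_Y1 in Hf, Hg.
  set (D := fun n => (hank g g n - hank f f n)%cx).
  assert (HS : forall n, ((C1 + p * p^*) * D (S n) = p^* * D (S (S n)) + p * D n)%cx).
  { intros n. pose proof (autocorr_den_S p g Hg n) as e1. pose proof (autocorr_num_S p f Hf n) as e2.
    cbn zeta in e1, e2. unfold g in e1 at 1 2 3 4. rewrite bl_eq in e1. fold g in e1. rewrite e2 in e1.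
    unfold D. 
    match type of e1 with ?a = ?b => assert (e3 : (b - a = C0)%cx) by (rewrite e1; ring) end.
    match goal with |- ?a = ?b => cut ((a - b = C0)%cx); [intros e4; transitivity (a - b + b)%cx; [ring|rewrite e4; ring]|] end.
    rewrite <- e3. ring. }
  assert (H0 : ((C1 + p * p^*) * D 0%nat = p^* * D 1%nat + p * (D 1%nat)^*)%cx).
  { pose proof (autocorr_den_0 p g Hg) as e1. pose proof (autocorr_num_0 p f Hf) as e2.
    cbn zeta in e1, e2. unfold g in e1 at 1 2 3 4. rewrite bl_eq in e1. fold g in e1. rewrite e2 in e1.
    unfold D. rewrite Cconj_sub.
    match type of e1 with ?a = ?b => assert (e3 : (b - a = C0)%cx) by (rewrite e1; ring) end.
    match goal with |- ?a = ?b => cut ((a - b = C0)%cx); [intros e4; transitivity (a - b + b)%cx; [ring|rewrite e4; ring]|] end.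
    rewrite <- e3. ring. }
  set (E := fun n => (D (S n) - p * D n)%cx).
  assert (HE : forall n, (E n = p^* * E (S n))%cx).
  { intros n. unfold E. specialize (HS n).
    transitivity ((C1 + p * p^*) * D (S n) - p * D n - p^* * p * D (S n))%cx; [ring|]. rewrite HS. ring. }
  assert (HDb : exists B, forall n, Cnorm (D n) <= B).
  { destruct Hf as [A HA]. destruct Hg as [B HB]. exists (sqrt B * sqrt B + sqrt A * sqrt A). intros n.
    unfold D. eapply Rle_trans; [apply Cnorm_sub_le|].
    apply Rplus_le_compat; apply ip_bound; auto; apply bnd_shift; sf. }
  destruct HDb as [B HB].
  pose proof (Cnorm_ge0 p) as Hp0.
  (* Iterating [HE] gives |E n| = |p|^m |E (n + m)|, while [E] is bounded. *)
  assert (HE0 : forall n, E n = C0).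
  { intros n. apply Cnorm_eq0. apply zero_of_geometric_bound with (Cnorm p) (2 * B); [lra|apply Cnorm_ge0|].
    intros m. revert n. induction m as [|m IH]; intros n.
    - cbn [pow]. unfold E. eapply Rle_trans; [apply Cnorm_sub_le|]. rewrite Cnorm_mul.
      pose proof (HB n); pose proof (HB (S n)). pose proof (Cnorm_ge0 (D n)). nra.
    - rewrite HE, Cnorm_mul, Cnorm_conj. cbn [pow]. rewrite Rmult_assoc. apply Rmult_le_compat_l; auto. }
  assert (HD1 : forall n, D (S n) = (p * D n)%cx).
  { intros n. transitivity (E n + p * D n)%cx; [unfold E; ring|]. rewrite HE0; ring. }
  (* For real [D 0] and [D 1 = p * D 0], the relation [H0] becomes (1 + |p|^2) D 0 = 2 |p|^2 D 0,
     which forces [D 0] to vanish as |p| < 1. *)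
  assert (Hre : D 0%nat = Cof (Cre (D 0%nat))).
  { unfold D, hank. rewrite !shift_0, (ip_self_real g), (ip_self_real f) by auto. cx_ring. }
  assert (D0 : D 0%nat = C0).
  { rewrite (HD1 0%nat), Cconj_mul in H0. rewrite Hre in H0 |- *. rewrite Cconj_Cof in H0.
    set (d := Cre (D 0%nat)) in *. rewrite Cmul_Cconj in H0.
    replace (p^* * (p * Cof d) + p * (p^* * Cof d))%cx with (p * p^* * Cof d + p * p^* * Cof d)%cx in H0 by ring.
    rewrite Cmul_Cconj in H0.
    assert (Hn : Cnorm2 p < 1) by (rewrite <- Cnorm_sqr; nra).
    apply (f_equal Cre) in H0. clearbody d. generalize dependent (Cnorm2 p). intros m H0 Hn. cx_unfold.
    assert (d = 0) as -> by nra. easy. }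
  assert (HDn : forall n, D n = C0).
  { induction n; auto. rewrite HD1, IHn. ring. }
  seq_ext n. transitivity (D n + hank f f n)%cx; [unfold D; ring|]. rewrite HDn. ring.
Qed.

(** The bound [<= 1] carries the induction, since the strict one fails for the empty product.
    Strictness for [1 <= m] records that a nontrivial Blaschke product is not constant. *)
Lemma Bseq_props p m : (forall j, (j < m)%nat -> Cnorm (p j) < 1) ->
  geo (Bseq p m) /\ hank (Bseq p m) (Bseq p m) = dlt 0 /\
  (forall z, Cnorm z < 1 ->
    psum (Bseq p m) z (Cprod m (fun j => Cdiv (z - (p j)^*)%cx (C1 - p j * z)%cx))) /\
  Cnorm (Bseq p m 0) <= 1 /\ ((1 <= m)%nat -> Cnorm (Bseq p m 0) < 1).
Proof.
  induction m as [|m IH]; intros H; cbn [Bseq].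
  - split; [apply geo_dlt0|]. split; [|split; [|split]].
    + rewrite hank_dlt0. seq_ext n. unfold sscal. replace (dlt 0 0%nat) with C1 by easy. rewrite Cconj_C1. ring.
    + intros z _. apply psum_dlt0.
    + replace (dlt 0 0%nat) with C1 by easy. rewrite Cnorm_C1; lra.
    + lia.
  - destruct (IH ltac:(intros; apply H; lia)) as (g & a & t & n0 & _).
    assert (Hp : Cnorm (p m) < 1) by (apply H; lia).
    split; [now apply geo_bl|]. split; [|split].
    + now rewrite autocorr_bl.
    + intros z Hz. destruct (geo_psum _ z (geo_bl _ _ Hp g) Hz) as [G HG].
      cbn [Cprod]. set (F := Cprod m _) in *. specialize (t z Hz). fold F in t.
      assert (e1 := psum_sub _ _ _ _ _ HG (psum_scal (p m) _ _ _ (psum_rsh 1 _ _ _ HG))).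
      assert (e2 := psum_sub _ _ _ _ _ (psum_rsh 1 _ _ _ t) (psum_scal ((p m)^*)%cx _ _ _ t)).
      rewrite bl_eq in e1. pose proof (Ccv_unique _ _ _ e1 e2) as E. cbn [Cpow] in E.
      assert (Hn : (C1 - p m * z)%cx <> C0).
      { apply one_sub_neq0. rewrite Cnorm_mul. pose proof (Cnorm_ge0 (p m)); pose proof (Cnorm_ge0 z). nra. }
      replace (F * Cdiv (z - (p m)^*) (C1 - p m * z))%cx with G; auto.
      unfold Cdiv. pose proof (Cmul_Cinv _ Hn) as Ei. set (I := Cinv _) in *.
      transitivity (G * ((C1 - p m * z) * I))%cx; [rewrite Ei; ring|].
      transitivity ((G - p m * (z * C1 * G)) * I)%cx; [ring|]. rewrite E. ring.
    + cbn [bl]. rewrite Cnorm_opp, Cnorm_mul, Cnorm_conj.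
      pose proof (Cnorm_ge0 (p m)); pose proof (Cnorm_ge0 (Bseq p m 0)). split; [nra|intros _; nra].
Qed.

Lemma blaschke_unstable alpha N p c : alpha <> C0 -> (1 <= N)%nat ->
  (forall j, (j < N)%nat -> Cnorm (p j) < 1) -> is_taylor c (blaschke_phi alpha N p) -> orbitally_unstable c.
Proof.
  intros Ha HN Hp Hc. destruct (Bseq_props p N Hp) as (g & a & t & _ & n0). specialize (n0 HN).
  assert (c = sscal alpha (Bseq p N)) as ->.
  { apply psum_coef_unique. intros z Hz. exists (blaschke_phi alpha N p z). split; [now apply Hc|].
    apply psum_scal, t; auto. }
  assert (F : fin w1 (Bseq p N)) by (apply fin_Y1, fin_HY, geo_fin, g).
  apply unstable_of_inner with (Cnorm2 alpha).
  - now apply geo_fin, geo_scal.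
  - rewrite hank_scal_l, hank_scal_r, a by sf. seq_ext n. unfold sscal. rewrite <- Cmul_Cconj. ring.
  - unfold sscal. rewrite Cnorm2_mul. rewrite <- (Cnorm_sqr (Bseq p N 0)), <- (Cnorm_sqr alpha).
    pose proof (Cnorm_pos _ Ha). pose proof (Cnorm_ge0 (Bseq p N 0)).
    assert (Cnorm (Bseq p N 0) * Cnorm (Bseq p N 0) < 1) by nra.
    rewrite <- (Rmult_1_r (Cnorm alpha * Cnorm alpha)) at 2. apply Rmult_lt_compat_l; nra.
Qed.

(** For b < N, the coefficients of z^b / (1 - q z^N). *)
Definition Eseq (N : nat) (q : Cx) (b n : nat) : Cx :=
  if Nat.eqb (n mod N) b then Cpow q (n / N) else C0.

Lemma Eseq_block N q b t : (b < N)%nat -> Eseq N q b (N * t + b) = Cpow q t.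
Proof.
  intros Hb. unfold Eseq.
  rewrite <- (Nat.mod_unique (N * t + b) N t b), <- (Nat.div_unique (N * t + b) N t b) by lia.
  now rewrite Nat.eqb_refl.
Qed.
Lemma Eseq_off N q b d t : (d < N)%nat -> d <> b -> Eseq N q b (N * t + d) = C0.
Proof.
  intros Hd Hne. unfold Eseq. rewrite <- (Nat.mod_unique (N * t + d) N t d) by lia.
  now rewrite (proj2 (Nat.eqb_neq d b) Hne).
Qed.
Lemma block_decomp N n : (0 < N)%nat -> exists t d, (d < N)%nat /\ n = (N * t + d)%nat.
Proof.
  intros H. exists (n / N)%nat, (n mod N). split; [apply Nat.mod_upper_bound; lia|apply Nat.div_mod; lia].
Qed.
(** Supports meet only if [n] lies in the class of d = a - b - s modulo N; there the exponents of
    [q] add up, with the carry [r], and the variables [n] and [j] separate. Hence G maps each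
    sequence [Eseq] to a multiple of another. *)
Lemma Eseq_corr_term N q a b d s r n j : (a < N)%nat -> (b < N)%nat -> (d < N)%nat ->
  (a + N * r = b + d + s)%nat ->
  (Eseq N q a (j + n + s) * (Eseq N q b j)^* = Cpow q r * Eseq N q d n * (Eseq N q b j * (Eseq N q b j)^*))%cx.
Proof.
  intros Ha Hb Hd E.
  destruct (block_decomp N j ltac:(lia)) as (t & j' & Hj & ->).
  destruct (block_decomp N n ltac:(lia)) as (t' & n' & Hn & ->).
  destruct (Nat.eq_dec j' b) as [->|Hjb].
  2:{ rewrite (Eseq_off N q b j' t) by auto. rewrite Cconj_C0. ring. }
  rewrite (Eseq_block N q b t) by auto.
  destruct (Nat.eq_dec n' d) as [->|Hnd].
  - rewrite (Eseq_block N q d t') by auto.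
    replace (N * t + b + (N * t' + d) + s)%nat with (N * (r + t' + t) + a)%nat by lia.
    rewrite Eseq_block by auto. rewrite !Cpow_add. ring.
  - rewrite (Eseq_off N q d n' t') by auto.
    destruct (block_decomp N (N * t + b + (N * t' + n') + s) ltac:(lia)) as (m & a' & Ha' & Em).
    rewrite Em. rewrite Eseq_off; [ring|auto|]. intros ->. apply Hnd.
    assert (E2 : (N * (t + t' + r) + n' = N * m + d)%nat) by lia.
    assert (n' = (N * m + d) mod N) by (rewrite <- E2; apply (Nat.mod_unique _ N (t + t' + r) n'); lia).
    rewrite <- (Nat.mod_unique (N * m + d) N m d) in H by lia. exact H.
Qed.

Section Periodic.
Variables (N : nat) (p : Cx).
Hypothesis HN : (2 <= N)%nat.
Hypothesis Hp : 0 < Cnorm p < 1.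
Let q := Cpow p N.
Let kap b := Cre (ip (Eseq N q b) (Eseq N q b)).

Lemma geo_Eseq b : geo (Eseq N q b).
Proof.
  (* The division n / N rounds down by less than N, which costs the factor [/ r ^ N]. *)
  set (r := Cnorm p) in *. assert (HrN : 0 < r ^ N) by (apply pow_lt; lra).
  exists (/ r ^ N), r. split; [left; now apply Rinv_0_lt_compat|split; [lra|]].
  intros n. unfold Eseq. pose proof (pow_lt r n ltac:(lra)).
  destruct (Nat.eqb (n mod N) b).
  - unfold q. rewrite !Cnorm_Cpow. fold r. rewrite <- pow_mult.
    apply Rmult_le_reg_l with (r ^ N); [auto|]. rewrite <- Rmult_assoc, Rinv_r, Rmult_1_l, <- pow_add by lra.
    set (m := (N + N * (n / N))%nat).
    assert (Hm : (n <= m)%nat).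
    { pose proof (Nat.div_mod n N ltac:(lia)). pose proof (Nat.mod_upper_bound n N ltac:(lia)). unfold m. lia. }
    replace m with (n + (m - n))%nat by lia. rewrite pow_add.
    rewrite <- (Rmult_1_r (r ^ n)) at 2. apply Rmult_le_compat_l; [lra|].
    rewrite <- (pow1 (m - n)). apply pow_incr; lra.
  - rewrite Cnorm_C0. apply Rmult_le_pos; [left; now apply Rinv_0_lt_compat|lra].
Qed.
Lemma fin_Eseq b : fin wH (Eseq N q b).
Proof. apply geo_fin, geo_Eseq. Qed.
Hint Resolve fin_Eseq : seqfin.

Lemma kap_pos b : (b < N)%nat -> 0 < kap b.
Proof.
  intros Hb. assert (F : fin w1 (Eseq N q b)) by sf.
  pose proof (bnd_point _ _ _ b weight_w1 (bnd_ip_self _ F)) as h. fold (kap b) in h.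
  pose proof (Eseq_block N q b 0 Hb) as e. replace (N * 0 + b)%nat with b in e by lia. rewrite e in h.
  cbn [Cpow] in h. unfold w1 in h. replace (Cnorm2 C1) with 1 in h by (cx_unfold; ring). lra.
Qed.
Lemma Gop_Eseq a b d s r : (a < N)%nat -> (b < N)%nat -> (d < N)%nat -> (a + N * r = b + d + s)%nat ->
  Gop s (Eseq N q a) (Eseq N q b) = sscal (Cpow q r * Cof (kap b))%cx (Eseq N q d).
Proof.
  intros Ha Hb Hd E. seq_ext n. unfold Gop, hank, sscal.
  transitivity (ip (sscal (Cpow q r * Eseq N q d n)%cx (Eseq N q b)) (Eseq N q b)).
  - apply ip_prod_ext. intros j. unfold shift, sscal. rewrite (Eseq_corr_term N q a b d s r) by auto. ring.
  - rewrite ip_scal_l by sf. rewrite ip_self_real by sf. fold (kap b). ring.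
Qed.
Lemma ip_Eseq_orth a b : (a < N)%nat -> (b < N)%nat -> a <> b -> ip (Eseq N q a) (Eseq N q b) = C0.
Proof.
  intros Ha Hb Hab. rewrite (ip_finite _ _ 0); [easy|]. intros n _.
  destruct (block_decomp N n ltac:(lia)) as (t & d & Hd & ->).
  destruct (Nat.eq_dec d a) as [->|H].
  - rewrite (Eseq_off N q b a) by auto. rewrite Cconj_C0. ring.
  - rewrite (Eseq_off N q a d) by auto. ring.
Qed.
Lemma Eseq_0 b : (b < N)%nat -> Eseq N q b 0 = if Nat.eqb b 0 then C1 else C0.
Proof.
  intros Hb. unfold Eseq. rewrite Nat.Div0.mod_0_l, Nat.Div0.div_0_l. rewrite (Nat.eqb_sym 0 b). easy.
Qed.
Lemma Gop_scal_l s c k x : fin w1 c -> fin w1 x -> Gop s (sscal k c) x = sscal k (Gop s c x).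
Proof. intros. unfold Gop. rewrite shift_sscal. apply hank_scal_l; sf. Qed.

Lemma Cmul_neq0 x y : x <> C0 -> y <> C0 -> (x * y)%cx <> C0.
Proof.
  intros Hx Hy E. apply Cnorm_pos in Hx, Hy. apply (f_equal Cnorm) in E. rewrite Cnorm_mul, Cnorm_C0 in E. nra.
Qed.
Lemma Cof_neq0 r : r <> 0 -> Cof r <> C0.
Proof. intros H E. apply H. now apply (f_equal Cre) in E. Qed.
Lemma Cconj_neq0 x : x <> C0 -> (x^*)%cx <> C0.
Proof. intros H E. apply H. rewrite <- (Cconj_conj x), E. apply Cconj_C0. Qed.
Lemma sscal_sscal k k' x : sscal k (sscal k' x) = sscal (k * k')%cx x.
Proof. seq_ext n. unfold sscal. ring. Qed.

(** H exchanges the classes l and 0, which are orthogonal, so [Theta] vanishes. As [c 0 = 0], the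
    antilinear term of the drift drops out and the square of <c, c> remains. *)
Lemma periodic_unstable_pos alpha l : alpha <> C0 -> (1 <= l)%nat -> (l < N)%nat ->
  orbitally_unstable (sscal alpha (Eseq N q l)).
Proof.
  intros Ha Hl1 Hl. set (c := sscal alpha (Eseq N q l)).
  assert (Hc : fin wH c) by (unfold c; sf).
  assert (Hk0 := kap_pos 0 ltac:(lia)). assert (Hkl := kap_pos l Hl).
  assert (Hal : 0 < Cnorm2 alpha) by (rewrite <- Cnorm_sqr; pose proof (Cnorm_pos _ Ha); nra).
  assert (G2 : Giter 0 c 2 = sscal (Cof (Cnorm2 alpha * kap l)) (Eseq N q 0)).
  { change (Giter 0 c 2) with (Gop 0 c (Giter 0 c 1)). rewrite Giter1_0. unfold c.
    rewrite Gop_scal_l, Gop_scal, (Gop_Eseq l l 0 0 0) by (sf; lia). rewrite !sscal_sscal. f_equal.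
    cbn [Cpow]. transitivity (alpha * alpha^* * Cof (kap l))%cx; [ring|]. rewrite Cmul_Cconj. cx_ring. }
  assert (G3 : Giter 0 c 3 = sscal (Cof (Cnorm2 alpha * kap l * kap 0)) c).
  { change (Giter 0 c 3) with (Gop 0 c (Giter 0 c 2)). rewrite G2, Gop_scal by sf. unfold c.
    rewrite Gop_scal_l, (Gop_Eseq l 0 l 0 0) by (sf; lia). rewrite !sscal_sscal, Cconj_Cof. f_equal.
    cbn [Cpow]. cx_ring. }
  apply (unstable_of_Theta_zero 0 c (Cnorm2 alpha * kap l * kap 0)); auto.
  - now rewrite G3, Giter1_0.
  - unfold Theta. rewrite G2, Giter1_0. unfold c. rewrite ip_scal_r, ip_scal_l, ip_Eseq_orth by (sf; lia). ring.
  - unfold drift. rewrite G2. change (Gop 0 c (dlt 0)) with (Giter 0 c 1). rewrite Giter1_0.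
    replace (c 0%nat) with C0.
    2:{ unfold c, sscal. rewrite Eseq_0 by auto. destruct (Nat.eqb_spec l 0); [lia|ring]. }
    unfold sscal at 1. rewrite Eseq_0 by lia. cbn [Nat.eqb].
    assert (E : ip c c = Cof (Cnorm2 alpha * kap l)).
    { unfold c. rewrite ip_scal_l, ip_scal_r, ip_self_real by sf. fold (kap l).
      transitivity (alpha * alpha^* * Cof (kap l))%cx; [ring|]. rewrite Cmul_Cconj. cx_ring. }
    rewrite E, Cconj_mul, Cconj_Cof, !Cconj_C1.
    replace (C1 * (Cof (Cnorm2 alpha * kap l) * C1) * Cof (Cnorm2 alpha * kap l) + C1 * (Giter 0 c 3 0%nat * C0))%cx
      with (Cof (Cnorm2 alpha * kap l) * Cof (Cnorm2 alpha * kap l))%cx by ring.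
    apply Cmul_neq0; apply Cof_neq0; nra.
Qed.

(** K exchanges the classes 0 and N - 1, distinct for N >= 2, so [Theta] again vanishes. The
    antilinear term of the drift drops out because K u, carried by the class N - 1, has no constant
    coefficient. *)
Lemma periodic_unstable_zero alpha : alpha <> C0 -> orbitally_unstable (sscal alpha (Eseq N q 0)).
Proof.
  intros Ha. set (c := sscal alpha (Eseq N q 0)).
  assert (Hc : fin wH c) by (unfold c; sf).
  assert (Hk0 := kap_pos 0 ltac:(lia)). assert (HkN := kap_pos (N - 1) ltac:(lia)).
  assert (Hal : 0 < Cnorm2 alpha) by (rewrite <- Cnorm_sqr; pose proof (Cnorm_pos _ Ha); nra).
  assert (Hq : 0 < Cnorm2 q).
  { rewrite <- Cnorm_sqr. unfold q. rewrite Cnorm_Cpow. pose proof (pow_lt (Cnorm p) N ltac:(lra)). nra. }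
  set (g := (Cof (Cnorm2 alpha * kap 0) * q)%cx).
  assert (G1 : Giter 1 c 1 = sscal g (Eseq N q (N - 1))).
  { change (Giter 1 c 1) with (Gop 1 c c). unfold c.
    rewrite Gop_scal_l, Gop_scal, (Gop_Eseq 0 0 (N - 1) 1 1) by (sf; lia). rewrite !sscal_sscal. f_equal.
    cbn [Cpow]. transitivity (alpha * alpha^* * Cof (kap 0) * q)%cx; [ring|]. rewrite Cmul_Cconj. unfold g. cx_ring. }
  set (k := Cnorm2 alpha * kap 0 * Cnorm2 q * kap (N - 1)).
  assert (Hk : 0 < k) by (unfold k; repeat apply Rmult_lt_0_compat; auto).
  assert (G2 : Giter 1 c 2 = sscal (Cof k) c).
  { change (Giter 1 c 2) with (Gop 1 c (Giter 1 c 1)). rewrite G1, Gop_scal by sf. unfold c.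
    rewrite Gop_scal_l, (Gop_Eseq 0 (N - 1) 0 1 1) by (sf; lia). rewrite !sscal_sscal. f_equal.
    cbn [Cpow]. unfold g. rewrite Cconj_mul, Cconj_Cof.
    transitivity (Cof (Cnorm2 alpha * kap 0) * (q * q^*) * Cof (kap (N - 1)) * alpha)%cx; [ring|].
    rewrite Cmul_Cconj. unfold k. cx_ring. }
  apply (unstable_of_Theta_zero 1 c k); auto.
  - change (Giter 1 c 3) with (Gop 1 c (Giter 1 c 2)). rewrite G2, Gop_scal, Cconj_Cof by sf. easy.
  - unfold Theta. rewrite G1, G2. unfold c. rewrite !ip_scal_r, ip_scal_l, ip_Eseq_orth by (sf; lia). ring.
  - assert (c0 : c 0%nat = alpha) by (unfold c, sscal; rewrite Eseq_0 by lia; cbn [Nat.eqb]; ring).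
    assert (E : ip (Giter 1 c 1) (Gop 1 c (dlt 0)) = (Cof k * alpha^*)%cx).
    { change (Giter 1 c 1) with (Gop 1 c c). rewrite Gop_sym by sf.
      rewrite Gop2_sym by sf. change (Gop 1 c (Gop 1 c c)) with (Giter 1 c 2). rewrite G2, ip_scal_r, Cconj_Cof by sf.
      f_equal. rewrite <- ip_conj by sf. rewrite ip_dlt_r. now rewrite c0. }
    unfold drift. rewrite E, G2.
    replace (Giter 1 c 1 0%nat) with C0.
    2:{ rewrite G1. unfold sscal. rewrite Eseq_0 by lia. destruct (Nat.eqb_spec (N - 1) 0); [lia|ring]. }
    unfold sscal. rewrite c0, Cconj_mul, Cconj_Cof.
    replace (C1 * (Cof k * alpha^*) * (Cof k * alpha^*) + C1^* * (Giter 1 c 3 0%nat * C0))%cx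
      with ((Cof k * alpha^*) * (Cof k * alpha^*))%cx by ring.
    assert (Cof k <> C0) by (apply Cof_neq0; lra). pose proof (Cconj_neq0 _ Ha).
    repeat apply Cmul_neq0; auto.
Qed.

(** Multiplying by the denominator leaves alpha z^l; uniqueness of coefficients turns this into a
    recursion of step N, solved block by block. *)
Lemma phi_b_coef alpha l c : (l < N)%nat -> is_taylor c (phi_b alpha N l p) -> c = sscal alpha (Eseq N q l).
Proof.
  intros Hl Hc.
  assert (E : seq_sub c (sscal q (rsh N c)) = sscal alpha (dlt l)).
  { apply psum_coef_unique. intros z Hz. exists (alpha * Cpow z l)%cx. split.
    - assert (h : psum c z (phi_b alpha N l p z)) by (now apply Hc).
      pose proof (psum_sub _ _ _ _ _ h (psum_scal q _ _ _ (psum_rsh N _ _ _ h))) as h2.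
      replace (alpha * Cpow z l)%cx with (phi_b alpha N l p z - q * (Cpow z N * phi_b alpha N l p z))%cx; auto.
      assert (Hn : (C1 - q * Cpow z N)%cx <> C0).
      { apply one_sub_neq0. unfold q. rewrite Cnorm_mul, !Cnorm_Cpow, <- Rpow_mult_distr.
        pose proof (Cnorm_ge0 z). assert (0 <= Cnorm p * Cnorm z < 1) by nra.
        destruct N as [|m]; [lia|]. cbn [pow].
        assert ((Cnorm p * Cnorm z) ^ m <= 1) by (rewrite <- (pow1 m); apply pow_incr; lra).
        pose proof (pow_le (Cnorm p * Cnorm z) m ltac:(lra)). nra. }
      unfold phi_b, Cdiv. fold q. pose proof (Cmul_Cinv _ Hn) as Ei. set (I := Cinv _) in *.
      transitivity (alpha * Cpow z l * ((C1 - q * Cpow z N) * I))%cx; [ring|]. rewrite Ei; ring.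
    - replace (alpha * Cpow z l)%cx with (alpha * (Cpow z l * C1))%cx by ring.
      rewrite <- rsh_dlt. apply psum_scal, psum_rsh, psum_dlt0. }
  assert (Ec : forall n, c n = (alpha * dlt l n + q * rsh N c n)%cx).
  { intros n. apply (f_equal (fun x => x n)) in E. unfold seq_sub, sscal in E. rewrite <- E. ring. }
  assert (H : forall t d, (d < N)%nat -> c (N * t + d)%nat = sscal alpha (Eseq N q l) (N * t + d)%nat).
  { induction t as [|t IH]; intros d Hd; rewrite Ec; unfold sscal, rsh.
    - rewrite (proj2 (Nat.leb_gt N (N * 0 + d))) by lia.
      replace (N * 0 + d)%nat with d by lia. unfold dlt. destruct (Nat.eqb_spec d l) as [->|Hdl].
      + pose proof (Eseq_block N q l 0 Hl) as e. replace (N * 0 + l)%nat with l in e by lia. rewrite e. cbn [Cpow]. ring.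
      + pose proof (Eseq_off N q l d 0 Hd Hdl) as e. replace (N * 0 + d)%nat with d in e by lia. rewrite e. ring.
    - rewrite (proj2 (Nat.leb_le N (N * S t + d))) by lia.
      replace (N * S t + d - N)%nat with (N * t + d)%nat by lia. rewrite IH by auto. unfold sscal, dlt.
      destruct (Nat.eqb_spec (N * S t + d) l); [lia|].
      destruct (Nat.eq_dec d l) as [->|Hdl].
      + rewrite !Eseq_block by auto. cbn [Cpow]. ring.
      + rewrite !Eseq_off by auto. ring. }
  seq_ext n. destruct (block_decomp N n ltac:(lia)) as (t & d & Hd & ->). now apply H.
Qed.
End Periodic.

Theorem theorem4 :
  (forall (alpha : Cx) (N : nat) (p : nat -> Cx) (c : nat -> Cx),
      alpha <> C0 -> (1 <= N)%nat ->
      (forall j, (j < N)%nat -> Cnorm (p j) < 1) ->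
      is_taylor c (blaschke_phi alpha N p) ->
      orbitally_unstable c) /\
  (forall (alpha : Cx) (N l : nat) (p : Cx) (c : nat -> Cx),
      alpha <> C0 -> (2 <= N)%nat -> (l <= N - 1)%nat ->
      0 < Cnorm p < 1 ->
      is_taylor c (phi_b alpha N l p) ->
      orbitally_unstable c).
Proof.
  split.
  - exact blaschke_unstable.
  - intros alpha N l p c Ha HN Hl Hp Hc.
    rewrite (phi_b_coef N p HN Hp alpha l c ltac:(lia) Hc). destruct l as [|l].
    + now apply periodic_unstable_zero.
    + apply periodic_unstable_pos; auto; lia.
Qed.
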